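(* Assume that $f_+, f_-\colon \Omega\to\mathbb{R}$ are continuous functions such that $$f_+(x)=\lim_{s\to+\infty} f(x,s)\quad\text{and}\quad f_-(x)=\lim_{s\to-\infty} f(x,s)\qquad\text{for } x\in\Omega.$$ (i) If $$\int_{\{\bar u>0\}} f_+(x)\bar u(x)\,dx+\int_{\{\bar u<0\}} f_-(x)\bar u(x)\,dx>0\qquad\text{for every }\bar u\in\mathrm{Ker}(\lambda I-A_p)\setminus\{0\},$$ then for all balls $B_1\subset X^\alpha_+\oplus X^\alpha_-$ and $B_2\subset X_0$ there is $R>0$ such that $$\langle F(x+y),x\rangle_H>-\langle F(x+y),z\rangle_H$$ for all $(y,z)\in B_1\times B_2$ and all $x\in X_0$ with $\|x\|_H\ge R$. (ii) If $$\int_{\{\bar u>0\}} f_+(x)\bar u(x)\,dx+\int_{\{\bar u<0\}} f_-(x)\bar u(x)\,dx<0\qquad\text{for every }\bar u\in\mathrm{Ker}(\lambda I-A_p)\setminus\{0\},$$ then for all balls $B_1\subset X^\alpha_+\oplus X^\alpha_-$ and $B_2\subset X_0$ there is $R>0$ such that $$\langle F(x+y),x\rangle_H<-\langle F(x+y),z\rangle_H$$ for all $(y,z)\in B_1\times B_2$ and all $x\in X_0$ with $\|x\|_H\ge R$.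
   Context: Let $\Omega\subset\mathbb{R}^n$ be an open bounded set with $C^\infty$ boundary, and let $f\colon\overline\Omega\times\mathbb{R}\to\mathbb{R}$ be a continuous bounded map such that: - for every $R>0$ there is $L>0$ such that $|f(x,s_1)-f(x,s_2)|\le L|s_1-s_2|$ for $x\in\Omega$ and $s_1,s_2\in\mathbb{R}$ with $|s_1|,|s_2|\le R$; - $f$ is of class $C^1$, there is a constant $\nu\in\mathbb{R}$ with $D_sf(x,0)=\nu$ for $x\in\Omega$, and $f(x,0)=0$ for $x\in\Omega$. Fix $\alpha\in(3/4,1)$ and $p\ge 2n$ with $p\geq 2$. Put $X:=L^p(\Omega)$ and let $A_p\colon X\supset D(A_p)\to X$ be $A_p\bar u:=-\Delta\bar u$ with Dirichlet boundary conditions, $D(A_p):=W^{2,p}(\Omega)\cap W^{1,p}_0(\Omega)$. It is a positive sectorial operator with compact resolvents; its spectrum consists of eigenvalues $\lambda_1<\lambda_2<\dots$ of finite multiplicity. Let $X^\alpha:=D(A_p^\alpha)$ be the fractional power space with norm $\|u\|_\alpha:=\|A_p^\alpha u\|_{L^p}$; one has a continuous inclusion $X^\alpha\subset C(\overline\Omega)$. The Nemytskii operator $F\colon X^\alpha\to X$ is $F(\bar u)(x):=f(x,\bar u(x))$, $x\in\Omega$. Let $H:=L^2(\Omega)$ with its standard inner product $\langle\cdot,\cdot\rangle_H$ and norm $\|\cdot\|_H$; $X\subset H$. Assume $\lambda=\lambda_k$ for some $k\ge1$ (resonance). Put $X_0:=\mathrm{Ker}(\lambda I-A_p)$, $X_-:=\bigoplus_{i=1}^{k-1}\mathrm{Ker}(\lambda_iI-A_p)$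 ($X_-=\{0\}$ if $k=1$), and let $X_+$ be the closed subspace of $X$ of all elements that are $L^2$-orthogonal to $X_0\oplus X_-$, so that $X=X_0\oplus X_-\oplus X_+$. Put $X^\alpha_\pm:=X^\alpha\cap X_\pm$. Balls in $X^\alpha_+\oplus X^\alpha_-$ are taken with respect to the norm of $X^\alpha$; $X_0$ is finite dimensional. *)

(* Defs.v *)
From HB Require Import structures.
From mathcomp Require Import all_boot all_order all_algebra.
From mathcomp Require Import all_classical all_reals all_analysis.

Set Implicit Arguments.
Unset Strict Implicit.
Unset Printing Implicit Defensive.
Import Order.TTheory GRing.Theory Num.Theory.
Import numFieldNormedType.Exports.

Local Open Scope classical_set_scope.
Local Open Scope ring_scope.

(* The sigma-algebra on R^n generated by the coordinate maps, as the library
   does for n.-tuple; it is the Borel sigma-algebra. *)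
Section rV_measurable.
Context (R : realType) (n : nat).

Let coor : 'I_n -> 'rV[R]_n -> R := fun i x => x ord0 i.

Let rV_set0 : g_sigma_preimage coor set0.
Proof. exact: sigma_algebra0. Qed.

Let rV_setC A : g_sigma_preimage coor A -> g_sigma_preimage coor (~` A).
Proof. exact: sigma_algebraC. Qed.

Let rV_bigcup (F : _^nat) : (forall i, g_sigma_preimage coor (F i)) ->
  g_sigma_preimage coor (\bigcup_i (F i)).
Proof. exact: sigma_algebra_bigcup. Qed.

HB.instance Definition _ := @isMeasurable.Build
  (measure_tuple_display default_measure_display) 'rV[R]_n
  (g_sigma_preimage coor) rV_set0 rV_setC rV_bigcup.

End rV_measurable.

Section cons_rV.
Context (R : realType) (n : nat).
Implicit Types (z : measurableTypeR R * 'rV[R]_n) (x : 'rV[R]_n.+1).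

Definition cons_rV z : 'rV[R]_n.+1 :=
  \row_i (if unlift ord0 i is Some j then z.2 ord0 j else z.1).

Definition uncons_rV x : measurableTypeR R * 'rV[R]_n :=
  (x ord0 ord0, \row_i x ord0 (lift ord0 i)).

Lemma cons_rVK : cancel cons_rV uncons_rV.
Proof.
move=> [a v]; congr (_, _); first by rewrite mxE unlift_none.
by apply/rowP => i; rewrite !mxE liftK.
Qed.

Lemma uncons_rVK : cancel uncons_rV cons_rV.
Proof.
by move=> x; apply/rowP => i; rewrite mxE; case: unliftP => [j|] ->; rewrite ?mxE.
Qed.

End cons_rV.

Lemma measurable_coor (R : realType) (n : nat) (i : 'I_n) :
  measurable_fun setT (fun x : 'rV[R]_n => x ord0 i).
Proof.
move=> _ Y mY; rewrite setTI; apply: sub_sigma_algebra => /=.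
rewrite -bigcup_seq/=; exists i => /=; first by rewrite mem_index_enum.
by exists Y => //; rewrite setTI.
Qed.

Lemma measurable_fun_rVP d (T : measurableType d) (R : realType) (n : nat)
    (f : T -> 'rV[R]_n) :
  (forall i, measurable_fun setT (fun t => f t ord0 i)) ->
  measurable_fun setT f.
Proof.
move=> mf; apply: (@measurability _ _ _ _ setT f
  (\big[setU/set0]_(i < n) preimage_set_system setT
    (fun x : 'rV[R]_n => x ord0 i) measurable)) => //.
move=> _ [A + <-]; rewrite -bigcup_seq => -[i _ [B mB <-]].
by have := mf i measurableT B mB; rewrite !setTI.
Qed.

Lemma measurable_cons_rV (R : realType) (n : nat) :
  measurable_fun setT (@cons_rV R n).
Proof.
apply: measurable_fun_rVP => i; case: (unliftP ord0 i) => [j|] ->.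
  rewrite (_ : (fun _ => _) = (fun x : 'rV[R]_n => x ord0 j) \o snd); last first.
    by apply/funext => z; rewrite mxE liftK.
  exact: (measurableT_comp (measurable_coor j) measurable_snd).
rewrite (_ : (fun _ => _) = fst); first exact: measurable_fst.
by apply/funext => z; rewrite mxE unlift_none.
Qed.

Lemma measurable_uncons_rV (R : realType) (n : nat) :
  measurable_fun setT (@uncons_rV R n).
Proof.
apply/measurable_fun_pairP; split; first exact: measurable_coor.
apply: measurable_fun_rVP => i; rewrite (_ : (fun _ => _) =
  (fun x : 'rV[R]_n.+1 => x ord0 (lift ord0 i))); first exact: measurable_coor.
by apply/funext => z; rewrite mxE.
Qed.

Section cons_measure.
Local Open Scope ereal_scope.
Context (R : realType) (n : nat).
Variable mu : {sigma_finite_measure set 'rV[R]_n -> \bar R}.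

Definition cons_measure : set 'rV[R]_n.+1 -> \bar R :=
  pushforward (@lebesgue_measure R \x mu) (@cons_rV R n).

Let cons_measure0 : cons_measure set0 = 0.
Proof. exact: (measure0 (@lebesgue_measure R \x mu)). Qed.

Let cons_measure_ge0 A : 0 <= cons_measure A.
Proof. exact: (measure_ge0 (@lebesgue_measure R \x mu)). Qed.

Let cons_measure_sigma_additive : semi_sigma_additive cons_measure.
Proof.
have mcons A : measurable A -> measurable (@cons_rV R n @^-1` A).
  by move=> mA; rewrite -[X in measurable X]setTI; exact: measurable_cons_rV.
move=> F mF tF mUF; rewrite /cons_measure /pushforward preimage_bigcup.
apply: measure_semi_sigma_additive.
- by move=> k; exact: mcons.
- apply/trivIsetP => /= i j _ _ ij; rewrite -preimage_setI.
  by move/trivIsetP : tF => /(_ _ _ _ _ ij) ->//; rewrite preimage_set0.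
- by rewrite -preimage_bigcup; exact: mcons.
Qed.

HB.instance Definition _ := isMeasure.Build _ _ _ cons_measure
  cons_measure0 cons_measure_ge0 cons_measure_sigma_additive.

Let cons_measure_sigma_finite : sigma_finite setT cons_measure.
Proof.
have /sigma_finiteP[F [TF ndF Foo]] := sigma_finiteT (@lebesgue_measure R).
have /sigma_finiteP[G [TG ndG Goo]] := sigma_finiteT mu.
exists (fun k => @uncons_rV R n @^-1` (F k `*` G k)).
  rewrite -preimage_bigcup (_ : \bigcup_k _ = setT) ?preimage_setT//.
  rewrite -setXTT TF TG predeqE => -[x y]; split.
    by move=> [k _ []/= ? ?]; split; exists k.
  move=> [/= [k _ Fkx] [l _ Gly]]; exists (maxn k l) => //; split.
  - by move: x Fkx; exact/subsetPset/ndF/leq_maxl.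
  - by move: y Gly; exact/subsetPset/ndG/leq_maxr.
move=> k; have [mF Fk] := Foo k; have [mG Gk] := Goo k; split.
  rewrite -[X in measurable X]setTI.
  by apply: measurable_uncons_rV => //; exact: measurableX.
rewrite /cons_measure /pushforward -comp_preimage.
rewrite (_ : _ \o _ = id); last by apply/funext => z; exact: cons_rVK.
by rewrite preimage_id product_measure1E// lte_mul_pinfty// ge0_fin_numE.
Qed.

HB.instance Definition _ := Measure_isSigmaFinite.Build _ _ _ cons_measure
  cons_measure_sigma_finite.

End cons_measure.

(* Lebesgue measure on R^n. *)
Fixpoint leb (R : realType) (n : nat) :
    {sigma_finite_measure set 'rV[R]_n -> \bar R} :=
  if n is m.+1 then cons_measure (leb R m) else dirac (0 : 'rV[R]_0).

Section function_spaces.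
Context (R : realType) (n : nat).
Implicit Types (Omega : set 'rV[R]_n) (p : R) (s : seq 'I_n).
Implicit Types (u v w phi : 'rV[R]_n -> R).

Definition partial (i : 'I_n) u : 'rV[R]_n -> R :=
  fun x => 'D_(delta_mx 0 i) u x.

Definition partials s u : 'rV[R]_n -> R := foldr partial u s.

Definition smooth u := forall s, continuous (partials s u) /\
  forall i x, derivable (partials s u) x (delta_mx 0 i).

Definition test_function Omega phi := let supp := closure [set x | phi x != 0] in
  [/\ smooth phi, compact supp & supp `<=` Omega].

(* Near each boundary point, after choosing a coordinate i and an orientation
   b, Omega is the strict epigraph of a smooth function g of the other
   coordinates (g is a function on R^n that ignores the i-th coordinate). *)
Definition smooth_boundary Omega := forall x, (closure Omega `\` Omega) x ->
  exists (i : 'I_n) (b : bool) (g : 'rV[R]_n -> R) (r : R),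
  [/\ smooth g, (forall y t, g (y + t *: delta_mx 0 i) = g y), 0 < r &
      forall y, ball x r y -> (Omega y <-> g y < (-1) ^+ b * y ord0 i)].

(* Elements of L^p(Omega) are represented by functions on R^n whose values
   outside Omega are irrelevant; equality in L^p(Omega) is [ae_eq _ Omega]. *)
Definition Lp Omega p : set ('rV[R]_n -> R) :=
  [set u | u \_ Omega \in Lfun (leb R n) p%:E].

Definition Lp_norm Omega p u : R :=
  fine 'N[leb R n]_(p%:E)[EFin \o (u \_ Omega)]%E.

Definition L2_inner Omega u v : R := \int[leb R n]_(x in Omega) (u x * v x).

Definition weak_partial Omega s u v := forall phi, test_function Omega phi ->
  L2_inner Omega u (partials s phi) = (-1) ^+ size s * L2_inner Omega v phi.

(* W^{m,p}(Omega) *)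
Definition sobolev Omega (m : nat) p : set ('rV[R]_n -> R) :=
  [set u | Lp Omega p u /\ forall s, (size s <= m)%N ->
     exists2 v, Lp Omega p v & weak_partial Omega s u v].

(* A representative of the weak derivative, unique up to a.e. equality. *)
Definition wpartial Omega p s u : 'rV[R]_n -> R :=
  get [set v | Lp Omega p v /\ weak_partial Omega s u v].

(* W^{1,p}_0(Omega), the closure of the test functions in W^{1,p}(Omega) *)
Definition sobolev0 Omega p : set ('rV[R]_n -> R) :=
  [set u | sobolev Omega 1 p u /\
     exists2 phi : nat -> 'rV[R]_n -> R, (forall k, test_function Omega (phi k)) &
       forall s, (size s <= 1)%N ->
         Lp_norm Omega p (wpartial Omega p s u \- partials s (phi k))
           @[k --> \oo] --> (0 : R)].

(* Domain and action of A_p = - Laplacian, with Dirichlet boundary conditions. *)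
Definition domA Omega p : set ('rV[R]_n -> R) :=
  sobolev Omega 2 p `&` sobolev0 Omega p.

Definition opA Omega p u : 'rV[R]_n -> R :=
  fun x => - \sum_(i < n) wpartial Omega p [:: i; i] u x.

Definition kerA Omega p (mu : R) : set ('rV[R]_n -> R) :=
  [set u | domA Omega p u /\
     ae_eq (leb R n) Omega (opA Omega p u) (fun x => mu * u x)].

Definition eigenvalueA Omega p (mu : R) :=
  exists2 u, kerA Omega p mu u & ~ ae_eq (leb R n) Omega u (cst 0).

(* u = A_p^{-alpha} w for 0 < alpha < 1, by Balakrishnan's formula
     A^{-alpha} w = sin(pi alpha)/pi \int_0^oo t^{-alpha} (t I + A)^{-1} w dt,
   the L^p(Omega)-valued integral being tested against the dual L^{p'}(Omega);
   r t stands for (t I + A_p)^{-1} w. *)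
Definition neg_powA Omega p (alpha : R) w u :=
  [/\ Lp Omega p w, Lp Omega p u &
    exists2 r : R -> 'rV[R]_n -> R,
      (forall t, 0 < t -> domA Omega p (r t) /\
        ae_eq (leb R n) Omega (fun x => t * r t x + opA Omega p (r t) x) w) &
      forall phi, Lp Omega (p / (p - 1)) phi ->
        let g t := t `^ (- alpha) * L2_inner Omega (r t) phi in
        lebesgue_measure.-integrable `]0, +oo[ (EFin \o g) /\
        L2_inner Omega u phi =
          sin (pi * alpha) / pi * \int[lebesgue_measure]_(t in `]0, +oo[) g t].

(* X^alpha = D(A_p^alpha) is the range of A_p^{-alpha} and A_p^alpha is the
   inverse of A_p^{-alpha}. *)
Definition Xalpha Omega p (alpha : R) : set ('rV[R]_n -> R) :=
  [set u | exists w, neg_powA Omega p alpha w u].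

Definition powA Omega p (alpha : R) u : 'rV[R]_n -> R :=
  get [set w | neg_powA Omega p alpha w u].

Definition Xalpha_norm Omega p (alpha : R) u : R :=
  Lp_norm Omega p (powA Omega p alpha u).

(* The spectrum consists of the eigenvalues, numbered here from 0. *)
Definition eigenvalue_enum Omega p (lam : nat -> R) :=
  (forall i j, (i < j)%N -> lam i < lam j) /\
  (forall mu, eigenvalueA Omega p mu <-> exists i, lam i = mu).

Definition Xminus Omega p (lam : nat -> R) (k : nat) : set ('rV[R]_n -> R) :=
  [set u | Lp Omega p u /\ exists2 v : 'I_k -> 'rV[R]_n -> R,
     (forall i : 'I_k, kerA Omega p (lam i) (v i)) &
     ae_eq (leb R n) Omega u (fun x => \sum_(i < k) v i x)].

Definition Xplus Omega p (lam : nat -> R) (k : nat) : set ('rV[R]_n -> R) :=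
  [set u | Lp Omega p u /\ forall v0 v1, kerA Omega p (lam k) v0 ->
     Xminus Omega p lam k v1 -> L2_inner Omega u (v0 \+ v1) = 0].

Definition Xalpha_pm Omega p alpha lam k : set ('rV[R]_n -> R) :=
  [set y | exists yp ym,
     [/\ (Xalpha Omega p alpha `&` Xplus Omega p lam k) yp,
         (Xalpha Omega p alpha `&` Xminus Omega p lam k) ym & y = yp \+ ym]].

Definition ball_pm Omega p alpha lam k (c : 'rV[R]_n -> R) (r : R) :=
  [set y | Xalpha_pm Omega p alpha lam k y /\
     Xalpha_norm Omega p alpha (y \- c) < r].

Definition ball_ker Omega p (mu : R) (c : 'rV[R]_n -> R) (r : R) :=
  [set z | kerA Omega p mu z /\ Lp_norm Omega 2 (z \- c) < r].

End function_spaces.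

Section nonlinearity.
Context (R : realType) (n : nat).
Variables (Omega : set 'rV[R]_n) (f : 'rV[R]_n -> R -> R).

Definition continuous_cyl (g : 'rV[R]_n -> R -> R) :=
  {within closure Omega `*` [set: R],
    continuous (fun z : 'rV[R]_n * R => g z.1 z.2)}.

Definition bounded_cyl :=
  exists M : R, forall x s, closure Omega x -> `|f x s| <= M.

Definition locally_lipschitz_s := forall rho : R, 0 < rho ->
  exists2 L : R, 0 < L & forall x s1 s2, Omega x -> `|s1| <= rho ->
    `|s2| <= rho -> `|f x s1 - f x s2| <= L * `|s1 - s2|.

(* The partial derivatives exist on Omega x R and extend continuously to the
   closure. *)
Definition C1_cyl := exists (fx : 'I_n -> 'rV[R]_n -> R -> R) fs,
  [/\ forall i, continuous_cyl (fx i), continuous_cyl fs &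
      forall x s, Omega x ->
        (forall i, is_derive x (delta_mx 0 i) (f ^~ s) (fx i x s)) /\
        is_derive s 1 (f x) (fs x s)].

Definition nemytskii (u : 'rV[R]_n -> R) : 'rV[R]_n -> R :=
  fun x => f x (u x).

End nonlinearity.

Definition landesman_lazer (R : realType) (n : nat) (Omega : set 'rV[R]_n)
    (fp fm u : 'rV[R]_n -> R) : R :=
  \int[leb R n]_(x in Omega `&` [set x | 0 < u x]) (fp x * u x) +
  \int[leb R n]_(x in Omega `&` [set x | u x < 0]) (fm x * u x).

(* Main.v *)
Require Import Defs.
From mathcomp Require Import all_boot all_order all_algebra.
From mathcomp Require Import all_classical all_reals all_analysis.
From mathcomp Require Import measurable_realfun ring lra.
Import Order.TTheory GRing.Theory Num.Theory.
Import numFieldNormedType.Exports.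
Local Open Scope classical_set_scope.
Local Open Scope ring_scope.

Set Implicit Arguments.
Unset Strict Implicit.
Unset Printing Implicit Defensive.

(** Write |.| for the norm of L^2 and suppose that no radius works. Then there are
    kernel elements x_k whose norms N_k = |x_k| grow geometrically, together with
    bounded y_k and z_k, that violate the inequality. The normalised elements
    u_k = x_k / N_k lie in the unit sphere of an eigenspace, so that a subsequence
    converges in L^2 and almost everywhere to some u of norm 1 in the eigenspace.
    Since y_k stays bounded in L^2, y_k / N_k tends to 0 almost everywhere, hence
    x_k + y_k = N_k (u_k + y_k / N_k) tends to +oo where u > 0 and to -oo where
    u < 0. As f is bounded, dominated convergence yields
    < F(x_k + y_k), u > --> int_{u>0} f_+ u + int_{u<0} f_- u, while
    < F(x_k + y_k), u_k - u > and < F(x_k + y_k), z_k > / N_k tend to 0. So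
    N_k^-1 (< F(x_k + y_k), x_k > + < F(x_k + y_k), z_k >) tends to the
    Landesman-Lazer integral of u ([resonance_limit]), whose sign is prescribed:
    a contradiction.

    Two facts about the Dirichlet Laplacian A enter, both derived from
    inequalities for test functions.

    The unit sphere of an eigenspace is compact ([kerA_selection]). Cutting a cube
    that contains Omega into small cells and comparing phi with its mean on each
    cell gives
      |phi|^2 <= C sum_t < phi, 1_{Q_t} >^2 + e |grad phi|^2
    with e as small as desired ([rellich_functionals]). By Green's formula
    ([green]) it extends to the domain of A with < A u, u > in place of
    |grad u|^2; on an eigenspace < A u, u > is a multiple of |u|^2 and is absorbed
    by the left-hand side. So finitely many linear functionals control the norm,
    and Bolzano-Weierstrass applies to their values.

    Balls of X^alpha are bounded in L^2 ([Xalpha_bound]). The Poincare inequality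
    gives < A u, u > >= c |u|^2, hence |(t + A)^-1 w| <= |w| / (t + c), and in
    Balakrishnan's formula the weight t^-alpha / (t + c) is integrable on
    ]0, +oo[.

    Weak derivatives are determined up to null sets by the fundamental lemma of
    the calculus of variations ([ae0_of_test]); this makes the operator and its
    fractional powers linear, so that differences of elements of X^alpha can be
    estimated. *)

(** * Square-integrable functions *)

Section square_integrable.
Context d (T : measurableType d) (R : realType).
Variables (mu : {measure set T -> \bar R}) (D : set T).
Hypothesis mD : measurable D.
Implicit Types (u v w : T -> R) (a b : R).

Definition sqint u :=
  measurable_fun D u /\ mu.-integrable D (EFin \o (fun x => u x ^+ 2)).

Definition dotL2 u v : R := \int[mu]_(x in D) (u x * v x).

Definition normL2 u : R := Num.sqrt (dotL2 u u).

Local Notation ip := dotL2.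
Local Notation nrm := normL2.

Lemma sqint_mul u v : sqint u -> sqint v ->
  mu.-integrable D (EFin \o (fun x => u x * v x)).
Proof.
move=> [mu_ iu] [mv iv].
apply: (le_integrable mD (g := EFin \o (fun x => u x ^+ 2 + v x ^+ 2))).
- by apply/measurable_EFinP; exact: measurable_funM.
- move=> x _ /=; rewrite lee_fin.
  rewrite normrM [leRHS]ger0_norm ?addr_ge0 ?sqr_ge0//.
  rewrite -(real_normK (num_real (u x))) -(real_normK (num_real (v x))).
  have := sqr_ge0 (`|u x| - `|v x|); have := sqr_ge0 (`|u x| + `|v x|).
  nra.
- exact: (integrableD mD iu iv).
Qed.

Lemma sqintD u v : sqint u -> sqint v -> sqint (u \+ v).
Proof.
move=> su sv; have iuv := sqint_mul su sv; case: su sv => [mu_ iu] [mv iv].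
split; first exact: measurable_funD.
have := integrableD mD (integrableD mD iu iv) (integrableZl mD 2 iuv).
apply: eq_integrable => // x _ /=; rewrite -!EFinM -!EFinD; congr EFin; ring.
Qed.

Lemma sqintZ a u : sqint u -> sqint (a \*o u).
Proof.
move=> [mu_ iu]; split; first exact: measurable_funM.
have := integrableZl mD (a ^+ 2) iu.
by apply: eq_integrable => // x _ /=; rewrite -EFinM exprMn.
Qed.

Lemma sqintB u v : sqint u -> sqint v -> sqint (u \- v).
Proof.
move=> su sv; have := sqintD su (sqintZ (-1) sv).
by congr sqint; apply/funext => x /=; rewrite mulN1r.
Qed.

Lemma sqint0 : sqint (cst 0).
Proof.
split=> //; have := @integrable0 _ _ _ mu D.
by apply: eq_integrable => // x _ /=; rewrite expr0n.
Qed.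

Lemma sqint_sum (I : Type) (s : seq I) (u : I -> T -> R) :
  (forall i, sqint (u i)) -> sqint (fun x => \sum_(i <- s) u i x).
Proof.
move=> su; elim: s => [|i s ih].
  by under eq_fun do rewrite big_nil; exact: sqint0.
by under eq_fun do rewrite big_cons; exact: sqintD.
Qed.

Lemma sqint_cst a : (mu D < +oo)%E -> sqint (cst a).
Proof.
move=> fD; split; first exact: measurable_cst.
apply/integrableP; split.
  by apply/measurable_EFinP/measurable_funX; exact: measurable_cst.
rewrite (eq_integral (cst (`|(a ^+ 2)%:E|)%E))//.
by rewrite integral_cst// lte_mul_pinfty.
Qed.

Lemma sqint_le u v : measurable_fun D u -> (forall x, D x -> `|u x| <= `|v x|) ->
  sqint v -> sqint u.
Proof.
move=> mu_ uv [mv iv]; split=> //.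
apply: le_integrable iv => //.
  by apply/measurable_EFinP; exact: measurable_funX.
by move=> x /uv h /=; rewrite lee_fin !normrX lerXn2r// nnegrE.
Qed.

Lemma sqint_bounded u a : (mu D < +oo)%E -> measurable_fun D u ->
  (forall x, D x -> `|u x| <= a) -> sqint u.
Proof.
move=> fD mu_ ua; apply: sqint_le (sqint_cst a fD) => // x /ua h /=.
exact: le_trans h (ler_norm _).
Qed.

Lemma ipC u v : ip u v = ip v u.
Proof. by apply: eq_Rintegral => x _; rewrite mulrC. Qed.

Lemma ipDl u v w : sqint u -> sqint v -> sqint w ->
  ip (u \+ v) w = ip u w + ip v w.
Proof.
move=> su sv sw; rewrite -RintegralD//; try exact: sqint_mul.
by apply: eq_Rintegral => x _ /=; rewrite mulrDl.
Qed.

Lemma ipZl a u v : sqint u -> sqint v -> ip (a \*o u) v = a * ip u v.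
Proof.
move=> su sv; rewrite -RintegralZl//; last exact: sqint_mul.
by apply: eq_Rintegral => x _ /=; rewrite mulrA.
Qed.

Lemma ipBl u v w : sqint u -> sqint v -> sqint w ->
  ip (u \- v) w = ip u w - ip v w.
Proof.
move=> su sv sw; rewrite -RintegralB//; try exact: sqint_mul.
by apply: eq_Rintegral => x _ /=; rewrite mulrBl.
Qed.

Lemma ipDr u v w : sqint u -> sqint v -> sqint w ->
  ip w (u \+ v) = ip w u + ip w v.
Proof. by move=> *; rewrite !(ipC w) ipDl. Qed.

Lemma ipZr a u v : sqint u -> sqint v -> ip v (a \*o u) = a * ip v u.
Proof. by move=> *; rewrite !(ipC v) ipZl. Qed.

Lemma ipBr u v w : sqint u -> sqint v -> sqint w ->
  ip w (u \- v) = ip w u - ip w v.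
Proof. by move=> *; rewrite !(ipC w) ipBl. Qed.

Lemma ip0l v : ip (cst 0) v = 0.
Proof.
rewrite /ip; under eq_Rintegral do rewrite /= mul0r.
by rewrite Rintegral_cst ?mul0r.
Qed.

Lemma ip_suml (I : Type) (s : seq I) (u : I -> T -> R) v :
  (forall i, sqint (u i)) -> sqint v ->
  ip (fun x => \sum_(i <- s) u i x) v = \sum_(i <- s) ip (u i) v.
Proof.
move=> su sv; elim: s => [|i s ih].
  by rewrite big_nil -[RHS](ip0l v); congr ip; apply/funext => x; rewrite big_nil.
rewrite big_cons -ih -ipDl//; last exact: sqint_sum.
by congr ip; apply/funext => x; rewrite big_cons.
Qed.

Lemma ip_ge0 u : 0 <= ip u u.
Proof. by apply: Rintegral_ge0 => x _; rewrite -expr2 sqr_ge0. Qed.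

Lemma nrm_ge0 u : 0 <= nrm u. Proof. exact: sqrtr_ge0. Qed.

Lemma sqr_nrm u : nrm u ^+ 2 = ip u u.
Proof. by rewrite sqr_sqrtr// ip_ge0. Qed.

Lemma nrmZ a u : sqint u -> nrm (a \*o u) = `|a| * nrm u.
Proof.
move=> su; have sau := sqintZ a su.
by rewrite /nrm ipZl// ipZr// mulrA -expr2 sqrtrM ?sqr_ge0// sqrtr_sqr.
Qed.

(** The quadratic form (a, b) |-> |a u + b v|^2 is nonnegative; it is evaluated at
    (|v|^2, - <u, v>), or at a pair that makes it negative when |v| = 0 and
    <u, v> <> 0. *)
Lemma cauchy_schwarz u v : sqint u -> sqint v -> `|ip u v| <= nrm u * nrm v.
Proof.
move=> su sv.
have quad a b : 0 <= a ^+ 2 * ip u u + 2 * (a * b) * ip u v + b ^+ 2 * ip v v.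
  have sau := sqintZ a su; have sbv := sqintZ b sv.
  have := ip_ge0 ((a \*o u) \+ (b \*o v)).
  have sab := sqintD sau sbv.
  rewrite ipDl// !ipDr// !ipZl// !ipZr// (ipC v u).
  by congr (_ <= _); ring.
rewrite -sqrtrM ?ip_ge0// -sqrtr_sqr ler_wsqrtr//.
have [v0|v0] := eqVneq (ip v v) 0.
  have [->|uv0] := eqVneq (ip u v) 0; first by rewrite expr0n mulr_ge0 ?ip_ge0.
  have := quad (- ip u v) (1 / 2 * (ip u u + 1)).
  rewrite v0 => h; have u0 := ip_ge0 u.
  have : 0 < ip u v ^+ 2 by rewrite exprn_even_gt0.
  nra.
have {}v0 : 0 < ip v v by rewrite lt_neqAle eq_sym v0 ip_ge0.
have := quad (ip v v) (- ip u v).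
rewrite (_ : _ + _ = ip v v * (ip u u * ip v v - ip u v ^+ 2)); last by ring.
by rewrite pmulr_rge0// subr_ge0.
Qed.

Lemma nrmD u v : sqint u -> sqint v -> nrm (u \+ v) <= nrm u + nrm v.
Proof.
move=> su sv; rewrite -(@ler_pXn2r _ 2)// ?nnegrE ?addr_ge0 ?nrm_ge0//.
have suv := sqintD su sv.
rewrite sqr_nrm ipDl// !ipDr// (ipC v u) -!sqr_nrm.
have := cauchy_schwarz su sv; rewrite ler_norml => /andP[_].
nra.
Qed.

Lemma ip_cvg (u v : nat -> T -> R) (u0 v0 : T -> R) :
  (forall k, sqint (u k)) -> (forall k, sqint (v k)) -> sqint u0 -> sqint v0 ->
  nrm (u k \- u0) @[k --> \oo] --> (0 : R) ->
  nrm (v k \- v0) @[k --> \oo] --> (0 : R) ->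
  ip (u k) (v k) @[k --> \oo] --> ip u0 v0.
Proof.
move=> su sv su0 sv0 cu cv; apply/cvgrPdist_le => e e0.
suff /cvgr0_norm_le/(_ e e0) : `|ip (u k) (v k) - ip u0 v0| @[k --> \oo] --> (0 : R).
  by apply: filterS => k; rewrite normr_id distrC.
apply: (squeeze_cvgr (f := cst 0) (h := fun k => nrm (u k \- u0) * nrm (v k \- v0)
  + nrm u0 * nrm (v k \- v0) + nrm (u k \- u0) * nrm v0)).
- apply: nearW => k /=; rewrite normr_ge0 /=.
  have sd := sqintB (su k) su0; have se := sqintB (sv k) sv0.
  rewrite (_ : _ - _ = ip (u k \- u0) (v k \- v0) + ip u0 (v k \- v0)
      + ip (u k \- u0) v0); last by rewrite ipBl// ipBl// !ipBr//; ring.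
  by rewrite (le_trans (ler_normD _ _))// lerD ?(le_trans (ler_normD _ _))// ?lerD//;
    exact: cauchy_schwarz.
- exact: cvg_cst.
- rewrite [X in _ --> X](_ : _ = 0 * 0 + nrm u0 * 0 + 0 * nrm v0); last by ring.
  by apply: cvgD; [apply: cvgD; apply: cvgM => //; exact: cvg_cst|
    apply: cvgM => //; exact: cvg_cst].
Qed.

Lemma nrm_cvg (u : nat -> T -> R) (u0 : T -> R) :
  (forall k, sqint (u k)) -> sqint u0 ->
  nrm (u k \- u0) @[k --> \oo] --> (0 : R) ->
  nrm (u k) @[k --> \oo] --> nrm u0.
Proof.
move=> su su0 cu; have := ip_cvg su su su0 su0 cu cu.
by move=> h; apply: continuous_cvg h; exact: sqrt_continuous.
Qed.

Lemma ip_ae u v w : measurable_fun D u -> measurable_fun D v ->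
  measurable_fun D w -> ae_eq mu D u v -> ip u w = ip v w.
Proof.
move=> mu_ mv mw uv; congr fine; apply: ae_eq_integral => //.
- by apply/measurable_EFinP; exact: measurable_funM.
- by apply/measurable_EFinP; exact: measurable_funM.
- by apply: filterS uv => x h Dx; rewrite h.
Qed.

Lemma integral_sqr u : sqint u -> (\int[mu]_(x in D) (u x ^+ 2)%:E)%E = (nrm u ^+ 2)%:E.
Proof.
move=> [_ iu]; rewrite sqr_nrm /ip /Rintegral.
rewrite (eq_integral (EFin \o (fun x => u x ^+ 2)))//.
by rewrite fineK ?integrable_fin_num.
Qed.

(** The series of the squares has a finite integral, so it converges almost
    everywhere and its terms tend to 0. *)
Lemma fast_cvg_ae (v : nat -> T -> R) a :
  (forall k, sqint (v k)) -> (forall k, nrm (v k) <= a * 2^-1 ^+ k) ->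
  {ae mu, forall x, D x -> v k x @[k --> \oo] --> (0 : R)}.
Proof.
move=> sv va.
pose g k x := (v k x ^+ 2)%:E.
have mg k : measurable_fun D (g k).
  by apply/measurable_EFinP/measurable_funX; case: (sv k).
have g0 k x : D x -> (0 <= g k x)%E by move=> _; rewrite lee_fin sqr_ge0.
pose G x := (\sum_(k <oo) g k x)%E.
have mG : measurable_fun D G by apply: ge0_emeasurable_sum => [k x Dx _|k _]; [exact: g0|exact: mg].
have G0 x : D x -> (0 <= G x)%E by move=> Dx; apply: nneseries_ge0 => k _ _; exact: g0.
have iG : mu.-integrable D G.
  apply/integrableP; split=> //.
  rewrite (eq_integral G); last by move=> x; rewrite inE => /G0 ?; rewrite gee0_abs.
  rewrite integral_nneseries//.
  apply: (@le_lt_trans _ _ (\sum_(k <oo) (a ^+ 2 * 2^-1 ^+ k)%:E)%E).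
    apply: lee_nneseries => [k _ _|k _]; first by apply: integral_ge0 => x; exact: g0.
    rewrite integral_sqr// lee_fin (@le_trans _ _ ((a * 2^-1 ^+ k) ^+ 2))//.
      by rewrite lerXn2r ?nnegrE ?nrm_ge0// (le_trans _ (va k))// nrm_ge0.
    rewrite exprMn ler_wpM2l ?sqr_ge0// -exprM mulnC exprM.
    by rewrite lerXn2r ?nnegrE//; lra.
  under eq_eseriesr do rewrite -[(_ * _)%R]/(geometric (a ^+ 2) 2^-1 _).
  have /cvgP cg : series (geometric (a ^+ 2) 2^-1) @ \oo --> (a ^+ 2 * (1 - 2^-1)^-1 : R).
    by apply: cvg_geometric_series; rewrite ger0_norm; lra.
  rewrite (_ : (fun n => _) = EFin \o series (geometric (a ^+ 2) (2^-1 : R))).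
    by rewrite EFin_lim// ltry.
  by apply/funext => n /=; rewrite sumEFin.
have := integrable_ae mD iG; apply: filterS => x fG Dx.
have cs : cvgn (series (fun k => v k x ^+ 2)).
  apply: nondecreasing_is_cvgn.
    by apply/nondecreasing_seqP => n; rewrite /series /= big_nat_recr//= lerDl sqr_ge0.
  exists (fine (G x)) => _ [n _ <-].
  rewrite -lee_fin fineK ?fG// /series /= -sumEFin.
  by apply: nneseries_lim_ge => k _ _; exact: g0.
have v2 := cvg_series_cvg_0 cs.
have : Num.sqrt (v k x ^+ 2) @[k --> \oo] --> Num.sqrt (0 : R).
  by apply: continuous_cvg v2; exact: sqrt_continuous.
rewrite sqrtr0; under eq_fun do rewrite sqrtr_sqr.
by move=> /norm_cvg0.
Qed.

End square_integrable.

(** * Boxes and Lebesgue measure on R^n *)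

Section boxes.
Context (R : realType) (n : nat).
Implicit Types (I : 'I_n -> interval R) (x : 'rV[R]_n) (U : set 'rV[R]_n).

Definition box I : set 'rV[R]_n := [set x | forall i, x ord0 i \in I i].

Lemma measurable_box I : measurable (box I).
Proof.
rewrite (_ : box I = \bigcap_(i in [set: 'I_n]) ((fun x => x ord0 i) @^-1` [set` I i])).
  apply: fin_bigcap_measurable => // i _.
  rewrite -[X in measurable X]setTI.
  by apply: measurable_coor => //; exact: measurable_itv.
by apply/seteqP; split => [x h i _|x h i]; exact: h.
Qed.

Definition rat_obox (q : 'rV[rat]_n * 'rV[rat]_n) : set 'rV[R]_n :=
  box (fun i => `]ratr (q.1 ord0 i), ratr (q.2 ord0 i)[%R).

Definition rat_cbox (q : 'rV[rat]_n * 'rV[rat]_n) : set 'rV[R]_n :=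
  box (fun i => `[ratr (q.1 ord0 i), ratr (q.2 ord0 i)]%R).

(** The closed boxes, and not only the open ones, are kept inside U because they
    serve as supports of test functions. *)
Lemma open_bigcup_rat_obox U : open U ->
  U = \bigcup_(q in [set q | rat_cbox q `<=` U]) rat_obox q.
Proof.
move=> oU; apply/seteqP; split => [x Ux|x [q /= + qx]]; last first.
  by apply => i; move: (qx i); rewrite !in_itv /= => /andP[/ltW -> /ltW ->].
have /nbhs_ballP[e /= e0 xe] : nbhs x U by exact: oU.
have ha i : exists q : rat, x ord0 i - e / 2 < ratr q < x ord0 i.
  have [q] := @rat_in_itvoo R (x ord0 i - e / 2) (x ord0 i) (ltac:(lra)).
  by rewrite in_itv; exists q.
have hb i : exists q : rat, x ord0 i < ratr q < x ord0 i + e / 2.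
  have [q] := @rat_in_itvoo R (x ord0 i) (x ord0 i + e / 2) (ltac:(lra)).
  by rewrite in_itv; exists q.
have [a Pa] := choice ha; have [b Pb] := choice hb.
exists (\row_i a i, \row_i b i) => /=; last first.
  move=> i; rewrite !mxE in_itv /=.
  by have /andP[_ ->] := Pa i; have /andP[-> _] := Pb i.
move=> y hy; apply: xe; split=> // j i; rewrite (ord1 j).
have /andP[a1 a2] := Pa i; have /andP[b1 b2] := Pb i.
have := hy i; rewrite !mxE in_itv /= => /andP[h1 h2].
rewrite /ball /= ltr_norml; apply/andP; split; lra.
Qed.

Lemma measurable_open_rV U : open U -> measurable U.
Proof.
move=> oU; rewrite (open_bigcup_rat_obox oU).
rewrite bigcup_mkcond; apply: countable_bigcupT_measurable => [|q].
  exact: countableP.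
by case: ifP => _ //; exact: measurable_box.
Qed.

Lemma continuous_measurable_rV U (f : 'rV[R]_n -> R) : open U ->
  {within U, continuous f} -> measurable_fun U f.
Proof.
move=> oU cf; apply: (measurability _ (RGenOpens.measurableE R)).
move=> _ [_ [a [b ->] <-]]; apply: measurable_open_rV.
rewrite (@open_setSI _ U)//.
by move/continuousP: cf; apply; exact: interval_open.
Qed.

Lemma continuous_measurable_rVT (f : 'rV[R]_n -> R) :
  continuous f -> measurable_fun setT f.
Proof.
move=> cf; apply: continuous_measurable_rV; first exact: openT.
exact: continuous_subspaceT.
Qed.

End boxes.

Section tonelli.
Context (R : realType).
Local Open Scope ereal_scope.

Lemma box_cons n (I : 'I_n.+1 -> interval R) t v :
  box I (cons_rV (t, v)) <-> t \in I ord0 /\ box (fun i => I (lift ord0 i)) v.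
Proof.
split=> [h|[ht hv] i].
  by split=> [|i]; [have := h ord0|have := h (lift ord0 i)];
     rewrite mxE ?unlift_none ?liftK.
by rewrite mxE; case: unliftP => [j|] ->; [exact: hv|].
Qed.

(** Tonelli's theorem for the recursive construction of [leb]; all the
    computations on R^n proceed by induction on n through this formula. *)
Lemma integral_leb_cons n (f : 'rV[R]_n.+1 -> \bar R) :
  measurable_fun setT f -> (forall x, 0 <= f x) ->
  \int[leb R n.+1]_x f x =
  \int[@lebesgue_measure R]_t \int[leb R n]_v f (cons_rV (t, v)).
Proof.
move=> mf f0; have mfc : measurable_fun setT (f \o @cons_rV R n).
  by apply: measurableT_comp => //; exact: measurable_cons_rV.
have := @fubini_tonelli1 _ _ _ _ R (@lebesgue_measure R) (leb R n) _ mfc (fun x => f0 _).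
rewrite /fubini_F /= => <-.
have := ge0_integral_pushforward (@measurable_cons_rV R n)
  (@lebesgue_measure R \x leb R n) measurableT mf (fun x _ => f0 x).
by rewrite preimage_setT.
Qed.

Lemma integral_box_cons n (I : 'I_n.+1 -> interval R) (f : 'rV[R]_n.+1 -> \bar R) :
  measurable_fun setT f -> (forall x, 0 <= f x) ->
  \int[leb R n.+1]_(x in box I) f x =
  \int[@lebesgue_measure R]_(t in [set` I ord0])
    \int[leb R n]_(v in box (fun i => I (lift ord0 i))) f (cons_rV (t, v)).
Proof.
move=> mf f0; rewrite integral_mkcond integral_leb_cons; last 2 first.
- apply/(measurable_restrictT _ _).1; first exact: measurable_box.
  exact: measurable_funTS.
- by move=> x; rewrite patchE; case: ifP.
rewrite [RHS]integral_mkcond; apply: eq_integral => t _.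
rewrite patchE; case: ifPn => [/set_mem /= tI|/negP tI].
  rewrite [RHS]integral_mkcond; apply: eq_integral => v _.
  rewrite !patchE; congr (if _ then _ else _).
  apply/idP/idP => /set_mem h; apply/mem_set; first by case/box_cons: h.
  exact/box_cons.
rewrite integral0_eq// => v _; rewrite patchE; case: ifPn => // /set_mem.
by case/box_cons => ht _; case: tI; rewrite inE.
Qed.

Lemma leb_box_bounded n (a b : 'I_n -> R) :
  leb R n (box (fun i => `[a i, b i]%R)) < +oo.
Proof.
rewrite -[X in X < _]mul1e -integral_cst; last exact: measurable_box.
elim: n a b => [|n ih] a b.
  rewrite integral_cst ?mul1e; last exact: measurable_box.
  by rewrite /= diracE; case: (_ \in _); rewrite ltry.
rewrite integral_box_cons//.
pose B := box (fun i : 'I_n => `[a (lift ord0 i), b (lift ord0 i)]%R).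
rewrite (eq_integral (cst (leb R n B))); last first.
  by move=> t _; rewrite integral_cst ?mul1e//; exact: measurable_box.
have := ih (fun i => a (lift ord0 i)) (fun i => b (lift ord0 i)).
rewrite integral_cst ?mul1e; last exact: measurable_box.
rewrite -/B -ge0_fin_numE// => h.
rewrite -(fineK h) integral_cst//= lebesgue_measure_itv.
by case: ifP => _; rewrite ?mule0 -?EFinD -?EFinM ?ltry.
Qed.

Lemma bounded_sub_box n (U : set 'rV[R]_n) : bounded_set U ->
  exists2 M : R, (0 < M)%R & U `<=` box (fun=> `[- M, M]%R).
Proof.
move=> [M [Mr hM]]; exists (`|M| + 1)%R; first by rewrite ltr_pwDr.
move=> x Ux i; rewrite in_itv /= -ler_norml.
have := hM (`|M| + 1)%R; rewrite (le_lt_trans (ler_norm M)) ?ltrDl// => /(_ isT) h.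
apply: le_trans (h _ Ux).
rewrite [leRHS]/Num.Def.normr /= mx_normrE; apply/bigmax_geP; right => /=.
by exists (ord0, i).
Qed.

Lemma leb_bounded n (U : set 'rV[R]_n) : measurable U -> bounded_set U ->
  leb R n U < +oo.
Proof.
move=> mU /bounded_sub_box[M M0 UM].
apply: le_lt_trans (leb_box_bounded (fun=> - M)%R (fun=> M)).
by apply: le_measure => //; rewrite inE//; exact: measurable_box.
Qed.

End tonelli.

(** * A smooth cutoff on the line *)

Section psi.
Context (R : realType).

(** The factor t^-m is there so that the family is closed under differentiation:
    psi 0 is the usual flat function exp (-1/t), and the derivative of psi m is a
    linear combination of psi (m + 2) and psi (m + 1). *)
Definition psi (m : nat) (t : R) : R :=
  if 0 < t then t^-1 ^+ m * expR (- t^-1) else 0.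

(** The exponential series gives (1/t)^(m+2) / (m+2)! <= exp (1/t); the bound
    makes psi m differentiable at 0. *)
Lemma psi_le m (t : R) : 0 < t -> psi m t <= m.+2`!%:R * t ^+ 2.
Proof.
move=> t0; rewrite /psi t0 expRN.
have tV0 : 0 <= t^-1 by rewrite invr_ge0 ltW.
have h := expR_ge1Dxn m.+1 tV0.
have f0 : 0 < m.+2`!%:R :> R by rewrite ltr0n fact_gt0.
rewrite ler_pdivrMr ?expR_gt0//.
have {}h : t^-1 ^+ m.+2 <= m.+2`!%:R * expR t^-1.
  by rewrite mulrC -ler_pdivrMr//; apply: le_trans h; rewrite lerDr.
rewrite mulrAC -ler_pdivrMr ?exprn_gt0//.
by rewrite -exprVn -exprD addn2.
Qed.

Lemma psi_deriv m (t : R) : is_derive t 1 (psi m) (psi m.+2 t - m%:R * psi m.+1 t).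
Proof.
have [t0|t0|->] := ltgtP t 0.
- have e : \near t, cst 0 t = psi m t.
    near=> s; rewrite /psi /= ifF//; apply/negbTE; rewrite -leNgt ltW//.
    by near: s; exact: lt_nbhsl.
  apply: near_eq_is_derive e _.
  have -> : psi m.+2 t - m%:R * psi m.+1 t = 0.
    by rewrite /psi ifF ?ifF ?mulr0 ?subr0//; apply/negbTE; rewrite -leNgt ltW.
  exact: is_derive_cst.
- have e : \near t, ((fun s => s^-1 ^+ m) * (fun s => expR (- s^-1)))%R t = psi m t.
    near=> s; rewrite /psi /= ifT//.
    by near: s; exact: lt_nbhsr.
  apply: near_eq_is_derive e _.
  have tn0 : t != 0 by rewrite gt_eqF.
  have dV : is_derive t 1 (fun s : R => s^-1) (- t ^- 2 *: 1).
    exact: (@is_deriveV R id t 1 1 tn0).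
  have dN : is_derive t 1 (fun s : R => - s^-1) (- (- t ^- 2 *: 1)).
    exact: is_deriveN.
  have dE := @is_derive1_comp R expR (fun s => - s^-1) t _ _ (is_derive_expR _) dN.
  have dX : is_derive t 1 (fun s : R => s^-1 ^+ m) ((m%:R * t^-1 ^+ m.-1) *: (- t ^- 2 *: 1)).
    have := is_deriveX m dV; congr (is_derive _ _ _ _).
    by apply/funext => s; rewrite exprfctE.
  have dM := is_deriveM dX dE.
  apply: is_derive_eq dM _; rewrite /psi t0 /= /GRing.scale /=.
  case: m {dX} => [|m] /=; first by rewrite -exprVn !mul0r; ring.
  by rewrite -exprVn !exprS; ring.
- rewrite /psi ltxx mulr0 subr0.
  suff c0 : h^-1 *: (psi m (h *: 1 + 0) - psi m 0) @[h --> 0^'] --> (0 : R).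
    by apply: DeriveDef; [exact: cvgP c0|exact: cvg_lim c0].
  apply/cvgr0Pnorm_le => e e0; near=> h.
  rewrite /GRing.scale /= mulr1 addr0 {2}/psi ltxx subr0.
  have [h0|h0] := ltP 0 h; last by rewrite /psi ltNge h0 /= mulr0 normr0 ltW.
  rewrite ger0_norm; last first.
    rewrite mulr_ge0 ?invr_ge0 ?(ltW h0)// /psi h0.
    by rewrite mulr_ge0 ?expR_ge0// exprn_ge0// invr_ge0 ltW.
  have f0 : 0 < m.+2`!%:R :> R by rewrite ltr0n fact_gt0.
  rewrite mulrC ler_pdivrMr// (le_trans (psi_le m h0))// expr2 mulrA ler_pM2r//.
  rewrite mulrC -ler_pdivlMr// (le_trans (ler_norm _))// ltW//.
  near: h; apply: dnbhs0_lt; exact: divr_gt0.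
Unshelve. all: end_near.
Qed.

Lemma psi_ge0 m (t : R) : 0 <= psi m t.
Proof.
rewrite /psi; case: ifPn => // t0.
by rewrite mulr_ge0 ?expR_ge0// exprn_ge0// invr_ge0 ltW.
Qed.

Lemma psi_le0 m (t : R) : t <= 0 -> psi m t = 0.
Proof. by move=> t0; rewrite /psi ltNge t0. Qed.

Lemma psi0_le1 (t : R) : psi 0 t <= 1.
Proof.
rewrite /psi; case: ifPn => // t0; rewrite expr0 mul1r.
by rewrite -expR0 ler_expR oppr_le0 invr_ge0 ltW.
Qed.

Lemma psi0_cvg (t : R) : 0 < t -> psi 0 (k.+1%:R * t) @[k --> \oo] --> (1 : R).
Proof.
move=> t0; rewrite (_ : (fun _ => _) = (fun k => expR (- (t^-1 * k.+1%:R^-1)))); last first.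
  apply/funext => k; rewrite /psi mulr_gt0// expr0 mul1r invfM mulrC.
  by congr (expR (- _)); rewrite mulrC.
rewrite [X in _ --> X](_ : _ = expR (- (t^-1 * 0))); last by rewrite mulr0 oppr0 expR0.
apply: continuous_cvg; first exact: continuous_expR.
by apply: cvgN; apply: cvgM; [exact: cvg_cst|exact: cvg_harmonic].
Qed.

End psi.

Lemma is_derive_line (R : realType) (V : normedModType R) (u : V -> R) x v df :
  is_derive x v u df = is_derive (0 : R) 1 (fun h => u (h *: v + x)) df.
Proof.
have e : (fun h : R => h^-1 *: ((u \o shift x) (h *: v) - u x)) =
    (fun h : R => h^-1 *: (((fun h => u (h *: v + x)) \o shift 0) (h *: 1) -
      (fun h => u (h *: v + x)) 0)).
  by apply/funext => h /=; rewrite scale0r add0r addr0 [_%:A]mulr1.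
by apply/propext; split => -[]; rewrite /derivable /derive ?e => d1 d2;
  apply: DeriveDef; rewrite /derivable /derive ?e.
Qed.

Section smooth_functions.
Context (R : realType) (n : nat).
Implicit Types (u v : 'rV[R]_n -> R) (x : 'rV[R]_n).

(** Differentiability up to order k; unlike [smooth] it unfolds the first
    derivative, which is what the Leibniz rule needs. *)
Fixpoint diffk k u : Prop := continuous u /\
  if k is k'.+1 then forall i, (forall x, derivable u x (delta_mx 0 i)) /\
                              diffk k' (partial i u) else True.

Lemma diffkW k u : diffk k.+1 u -> diffk k u.
Proof.
elim: k u => [|k ih] u /=; first by case.
by move=> [cu h]; split=> // i; have [d h2] := h i; split=> //; exact: ih.
Qed.

Lemma diffk_cst k (a : R) : diffk k (cst a).
Proof.
elim: k a => [|k ih] a /=; first by split=> //; exact: cst_continuous.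
split=> [|i]; first exact: cst_continuous.
split=> [x|]; first exact: derivable_cst.
rewrite (_ : partial i (cst a) = cst 0); first exact: ih.
by apply/funext => x; exact: derive_cst.
Qed.

Lemma diffkD k u v : diffk k u -> diffk k v -> diffk k (u + v).
Proof.
elim: k u v => [|k ih] u v /= [cu hu] [cv hv].
  by split=> // x; exact: (cvgD (cu x) (cv x)).
split=> [x|i]; first by exact: (cvgD (cu x) (cv x)).
have [du hu'] := hu i; have [dv hv'] := hv i.
split=> [x|]; first exact: derivableD.
rewrite (_ : partial i (u + v) = partial i u + partial i v); first exact: ih.
by apply/funext => x; exact: deriveD.
Qed.

Lemma diffkM k u v : diffk k u -> diffk k v -> diffk k (u * v).
Proof.
elim: k u v => [|k ih] u v.
  move=> /= [cu hu] [cv hv].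
  by split=> // x; exact: (cvgM (cu x) (cv x)).
move=> hu0 hv0; move: (hu0) (hv0) => /= [cu hu] [cv hv].
split=> [x|i]; first by exact: (cvgM (cu x) (cv x)).
have [du hu'] := hu i; have [dv hv'] := hv i.
split=> [x|]; first exact: derivableM.
rewrite (_ : partial i (u * v) = u * partial i v + v * partial i u).
  by apply: diffkD; apply: ih => //; exact: diffkW.
by apply/funext => x; exact: deriveM.
Qed.

Lemma diffk_prod k (I : Type) (s : seq I) (u : I -> 'rV[R]_n -> R) :
  (forall i, diffk k (u i)) -> diffk k (\prod_(i <- s) u i).
Proof.
move=> hu; elim: s => [|i s ih]; first by rewrite big_nil; exact: diffk_cst.
by rewrite big_cons; exact: diffkM.
Qed.

(** By induction on k for all m at once, as the derivative of psi m involves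
    psi (m + 2) and psi (m + 1). *)
Lemma diffk_psi k m (c d : R) j :
  diffk k (fun x : 'rV[R]_n => psi m (c * x ord0 j + d)).
Proof.
have dpsi t l : {for t, continuous (@psi R l)}.
  by apply: differentiable_continuous; apply/derivable1_diffP; case: (psi_deriv l t).
have cpsi l : continuous (fun x : 'rV[R]_n => psi l (c * x ord0 j + d)).
  move=> x; apply: (@continuous_comp _ _ _ (fun x => c * x ord0 j + d) (psi l)); last exact: dpsi.
  exact: (cvgD (cvgM (cvg_cst c) (@coord_continuous R 1 n ord0 j x)) (cvg_cst d)).
have main l i x : is_derive x (delta_mx 0 i) (fun x : 'rV[R]_n => psi l (c * x ord0 j + d))
    ((i == j)%:R * c * (psi l.+2 (c * x ord0 j + d) - l%:R * psi l.+1 (c * x ord0 j + d))).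
  rewrite is_derive_line /=.
  have dA : is_derive (0 : R) 1 (fun h : R => h * (c * (i == j)%:R) + (c * x ord0 j + d))
      (c * (i == j)%:R).
    have h := is_deriveD (is_deriveM (is_derive_id (0 : R) 1)
      (is_derive_cst (c * (i == j)%:R) (0 : R) 1)) (is_derive_cst (c * x ord0 j + d) (0 : R) 1).
    by apply: is_derive_eq h _; rewrite /GRing.scale /= /cst; ring.
  have h := @is_derive1_comp R (psi l) _ 0 _ _ (psi_deriv l _) dA.
  rewrite (_ : (fun h => _) = psi l \o (fun h : R => h * (c * (i == j)%:R) + (c * x ord0 j + d))).
    by apply: is_derive_eq h _; rewrite mul0r add0r; ring.
  by apply/funext => h' /=; congr psi; rewrite !mxE eqxx /= eq_sym; ring.
elim: k m => [|k ih] m; first by split.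
split=> // i; split=> [x|]; first by case: (main m i x).
rewrite (_ : partial i _ = cst ((i == j)%:R * c) * ((fun x => psi m.+2 (c * x ord0 j + d))
   + cst (- m%:R) * (fun x => psi m.+1 (c * x ord0 j + d)))); last first.
  apply/funext => x; rewrite /partial derive_val.
  by rewrite !fctE mulNr.
by apply: diffkM; [exact: diffk_cst|apply: diffkD => //; apply: diffkM => //; exact: diffk_cst].
Qed.

Lemma diffk_smooth u : (forall k, diffk k u) -> smooth u.
Proof.
move=> hu s.
have {hu} hs k : diffk k (partials s u).
  elim: s k => [|i s ih] k; first exact: hu.
  by have [_ /(_ i)[]] := ih k.+1.
split; first by case: (hs 0%N).
by move=> i x; have [_ /(_ i)[]] := hs 1%N.
Qed.

End smooth_functions.

(** * Bump functions on boxes *)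

Section bump.
Context (R : realType) (n : nat).
Implicit Types (a b : 'I_n -> R).

Definition obox a b : set 'rV[R]_n := box (fun i => `]a i, b i[%R).
Definition cbox a b : set 'rV[R]_n := box (fun i => `[a i, b i]%R).

Lemma oboxP a b x : obox a b x <-> forall i, a i < x ord0 i < b i.
Proof. by split=> h i; have := h i; rewrite in_itv. Qed.

Lemma cboxP a b x : cbox a b x <-> forall i, a i <= x ord0 i <= b i.
Proof. by split=> h i; have := h i; rewrite in_itv. Qed.

Lemma compact_cbox a b : compact (cbox a b).
Proof.
exact: (@rV_compact R n (fun i => `[a i, b i]%classic) (fun i => @segment_compact R _ _)).
Qed.

(** On the open box both arguments are positive and the k-th bump tends to 1;
    outside of it one of the factors vanishes for every k. *)
Definition bump a b (k : nat) : 'rV[R]_n -> R := \prod_(i < n)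
  ((fun x : 'rV[R]_n => psi 0 (k.+1%:R * x ord0 i + - (k.+1%:R * a i))) *
   (fun x : 'rV[R]_n => psi 0 (- k.+1%:R * x ord0 i + k.+1%:R * b i))).

Lemma bumpE a b k x : bump a b k x = \prod_(i < n)
  (psi 0 (k.+1%:R * (x ord0 i - a i)) * psi 0 (k.+1%:R * (b i - x ord0 i))).
Proof.
rewrite /bump (@big_morph _ _ (fun u : 'rV[R]_n -> R => u x) 1 *%R)//.
by apply: eq_bigr => i _; congr (psi _ _ * psi _ _); ring.
Qed.

Lemma bump01 a b k x : 0 <= bump a b k x <= 1.
Proof.
rewrite bumpE; apply/andP; split.
  by apply: prodr_ge0 => i _; rewrite mulr_ge0 ?psi_ge0.
apply: prodr_ile1 => i _.
by rewrite mulr_ge0 ?psi_ge0//= mulr_ile1 ?psi_ge0 ?psi0_le1.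
Qed.

Lemma bump_out a b k x : ~ obox a b x -> bump a b k x = 0.
Proof.
move=> /oboxP/existsNP[i /negP]; rewrite negb_and -!leNgt => h.
rewrite bumpE; apply/eqP/prodf_eq0; exists i => //; rewrite mulf_eq0.
by case/orP: h => h; apply/orP; [left|right]; rewrite psi_le0// pmulr_rle0// subr_le0.
Qed.

Lemma bump_cvg a b x : bump a b k x @[k --> \oo] --> (\1_(obox a b) x : R).
Proof.
rewrite indicE; have [/set_mem h|/negP h] := boolP (x \in obox a b); last first.
  rewrite (_ : (fun k => _) = cst 0); first exact: cvg_cst.
  by apply/funext => k; apply: bump_out; apply: contra_not h => /mem_set.
have {}h := (oboxP _ _ _).1 h.
have -> : (fun k => bump a b k x) = (fun k => \prod_(i < n)
    (psi 0 (k.+1%:R * (x ord0 i - a i)) * psi 0 (k.+1%:R * (b i - x ord0 i)))).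
  by apply/funext => k; exact: bumpE.
have -> : (true%:R : R) = \prod_(i < n) 1 by rewrite big1.
apply: cvg_big => [|i _]; first exact: mul_continuous.
have /andP[h1 h2] := h i; rewrite -[X in _ --> X]mulr1.
by apply: cvgM; apply: psi0_cvg; rewrite subr_gt0.
Qed.

Lemma bump_test (Omega : set 'rV[R]_n) a b k :
  cbox a b `<=` Omega -> test_function Omega (bump a b k).
Proof.
move=> abO.
have supp : closure [set x | bump a b k x != 0] `<=` cbox a b.
  have cl : closed (cbox a b).
    by apply: compact_closed; [exact: norm_hausdorff|exact: compact_cbox].
  rewrite ((closure_id _).1 cl); apply: closureS => x /= /eqP h.
  have : obox a b x by apply: contra_notP h; exact: bump_out.
  by move/oboxP => h'; apply/cboxP => i; have /andP[/ltW -> /ltW ->] := h' i.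
split.
- apply: diffk_smooth => m; apply: diffk_prod => i.
  by apply: diffkM; exact: diffk_psi.
- apply: (subclosed_compact (@closed_closure _ _) (@compact_cbox a b)).
  exact: supp.
- exact: subset_trans supp abO.
Qed.

End bump.

(** * The fundamental lemma of the calculus of variations *)

Section oboxes_generate.
Context (R : realType) (n : nat).

Definition oboxes : set (set 'rV[R]_n) := [set B | exists a b, B = obox a b].

Lemma oboxI a b a' b' : obox a b `&` obox a' b' =
  obox (fun i => Num.max (a i) (a' i)) (fun i => Num.min (b i) (b' i)) :> set 'rV[R]_n.
Proof.
apply/seteqP; split=> [x [/oboxP h /oboxP h']|x /oboxP h].
  apply/oboxP => i; have /andP[h1 h2] := h i; have /andP[h3 h4] := h' i.
  by rewrite gt_max lt_min h1 h2 h3 h4.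
by split; apply/oboxP => i; have := h i;
  rewrite gt_max lt_min => /andP[/andP[h1 h2] /andP[h3 h4]]; rewrite ?h1 ?h2 ?h3 ?h4.
Qed.

Lemma oboxesI : setI_closed oboxes.
Proof.
by move=> _ _ [a [b ->]] [a' [b' ->]]; rewrite oboxI; eexists; eexists.
Qed.

(** A coordinate strip is an increasing union of boxes that are bounded in the
    other directions. *)
Lemma measurable_oboxes : @measurable _ 'rV[R]_n = <<s oboxes >>.
Proof.
apply/seteqP; split; last first.
  apply: smallest_sub; first exact: sigma_algebra_measurable.
  by move=> _ [a [b ->]]; exact: measurable_box.
apply: smallest_sub; first exact: smallest_sigma_algebra.
rewrite -bigcup_seq => A /= [i _ [B mB <-]].
have h : @measurable_fun _ _ (g_sigma_algebraType oboxes) R setT (fun x : 'rV[R]_n => x ord0 i).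
  apply: (measurability _ (RGenOpens.measurableE R)).
  move=> _ [_ [s [t ->] <-]].
  rewrite (_ : _ `&` _ = \bigcup_k (obox (fun j => if j == i then s else - k%:R)
      (fun j => if j == i then t else k%:R))).
    by apply: bigcupT_measurable => k; apply: sub_sigma_algebra; eexists; eexists.
  apply/seteqP; split => [x [_ /=]|x [k _ /oboxP h]].
    rewrite in_itv /= => hx; have [N xN] : exists N, forall j, `|x ord0 j| < N%:R.
      exists (\max_(j < n) Num.trunc `|x ord0 j|).+1 => j.
      apply: lt_le_trans (truncnS_gt _) _ => //.
      by rewrite ler_nat ltnS (leq_bigmax j).
    exists N => //; apply/oboxP => j; case: eqP => [->//|_].
    by rewrite -ltr_norml.
  by split=> //=; have := h i; rewrite eqxx in_itv.
exact: h.
Qed.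

End oboxes_generate.

Section fundamental_lemma.
Context (R : realType) (n : nat).
Variables (Omega : set 'rV[R]_n) (v : 'rV[R]_n -> R).
Hypotheses (oO : open Omega) (iv : (leb R n).-integrable Omega (EFin \o v)).
Hypothesis v0 : forall phi, test_function Omega phi -> L2_inner Omega v phi = 0.

Let mO : measurable Omega := measurable_open_rV oO.
Let mv : measurable_fun Omega v.
Proof. by apply/measurable_EFinP; exact: measurable_int iv. Qed.

(** The bump functions of the box are test functions and converge boundedly to
    its indicator function. *)
Let integral_obox0 a b : cbox a b `<=` Omega ->
  (\int[leb R n]_(x in obox a b) (v x)%:E = 0)%E.
Proof.
move=> abO; have oO' : obox a b `<=` Omega.
  move=> x /oboxP h; apply: abO; apply/cboxP => i.
  by have /andP[/ltW -> /ltW ->] := h i.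
have mB : measurable (obox a b) by exact: measurable_box.
have mb k : measurable_fun setT (bump a b k).
  apply: continuous_measurable_rVT.
  by have [/(_ [::])[]] := bump_test k abO.
have dom x k : (`|(v x * bump a b k x)%:E| <= `|(v x)%:E|)%E.
  rewrite !abse_EFin lee_fin normrM ler_piMr//.
  by have /andP[h1 h2] := bump01 a b k x; rewrite ger0_norm.
have z k : (\int[leb R n]_(x in Omega) (v x * bump a b k x)%:E = 0)%E.
  rewrite -[RHS]/((0 : R)%:E) -(v0 (bump_test k abO)) /L2_inner /Rintegral fineK//.
  apply: integrable_fin_num => //; apply: le_integrable iv => //.
    apply/measurable_EFinP; apply: measurable_funM => //.
    exact: measurable_funTS.
have [] := @dominated_convergence _ _ _ (leb R n) Omega mO
  (fun k x => (v x * bump a b k x)%:E) (fun x => (v x * \1_(obox a b) x)%:E)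
  (fun x => `|(v x)%:E|)%E.
- move=> k; apply/measurable_EFinP; apply: measurable_funM => //.
  exact: measurable_funTS.
- by apply/measurable_EFinP; apply: measurable_funM.
- apply: aeW => x Ox; apply: cvg_EFin; first exact: nearW.
  by apply: cvgM; [exact: cvg_cst|exact: bump_cvg].
- exact: integrable_abse.
- by apply: aeW => x k _; exact: dom.
move=> _ _; rewrite (_ : [sequence _]_k = cst 0%E); last by apply/funext => k; exact: z.
have c0 : cst 0%E x @[x --> \oo] --> (0%E : \bar R) by exact: cvg_cst.
move=> /(cvg_unique (@ereal_hausdorff R) c0) e; rewrite [RHS]e.
rewrite -[in LHS](setIidr oO') integral_mkcondr.
apply: eq_integral => x _; rewrite patchE indicE.
by case: ifP => _ /=; rewrite ?mulr1 ?mulr0.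
Qed.

(** The sets E for which the integral vanishes form a Dynkin system, and open
    boxes form a generating pi-system. *)
Let integral_sub_obox0 a b : cbox a b `<=` Omega ->
  forall E, measurable E -> (\int[leb R n]_(x in E `&` obox a b) (v x)%:E = 0)%E.
Proof.
move=> abO; have oO' : obox a b `<=` Omega.
  move=> x /oboxP h; apply: abO; apply/cboxP => i.
  by have /andP[/ltW -> /ltW ->] := h i.
have mB : measurable (obox a b) by exact: measurable_box.
have iB : (leb R n).-integrable (obox a b) (EFin \o v) by exact: integrableS iv.
rewrite measurable_oboxes; apply: dynkin_induction.
- exact: measurable_oboxes.
- exact: oboxesI.
- by rewrite setTI; exact: integral_obox0.
- move=> E [a' [b' ->]].
  rewrite oboxI; apply: integral_obox0 => x /cboxP h; apply: abO; apply/cboxP => i.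
  by have := h i; rewrite ge_max le_min => /andP[/andP[_ ->] /andP[_ ->]].
- move=> E mE E0; have := integral_obox0 abO.
  rewrite -[in X in X -> _](setTI (obox a b)) -(setUv E) setIUl integral_setU.
  + by rewrite E0 add0e.
  + exact: measurableI.
  + by apply: measurableI => //; exact: measurableC.
  + rewrite -setIUl setUv setTI; exact: measurable_int iB.
  + by apply/disj_setPS => x [[Ex _] [nEx _]].
- move=> F mF tF F0; rewrite setI_bigcupl integral_bigcup.
  + by apply: eseries0 => k _ _; exact: F0.
  + apply/trivIsetP => i j _ _ ij; move/trivIsetP : tF => /(_ i j I I ij).
    by rewrite setIACA setIid => ->; rewrite set0I.
  + by move=> k; exact: measurableI.
  + rewrite -setI_bigcupl; apply: integrableS iB => //.
    by apply: measurableI => //; exact: bigcupT_measurable.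
Qed.

(** The function vanishes almost everywhere on each of the countably many
    rational boxes that cover Omega. *)
Lemma ae0_of_test : ae_eq (leb R n) Omega v (cst 0).
Proof.
(* The countable intersection is taken over the codes of rational boxes. *)
pose P q x := rat_cbox q `<=` Omega -> rat_obox q x -> v x = 0.
have : {ae leb R n, forall x, forall k : nat, forall q, unpickle k = Some q -> P q x}.
  apply: ae_foralln => k; case: (unpickle k) => [q|]; last by apply: aeW.
  have [qO|nq] := pselect (rat_cbox q `<=` Omega); last first.
    by apply: aeW => x q' [<-] /nq.
  have mq : measurable (@rat_obox R n q) by exact: measurable_box.
  have qO' : rat_obox q `<=` Omega.
    by rewrite (open_bigcup_rat_obox oO); exact: bigcup_sup.
  have : ae_eq (leb R n) (rat_obox q) (EFin \o v) (cst 0%E).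
    apply: (@integral_ae_eq _ _ _ _ _ mq) => //; first exact: integrableS iv.
    move=> E Eq mE; rewrite integral0 -[in LHS](setIidl Eq).
    exact: integral_sub_obox0.
  by apply: filterS => x h q' [<-] _ qx; have [] := h qx.
apply: filterS => x h Ox.
have [q qO qx] : (\bigcup_(q in [set q | rat_cbox q `<=` Omega]) rat_obox q) x.
  by rewrite -open_bigcup_rat_obox.
by apply: (h (pickle q) q) => //; rewrite pickleK.
Qed.

End fundamental_lemma.

(** * Iterated integrals and increments on an interval *)

Section restricted_tonelli.
Local Open Scope ereal_scope.
Context d1 d2 (T1 : measurableType d1) (T2 : measurableType d2) (R : realType).
Variables (m1 : {sigma_finite_measure set T1 -> \bar R}).
Variables (m2 : {sigma_finite_measure set T2 -> \bar R}).
Variables (f : T1 * T2 -> \bar R) (A : set T1) (B : set T2).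
Hypotheses (mA : measurable A) (mB : measurable B).
Hypotheses (mf : measurable_fun setT f) (f0 : forall z, 0 <= f z).

Let g := f \_ (A `*` B).
Let mg : measurable_fun setT g.
Proof.
apply/(measurable_restrictT _ _).1; first exact: measurableX.
exact: measurable_funTS.
Qed.
Let g0 z : 0 <= g z.
Proof. by rewrite /g patchE; case: ifP. Qed.

Lemma measurable_integral_section :
  measurable_fun setT (fun x => \int[m2]_(y in B) f (x, y)).
Proof.
pose k := f \_ (setT `*` B).
have mk : measurable_fun setT k.
  apply/(measurable_restrictT _ _).1; first exact: measurableX.
  exact: measurable_funTS.
have k0 z : 0 <= k z by rewrite /k patchE; case: ifP.
have := @measurable_fun_fubini_tonelli_F _ _ _ _ R m2 k mk k0.
congr measurable_fun; apply/funext => x; rewrite [RHS]integral_mkcond.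
apply: eq_integral => y _; rewrite /k !patchE; congr (if _ then _ else _).
by apply/idP/idP => /set_mem h; apply/mem_set; [case: h|split].
Qed.

Lemma restricted_tonelli : \int[m1]_(x in A) \int[m2]_(y in B) f (x, y) =
  \int[m2]_(y in B) \int[m1]_(x in A) f (x, y).
Proof.
have := @fubini_tonelli _ _ _ _ R m1 m2 g mg g0.
have e x y : g (x, y) = if x \in A then if y \in B then f (x, y) else 0 else 0.
  rewrite /g patchE.
  have [/set_mem xA|/negP xA] := boolP (x \in A).
    have [/set_mem yB|/negP yB] := boolP (y \in B); first by rewrite mem_set.
    by rewrite memNset// => -[_ /= ?]; apply: yB; rewrite inE.
  by rewrite memNset// => -[/= ? _]; apply: xA; rewrite inE.
under eq_integral do (under eq_integral do rewrite e).
under [in RHS]eq_integral do (under eq_integral do rewrite e).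
move=> h; rewrite integral_mkcond [RHS]integral_mkcond.
transitivity (\int[m1]_x \int[m2]_y (if x \in A then if y \in B then f (x, y) else 0 else 0)).
  apply: eq_integral => x _; rewrite patchE; case: ifP => _.
    by rewrite integral_mkcond; apply: eq_integral => y _; rewrite patchE.
  by rewrite integral0.
rewrite h; apply: eq_integral => y _; rewrite patchE; case: ifP => _.
  by rewrite [RHS]integral_mkcond; apply: eq_integral => x _; rewrite patchE.
by rewrite integral0_eq// => x _; case: ifP.
Qed.

End restricted_tonelli.

Section line.
Context (R : realType).
Local Notation lam := (@lebesgue_measure R).

(** The fundamental theorem of calculus and the Cauchy-Schwarz inequality for g'
    and 1. *)
Lemma sqr_increment_le (g g' : R -> R) (a b s t : R) :
  (forall x : R, is_derive x (1 : R) g (g' x)) -> continuous g' ->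
  s \in `[a, b] -> t \in `[a, b] ->
  (((g t - g s) ^+ 2)%:E <= (b - a)%:E * \int[lam]_(x in `[a, b]) (g' x ^+ 2)%:E)%E.
Proof.
move=> dg cg.
wlog st : s t / s <= t.
  move=> h sab tab; have [st|/ltW ts] := leP s t; first exact: h.
  by rewrite -opprB sqrrN; exact: h.
rewrite !in_itv /= => /andP[as_ sb] /andP[at_ tb].
have ab0 : 0 <= b - a by rewrite subr_ge0 (le_trans as_).
have int0 (A : set R) : (0 <= \int[lam]_(x in A) (g' x ^+ 2)%:E)%E.
  by apply: integral_ge0 => x _; rewrite lee_fin sqr_ge0.
have cg0 : continuous g.
  by move=> x; apply: differentiable_continuous; apply/derivable1_diffP; case: (dg x).
have mg' : measurable_fun setT g' by exact: continuous_measurable_fun.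
move: st; rewrite le_eqVlt => /predU1P[->|st].
  by rewrite subrr expr0n /= mule_ge0.
have sg : sqint lam `[s, t] g'.
  split; first exact: measurable_funTS.
  apply: continuous_compact_integrable; first exact: segment_compact.
  apply: continuous_subspaceT => x.
  exact: (continuous_comp (cg x) (@exprn_continuous _ 2 (g' x))).
have ls : lam `[s, t]%classic = (t - s)%:E by rewrite lebesgue_measure_itv /= lte_fin st.
have s1 : sqint lam `[s, t] (cst 1).
  by apply: sqint_cst => //; have := ltry (t - s); rewrite -ls.
have ftc : dotL2 lam `[s, t] g' (cst 1) = g t - g s.
  rewrite /dotL2 /Rintegral; under eq_integral do rewrite mulr1.
  rewrite (@continuous_FTC2 _ g' g)//.
  - exact: continuous_subspaceT.
  - split; first by move=> x _; case: (dg x).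
    + by apply: cvg_at_right_filter; exact: cg0.
    + by apply: cvg_at_left_filter; exact: cg0.
  - by move=> x _; rewrite derive1E derive_val.
have h : `|dotL2 lam `[s, t] g' (cst 1)| <= normL2 lam `[s, t] g' * normL2 lam `[s, t] (cst 1).
  exact: cauchy_schwarz.
rewrite ftc in h.
have {}h : (g t - g s) ^+ 2 <= normL2 lam `[s, t] g' ^+ 2 * (t - s).
  rewrite -real_normK ?num_real// (_ : t - s = normL2 lam `[s, t] (cst 1) ^+ 2).
    by rewrite -exprMn lerXn2r// nnegrE ?mulr_ge0 ?nrm_ge0.
  rewrite sqr_nrm /dotL2 /cst mulr1 Rintegral_cst// mul1r.
  by have := congr1 fine ls.
apply: (@le_trans _ _ (normL2 lam `[s, t] g' ^+ 2 * (t - s))%:E); first by rewrite lee_fin.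
rewrite mulrC EFinM -integral_sqr//; apply: lee_pmul => //.
- by rewrite lee_fin subr_ge0 ltW.
- by rewrite lee_fin; lra.
- apply: ge0_subset_integral => //.
  + by apply: measurable_funTS; apply/measurable_EFinP; exact: measurable_funX.
  + by move=> x _; rewrite lee_fin sqr_ge0.
  + by move=> x /=; rewrite !in_itv /= => /andP[h1 h2]; rewrite (le_trans as_) ?(le_trans h2).
Qed.

End line.

(** * Increments over a cube *)

Section slices.
Context (R : realType) (n : nat).
Implicit Types (phi : 'rV[R]_n.+1 -> R) (t : R) (v : 'rV[R]_n).

Definition slice phi t : 'rV[R]_n -> R := fun v => phi (cons_rV (t, v)).

Lemma cons_rV_add0 (h t : R) v :
  cons_rV (h + t, v) = h *: delta_mx 0 ord0 + cons_rV (t, v) :> 'rV[R]_n.+1.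
Proof.
apply/rowP => j; rewrite !mxE eqxx /=; case: unliftP => [i|] ->.
  by rewrite (_ : lift ord0 i == ord0 = false)// mulr0 add0r.
by rewrite eqxx mulr1.
Qed.

Lemma cons_rV_addS (h t : R) i v :
  cons_rV (t, h *: delta_mx 0 i + v) =
  h *: delta_mx 0 (lift ord0 i) + cons_rV (t, v) :> 'rV[R]_n.+1.
Proof.
apply/rowP => j; rewrite !mxE eqxx /=; case: unliftP => [k|] ->.
  by rewrite !mxE eqxx /= (inj_eq lift_inj).
by rewrite (_ : ord0 == lift ord0 i = false)// mulr0 add0r.
Qed.

Lemma continuous_cons_head v : continuous (fun t : R => cons_rV (t, v) : 'rV[R]_n.+1).
Proof.
move=> t A /nbhs_ballP[e /= e0 eA]; apply/nbhs_ballP; exists e => //= s ts.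
apply: eA; split=> // i j; rewrite !mxE.
by case: unliftP => [k|] _ //=; exact: ballxx.
Qed.

Lemma continuous_cons_tail t : continuous (fun v : 'rV[R]_n => cons_rV (t, v) : 'rV[R]_n.+1).
Proof.
move=> v A /nbhs_ballP[e /= e0 eA]; apply/nbhs_ballP; exists e => //= w [_ vw].
apply: eA; split=> // i j; rewrite !mxE.
by case: unliftP => [k|] _ /=; [exact: vw|exact: ballxx].
Qed.

Lemma slice_is_derive phi t v : diffk 1 phi ->
  is_derive (t : R) (1 : R) (fun t => slice phi t v) (slice (partial ord0 phi) t v).
Proof.
move=> [_ /(_ ord0)[+ _]] => /(_ (cons_rV (t, v))) /derivableP.
rewrite is_derive_line => h; rewrite is_derive_line.
move: h; congr (is_derive _ _ _ _); apply/funext => h.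
by rewrite /slice [_%:A]mulr1 cons_rV_add0.
Qed.

Lemma slice_partial phi t i v : diffk 1 phi ->
  is_derive v (delta_mx 0 i) (slice phi t) (slice (partial (lift ord0 i) phi) t v).
Proof.
move=> [_ /(_ (lift ord0 i))[+ _]] => /(_ (cons_rV (t, v))) /derivableP.
rewrite is_derive_line => h; rewrite is_derive_line.
by move: h; congr (is_derive _ _ _ _); apply/funext => h; rewrite /slice cons_rV_addS.
Qed.

Lemma slice_partialE phi t i : diffk 1 phi ->
  partial i (slice phi t) = slice (partial (lift ord0 i) phi) t.
Proof.
by move=> dphi; apply/funext => v; have [_] := slice_partial t i v dphi.
Qed.

Lemma slice_diffk phi t : diffk 1 phi -> diffk 1 (slice phi t).
Proof.
move=> dphi; have [cphi pphi] := dphi.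
split=> [v|i].
  by apply: (@continuous_comp _ _ _ (fun v => cons_rV (t, v)) phi);
    [exact: continuous_cons_tail|exact: cphi].
split=> [v|]; first by have [] := slice_partial t i v dphi.
rewrite slice_partialE //; split=> [v|] //.
apply: (@continuous_comp _ _ _ (fun v => cons_rV (t, v)) (partial (lift ord0 i) phi)).
  exact: continuous_cons_tail.
by have [_ [cp _]] := pphi (lift ord0 i); exact: cp.
Qed.

Lemma sqr_slice_increment_le phi (a b s t : R) v : diffk 1 phi ->
  s \in `[a, b] -> t \in `[a, b] ->
  (((slice phi t v - slice phi s v) ^+ 2)%:E <=
  (b - a)%:E * \int[@lebesgue_measure R]_(x in `[a, b])
     (slice (partial ord0 phi) x v ^+ 2)%:E)%E.
Proof.
move=> dphi; apply: (@sqr_increment_le _ (fun t => slice phi t v)).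
  by move=> x; exact: slice_is_derive.
move=> x; apply: (@continuous_comp _ _ _ (fun t => cons_rV (t, v)) (partial ord0 phi)).
  exact: continuous_cons_head.
by have [_ /(_ ord0)[_ [cp _]]] := dphi; exact: cp.
Qed.

End slices.

Lemma integral_affine d (T : measurableType d) (R : realType)
    (mu : {measure set T -> \bar R}) (D : set T) (m c : R) (K : \bar R) (f : T -> \bar R) :
  measurable D -> mu D = m%:E -> (0 <= K)%E -> 0 <= c ->
  (forall x, D x -> (0 <= f x)%E) -> measurable_fun D f ->
  (\int[mu]_(x in D) (K + c%:E * f x) = K * m%:E + c%:E * \int[mu]_(x in D) f x)%E.
Proof.
move=> mD Dm K0 c0 f0 mf; rewrite ge0_integralD//.
- by rewrite ge0_integralZl_EFin// integral_cst// Dm.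
- by move=> x Dx; rewrite mule_ge0// f0.
- exact: measurable_funeM.
Qed.

Section cube.
Context (R : realType).
Local Notation lam := (@lebesgue_measure R).

Definition cube n (a : 'I_n -> R) h : set 'rV[R]_n :=
  box (fun i => `[a i, a i + h[%R).

Lemma leb_cube n (a : 'I_n -> R) h : 0 < h -> leb R n (cube a h) = (h ^+ n)%:E.
Proof.
move=> h0; rewrite -[LHS]mul1e -integral_cst; last exact: measurable_box.
elim: n a => [|n ih] a.
  rewrite integral_cst ?mul1e; last exact: measurable_box.
  rewrite /= diracE expr0 mem_set//.
  by move=> [].
rewrite integral_box_cons//.
rewrite (eq_integral (cst (h ^+ n)%:E)); last by move=> t _; exact: ih.
rewrite integral_cst//= lebesgue_measure_itv /= lte_fin ltrDl h0.
by rewrite -EFinB -EFinM addrAC subrr add0r exprSr.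
Qed.

Local Open Scope ereal_scope.

(** The constants of the induction step of [cube_increments]: the first term
    comes from the increment in the new coordinate, the second one from the
    induction hypothesis. *)
Let cube_const n (h : R) (A S : \bar R) : (0 <= h)%R -> 0 <= A -> 0 <= S ->
  ((2 * h * h ^+ n * h)%:E * A + 2%:E * ((2 ^+ n * h ^+ n.+2)%:E * S)) * h%:E <=
  (2 ^+ n.+1 * h ^+ n.+3)%:E * (A + S).
Proof.
move=> h0 A0 S0; have c0 : (0 <= 2 ^+ n * h ^+ n.+2)%R by rewrite mulr_ge0 ?exprn_ge0.
have k0 : (0 <= 2 * h * h ^+ n * h)%R by rewrite ?(mulr_ge0, exprn_ge0).
rewrite ge0_muleDl ?mule_ge0// (ge0_muleDr _ A0 S0).
rewrite ![_ * h%:E]muleC !muleA -!EFinM.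
apply: leeD; apply: lee_wpmul2r => //; rewrite lee_fin.
  rewrite (_ : h * (2 * h * h ^+ n * h) = 2 * h ^+ n.+3)%R; last by rewrite !exprS; ring.
  rewrite ler_wpM2r ?exprn_ge0// exprS ler_peMr// exprn_ege1// ler1n//.
by rewrite le_eqVlt; apply/orP; left; apply/eqP; rewrite !exprS; ring.
Qed.

(** By induction on the dimension. Writing x = (t, v) and y = (s, w), one has
      (phi (t, v) - phi (s, w))^2 <= 2 (phi (t, v) - phi (s, v))^2
                                   + 2 (phi (s, v) - phi (s, w))^2,
    where the first square is bounded by h times the integral of
    (d_0 phi)^2 over the line through v, and the second one is handled by the
    induction hypothesis on the slice at s. *)
Lemma cube_increments n (a : 'I_n -> R) h (phi : 'rV[R]_n -> R) : (0 < h)%R ->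
  diffk 1 phi ->
  \int[leb R n]_(x in cube a h) \int[leb R n]_(y in cube a h)
     ((phi x - phi y) ^+ 2)%:E <=
  (2 ^+ n * h ^+ n.+2)%:E * \sum_(i < n)
     \int[leb R n]_(x in cube a h) (partial i phi x ^+ 2)%:E.
Proof.
move=> h0; elim: n a phi => [|n ih] a phi dphi.
  rewrite big_ord0 mule0 integral0_eq// => x _; rewrite integral0_eq// => y _.
  by rewrite (_ : x = y) ?subrr ?expr0n//; apply/rowP => -[].
have [cphi pphi] := dphi.
have mphi := continuous_measurable_rVT cphi.
have mpart i : measurable_fun setT (partial i phi).
  by apply: continuous_measurable_rVT; have [_ [cp _]] := pphi i.
set I := [set` `[a ord0, a ord0 + h[%R].
set Q := cube (fun i => a (lift ord0 i)) h.
have mQ : measurable Q by exact: measurable_box.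
have mI : measurable (I : set (measurableTypeR R)) by exact: measurable_itv.
have muI : lam I = h%:E.
  rewrite /I lebesgue_measure_itv /= lte_fin ltrDl h0.
  by rewrite -EFinB addrAC subrr add0r.
have intc (K : \bar R) : \int[lam]_(t in I) K = K * h%:E.
  by rewrite integral_cst//; congr (_ * _); exact: muI.
have muQ : leb R n Q = (h ^+ n)%:E by exact: leb_cube.
have hn0 : (0 <= h ^+ n)%R by rewrite exprn_ge0 ?ltW.
have h0' : (0 <= h)%R by exact: ltW.
(* D v is the energy of the new coordinate along the line through v, and E s v
   the inner double increment on the slice at s. *)
pose X t v := slice phi t v.
pose D v := \int[lam]_(t in I) (slice (partial ord0 phi) t v ^+ 2)%:E.
pose E t v := \int[leb R n]_(w in Q) ((X t v - X t w) ^+ 2)%:E.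
have D0 v : 0 <= D v by apply: integral_ge0 => t _; rewrite lee_fin sqr_ge0.
have E0 t v : 0 <= E t v by apply: integral_ge0 => w _; rewrite lee_fin sqr_ge0.
have mXX (u : 'rV[R]_n.+1 -> R) : measurable_fun setT u ->
    measurable_fun setT (fun z : measurableTypeR R * 'rV[R]_n => slice u z.1 z.2).
  move=> mu; have := measurableT_comp mu (@measurable_cons_rV R n).
  by congr measurable_fun; apply/funext => -[t v].
have X2 t s v w : t \in `[a ord0, (a ord0 + h)%R[ -> s \in `[a ord0, (a ord0 + h)%R[ ->
    ((X t v - X s w) ^+ 2)%:E <=
    (2 * h)%:E * D v + 2%:E * ((X s v - X s w) ^+ 2)%:E.
  move=> tI sI.
  have cI r : r \in `[a ord0, (a ord0 + h)%R[ -> r \in `[a ord0, (a ord0 + h)%R].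
    by rewrite !in_itv /= => /andP[-> /ltW ->].
  have := sqr_slice_increment_le v dphi (cI _ sI) (cI _ tI).
  rewrite -integral_itv_bndo_bndc; last first.
    apply: measurable_funTS; apply/measurable_EFinP; apply: measurable_funX.
    have := measurableT_comp (mXX _ (mpart ord0)) (pair2_measurable v).
    by congr measurable_fun; apply/funext.
  rewrite (_ : a ord0 + h - a ord0 = h)%R; last by rewrite addrAC subrr add0r.
  rewrite -/(D v) => hD.
  have : 2%:E * ((X t v - X s v) ^+ 2)%:E <= (2 * h)%:E * D v.
    by rewrite (EFinM 2 h) -muleA lee_wpmul2l.
  move=> /(leeD2r (2%:E * ((X s v - X s w) ^+ 2)%:E)).
  apply: le_trans; rewrite -!EFinM -EFinD lee_fin.
  have := sqr_ge0 ((X t v - X s v) - (X s v - X s w))%R; nra.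
have mX : measurable_fun setT (fun z : measurableTypeR R * 'rV[R]_n => X z.1 z.2) by exact: mXX.
have mD : measurable_fun setT D.
  apply: (@measurable_integral_section _ _ _ _ _ lam
    (fun z : 'rV[R]_n * measurableTypeR R => (slice (partial ord0 phi) z.2 z.1 ^+ 2)%:E)) => //.
    apply/measurable_EFinP; apply: measurable_funX.
    exact: (measurableT_comp (mXX _ (mpart ord0)) (@measurable_swap _ _ _ _)).
  by move=> z; rewrite lee_fin sqr_ge0.
have mE : measurable_fun setT (fun z : measurableTypeR R * 'rV[R]_n => E z.1 z.2).
  apply: (@measurable_integral_section _ _ _ _ _ (leb R n)
    (fun z : (measurableTypeR R * 'rV[R]_n) * 'rV[R]_n => ((X z.1.1 z.1.2 - X z.1.1 z.2) ^+ 2)%:E)) => //.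
    apply/measurable_EFinP; apply: measurable_funX; apply: measurable_funB.
      exact: (measurableT_comp mX measurable_fst).
    have m2 : measurable_fun setT (fun z : (measurableTypeR R * 'rV[R]_n) * 'rV[R]_n => (z.1.1, z.2)).
      apply/measurable_fun_pairP; split => /=.
        exact: (measurableT_comp measurable_fst measurable_fst).
      exact: measurable_snd.
    exact: (measurableT_comp mX m2).
  by move=> z; rewrite lee_fin sqr_ge0.
have mE1 v : measurable_fun setT (fun t : measurableTypeR R => E t v).
  exact: (measurableT_comp mE (pair2_measurable v)).
have mE2 t : measurable_fun setT (E t).
  exact: (measurableT_comp mE (pair1_measurable t)).
(* H v bounds the integral over y of the squared increments from (t, v),
   uniformly in t. *)
pose H v := (2 * h * h ^+ n * h)%:E * D v + 2%:E * \int[lam]_(s in I) E s v.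
have mkk : measurable_fun setT
   (fun z : 'rV[R]_n.+1 * 'rV[R]_n.+1 => ((phi z.1 - phi z.2) ^+ 2)%:E).
  apply/measurable_EFinP; apply: measurable_funX; apply: measurable_funB.
    exact: (measurableT_comp mphi measurable_fst).
  exact: (measurableT_comp mphi measurable_snd).
rewrite integral_box_cons; last 2 first.
- apply: (@measurable_integral_section _ _ _ _ _ (leb R n.+1)
    (fun z : 'rV[R]_n.+1 * 'rV[R]_n.+1 => ((phi z.1 - phi z.2) ^+ 2)%:E)) => //.
    exact: measurable_box.
  by move=> z; rewrite lee_fin sqr_ge0.
- by move=> x; apply: integral_ge0 => y _; rewrite lee_fin sqr_ge0.
have HP t v : t \in `[a ord0, (a ord0 + h)%R[ -> 
    \int[leb R n.+1]_(y in cube a h) ((phi (cons_rV (t, v)) - phi y) ^+ 2)%:E <= H v.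
  move=> tI; rewrite integral_box_cons; last 2 first.
  - by apply/measurable_EFinP; apply: measurable_funX; exact: measurable_funB.
  - by move=> y; rewrite lee_fin sqr_ge0.
  apply: (@le_trans _ _ (\int[lam]_(s in I) ((2 * h)%:E * D v * (h ^+ n)%:E + 2%:E * E s v))).
    apply: ge0_le_integral => //.
    + by move=> s _; apply: integral_ge0 => w _; rewrite lee_fin sqr_ge0.
    + apply: measurable_funTS.
      apply: (@measurable_integral_section _ _ _ _ _ (leb R n)
        (fun z : measurableTypeR R * 'rV[R]_n => ((X t v - X z.1 z.2) ^+ 2)%:E)) => //.
        apply/measurable_EFinP; apply: measurable_funX.
        exact: measurable_funB.
      by move=> z; rewrite lee_fin sqr_ge0.
    + apply: measurable_funTS; apply: emeasurable_funD; first exact: measurable_cst.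
      by apply: measurable_funeM; exact: mE1.
    + move=> s sI; rewrite -(integral_affine mQ muQ) ?mule_ge0 ?lee_fin ?mulr_ge0//; last 2 first.
      * by move=> w _; rewrite lee_fin sqr_ge0.
      * apply/measurable_EFinP; apply: measurable_funX; apply: measurable_funB => //.
        exact: measurable_funTS (measurableT_comp mX (pair1_measurable s)).
      apply: ge0_le_integral => //.
      * by move=> w _; rewrite lee_fin sqr_ge0.
      * apply/measurable_EFinP; apply: measurable_funX; apply: measurable_funB => //.
        exact: measurable_funTS (measurableT_comp mX (pair1_measurable s)).
      * apply: emeasurable_funD; first exact: measurable_cst.
        apply: measurable_funeM.
        apply/measurable_EFinP; apply: measurable_funX; apply: measurable_funB => //.
        exact: measurable_funTS (measurableT_comp mX (pair1_measurable s)).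
      * by move=> w _; exact: X2.
  rewrite (integral_affine mI muI) ?mule_ge0 ?lee_fin ?mulr_ge0//; last first.
    exact: (measurable_funTS (mE1 v)).
  by rewrite /H !EFinM leeD2r// -!muleA lee_pmul2l ?lte_fin// ?(muleC (D v)) !muleA.
have mDI : measurable_fun setT (fun v => \int[lam]_(s in I) E s v).
  apply: (@measurable_integral_section _ _ _ _ _ lam
    (fun z : 'rV[R]_n * measurableTypeR R => E z.2 z.1)) => //.
  exact: (measurableT_comp mE (@measurable_swap _ _ _ _)).
have DI0 v : 0 <= \int[lam]_(s in I) E s v by apply: integral_ge0.
have mH : measurable_fun setT H.
  by apply: emeasurable_funD; exact: measurable_funeM.
have k0 : (0 <= 2 * h * h ^+ n * h)%R by rewrite !mulr_ge0.
apply: (@le_trans _ _ (\int[lam]_(t in I) \int[leb R n]_(v in Q) H v)).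
  apply: ge0_le_integral => //.
  - by move=> t _; apply: integral_ge0 => v _; apply: integral_ge0 => y _; rewrite lee_fin sqr_ge0.
  - apply: measurable_funTS.
    apply: (@measurable_integral_section _ _ _ _ _ (leb R n)
      (fun z : measurableTypeR R * 'rV[R]_n =>
         \int[leb R n.+1]_(y in cube a h) ((phi (cons_rV z) - phi y) ^+ 2)%:E)) => //.
    + have := @measurable_integral_section _ _ _ _ _ (leb R n.+1)
        (fun z : 'rV[R]_n.+1 * 'rV[R]_n.+1 => ((phi z.1 - phi z.2) ^+ 2)%:E) _ (measurable_box _) mkk.
      move=> h1; apply: (measurableT_comp (h1 _ _) (@measurable_cons_rV R n)).
      by move=> z; rewrite lee_fin sqr_ge0.
    + by move=> z; apply: integral_ge0 => y _; rewrite lee_fin sqr_ge0.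
  - move=> t tI; apply: ge0_le_integral => //.
    + by move=> v _; apply: integral_ge0 => y _; rewrite lee_fin sqr_ge0.
    + apply: measurable_funTS.
      have := @measurable_integral_section _ _ _ _ _ (leb R n.+1)
        (fun z : 'rV[R]_n.+1 * 'rV[R]_n.+1 => ((phi z.1 - phi z.2) ^+ 2)%:E) _ (measurable_box _) mkk.
      move=> h1; apply: (measurableT_comp (h1 _ _) _).
        by move=> z; rewrite lee_fin sqr_ge0.
      exact: (measurableT_comp (@measurable_cons_rV R n) (pair1_measurable t)).
    + exact: measurable_funTS.
    + by move=> v _; exact: HP.
pose A := \int[leb R n.+1]_(x in cube a h) (partial ord0 phi x ^+ 2)%:E.
pose S := \sum_(i < n) \int[leb R n.+1]_(x in cube a h) (partial (lift ord0 i) phi x ^+ 2)%:E.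
have A0 : 0 <= A by apply: integral_ge0 => x _; rewrite lee_fin sqr_ge0.
have S0 : 0 <= S.
  by apply: sume_ge0 => i _; apply: integral_ge0 => x _; rewrite lee_fin sqr_ge0.
have AE : \int[leb R n]_(v in Q) D v = A.
  rewrite /A integral_box_cons; last 2 first.
  - by apply/measurable_EFinP; exact: measurable_funX.
  - by move=> x; rewrite lee_fin sqr_ge0.
  apply/esym; apply: (@restricted_tonelli _ _ _ _ R lam (leb R n)
    (fun z : measurableTypeR R * 'rV[R]_n => (slice (partial ord0 phi) z.1 z.2 ^+ 2)%:E)) => //.
    by apply/measurable_EFinP; apply: measurable_funX; exact: mXX.
  by move=> z; rewrite lee_fin sqr_ge0.
have c0 : (0 <= 2 ^+ n * h ^+ n.+2)%R by rewrite mulr_ge0 ?exprn_ge0.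
have SE : \int[leb R n]_(v in Q) \int[lam]_(s in I) E s v <= (2 ^+ n * h ^+ n.+2)%:E * S.
  have -> : \int[leb R n]_(v in Q) \int[lam]_(s in I) E s v =
            \int[lam]_(s in I) \int[leb R n]_(v in Q) E s v.
    apply/esym; exact: (@restricted_tonelli _ _ _ _ R lam (leb R n)
      (fun z : measurableTypeR R * 'rV[R]_n => E z.1 z.2)).
  have mi i : measurable_fun setT (fun s : measurableTypeR R =>
      \int[leb R n]_(v in Q) (slice (partial (lift ord0 i) phi) s v ^+ 2)%:E).
    apply: (@measurable_integral_section _ _ _ _ _ (leb R n)
      (fun z : measurableTypeR R * 'rV[R]_n => (slice (partial (lift ord0 i) phi) z.1 z.2 ^+ 2)%:E)) => //.
      by apply/measurable_EFinP; apply: measurable_funX; exact: mXX.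
    by move=> z; rewrite lee_fin sqr_ge0.
  have i0 i s : 0 <= \int[leb R n]_(v in Q) (slice (partial (lift ord0 i) phi) s v ^+ 2)%:E.
    by apply: integral_ge0 => x _; rewrite lee_fin sqr_ge0.
  have -> : S = \int[lam]_(s in I) \sum_(i < n) \int[leb R n]_(v in Q)
       (slice (partial (lift ord0 i) phi) s v ^+ 2)%:E.
    rewrite ge0_integral_sum//; last by move=> i; exact: measurable_funTS.
    apply: eq_bigr => i _; rewrite integral_box_cons//.
      by apply/measurable_EFinP; exact: measurable_funX.
    by move=> x; rewrite lee_fin sqr_ge0.
  rewrite -ge0_integralZl_EFin//; last 2 first.
  - by move=> s _; apply: sume_ge0.
  - by apply: measurable_funTS; apply: emeasurable_sum.
  apply: ge0_le_integral => //.
  - by move=> s _; apply: integral_ge0.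
  - apply: measurable_funTS.
    exact: (@measurable_integral_section _ _ _ _ _ (leb R n)
      (fun z : measurableTypeR R * 'rV[R]_n => E z.1 z.2)).
  - by apply: measurable_funTS; apply: measurable_funeM; apply: emeasurable_sum.
  - move=> s _; have h1 := ih (fun i => a (lift ord0 i)) _ (slice_diffk s dphi).
    rewrite (eq_bigr (fun i => \int[leb R n]_(v in Q)
      (slice (partial (lift ord0 i) phi) s v ^+ 2)%:E)) in h1.
      exact: h1.
    by move=> i _; rewrite slice_partialE.
have -> : \int[leb R n]_(v in Q) H v = (2 * h * h ^+ n * h)%:E * A +
   2%:E * \int[leb R n]_(v in Q) \int[lam]_(s in I) E s v.
  rewrite ge0_integralD//; last 4 first.
  - by move=> v _; rewrite mule_ge0.
  - by apply: measurable_funTS; exact: measurable_funeM.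
  - by move=> v _; rewrite mule_ge0.
  - by apply: measurable_funTS; exact: measurable_funeM.
  rewrite ge0_integralZl_EFin//; last exact: measurable_funTS.
  rewrite AE ge0_integralZl_EFin//; exact: measurable_funTS.
rewrite big_ord_recl -/A -/S intc.
apply: (@le_trans _ _ (((2 * h * h ^+ n * h)%:E * A +
  2%:E * ((2 ^+ n * h ^+ n.+2)%:E * S)) * h%:E)).
  by rewrite lee_wpmul2r// leeD2l// lee_wpmul2l.
by clearbody A S; exact: cube_const.
Qed.

End cube.

(** * Test functions and the Poincare inequality on a cube *)

Section continuous_sqint.
Context (R : realType) (n : nat).

Lemma sqint_continuous (U : set 'rV[R]_n) u : measurable U -> bounded_set U ->
  continuous u -> sqint (leb R n) U u.
Proof.
move=> mU bU cu; have [M M0 UM] := bounded_sub_box bU.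
have cpt : compact (u @` cbox (fun=> - M) (fun=> M)).
  apply: continuous_compact; last exact: compact_cbox.
  exact: continuous_subspaceT.
have [K [_ hK]] := compact_bounded cpt.
apply: (@sqint_bounded _ _ _ _ _ mU _ (K + 1)).
- exact: leb_bounded.
- exact: measurable_funTS (continuous_measurable_rVT cu).
- by move=> x /UM Ux; apply: (hK (K + 1)); [rewrite ltrDl|exists x].
Qed.

Lemma smooth_partials (u : 'rV[R]_n -> R) s : smooth u -> smooth (partials s u).
Proof. by move=> su t; rewrite /partials -foldr_cat; exact: su. Qed.

Lemma smooth_diffk (u : 'rV[R]_n -> R) : smooth u -> diffk 1 u.
Proof.
move=> su; have [cu du] := su [::].
by split=> // i; split; [exact: du|split=> //; case: (su [:: i])].
Qed.

Variable Omega : set 'rV[R]_n.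
Implicit Types phi : 'rV[R]_n -> R.

Lemma test_out phi x : test_function Omega phi -> ~ Omega x -> phi x = 0.
Proof.
move=> [_ _ sO] nOx; apply: contra_notP nOx => /eqP h; apply: sO.
exact: subset_closure.
Qed.

(** The support can only shrink: phi vanishes on the open complement of its
    support. *)
Lemma test_partial phi i : test_function Omega phi ->
  test_function Omega (partial i phi).
Proof.
move=> [sphi cphi sO].
have sub : closure [set x | partial i phi x != 0] `<=` closure [set x | phi x != 0].
  rewrite [X in _ `<=` X]((closure_id _).1 (@closed_closure _ _)).
  apply: closureS => x /= /eqP; apply: contra_notP => nx.
  have : \near x, cst 0 x = phi x.
    have : nbhs x (~` closure [set x | phi x != 0]).
      by apply: open_nbhs_nbhs; split=> //; rewrite openC; exact: closed_closure.
    apply: filterS => y ny; apply/eqP; rewrite eq_sym; apply: contra_notT ny => ny.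
    by apply: subset_closure; exact: ny.
  by rewrite /partial => /near_eq_derive <-; exact: derive_cst.
split; first exact: (@smooth_partials _ [:: i]).
- exact: subclosed_compact (@closed_closure _ _) cphi sub.
- exact: subset_trans sub sO.
Qed.

End continuous_sqint.

Section cube_poincare.
Context (R : realType) (n : nat).

Lemma bounded_box (a b : 'I_n -> R) (U : set 'rV[R]_n) :
  U `<=` cbox a b -> bounded_set U.
Proof.
move=> Uab; have [K [Kr hK]] := compact_bounded (@compact_cbox R n a b).
by exists K; split=> // M /hK h x /Uab; exact: h.
Qed.

(** The double integral of (phi x - phi y)^2 over Q x Q equals
    2 h^n |phi|^2 - 2 <phi, 1>^2 and is bounded by [cube_increments]. *)
Lemma cube_poincare (a : 'I_n -> R) h (phi : 'rV[R]_n -> R) (Q := cube a h) : 0 < h ->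
  diffk 1 phi ->
  dotL2 (leb R n) Q phi phi <= h ^- n * dotL2 (leb R n) Q phi (cst 1) ^+ 2 +
    2 ^+ n * h ^+ 2 * \sum_(i < n) dotL2 (leb R n) Q (partial i phi) (partial i phi).
Proof.
move=> h0 dphi; have mQ : measurable Q by exact: measurable_box.
have bQ : bounded_set Q.
  apply: (@bounded_box a (fun i => a i + h)) => x hx i; have := hx i.
  by rewrite !in_itv /= => /andP[-> /ltW ->].
have [cphi pphi] := dphi.
have sphi : sqint (leb R n) Q phi by exact: sqint_continuous.
have spart i : sqint (leb R n) Q (partial i phi).
  by apply: sqint_continuous => //; have [_ [cp _]] := pphi i; exact: cp.
have s1 : sqint (leb R n) Q (cst 1) by apply: sqint_cst => //; exact: leb_bounded.
have one : dotL2 (leb R n) Q (cst 1) (cst 1) = h ^+ n.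
  rewrite /dotL2 /cst mulr1 Rintegral_cst// mul1r.
  exact: (congr1 fine (leb_cube a h0)).
have := cube_increments a h0 dphi.
rewrite (eq_bigr (fun i => (dotL2 (leb R n) Q (partial i phi) (partial i phi))%:E)); last first.
  by move=> i _; rewrite integral_sqr// sqr_nrm.
set m := dotL2 _ _ phi (cst 1); set q := dotL2 _ _ phi phi;
pose S := \sum_(i < n) dotL2 (leb R n) Q (partial i phi) (partial i phi).
have inner x : (\int[leb R n]_(y in Q) ((phi x - phi y) ^+ 2)%:E =
    (h ^+ n * phi x * phi x + (- 2 * m) * phi x + q)%:E)%E.
  have sc : sqint (leb R n) Q (phi x \*o cst 1) by exact: sqintZ.
  have sd : sqint (leb R n) Q ((phi x \*o cst 1) \- phi) by exact: sqintB.
  rewrite (eq_integral (fun y => ((((phi x \*o cst 1) \- phi) y) ^+ 2)%:E)); last first.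
    by move=> y _ /=; rewrite mulr1.
  rewrite integral_sqr// sqr_nrm; congr EFin.
  rewrite ipBl// !ipBr// !ipZl// !ipZr// one (ipC _ _ (cst 1)) -/m -/q; ring.
rewrite (eq_integral (fun x => (h ^+ n * phi x * phi x + (- 2 * m) * phi x + q)%:E)); last first.
  by move=> x _; exact: inner.
have i1 : (leb R n).-integrable Q (EFin \o (fun x => h ^+ n * phi x * phi x)).
  have := integrableZl mQ (h ^+ n) (sqint_mul mQ sphi sphi).
  by apply: eq_integrable => // x _ /=; rewrite -EFinM mulrA.
have iphi : (leb R n).-integrable Q (EFin \o phi).
  by have := sqint_mul mQ sphi s1; apply: eq_integrable => // x _ /=; rewrite mulr1.
have i2 : (leb R n).-integrable Q (EFin \o (fun x => (- 2 * m) * phi x)).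
  exact: (integrableZl mQ (- 2 * m) iphi).
have i3 : (leb R n).-integrable Q (EFin \o (fun x => h ^+ n * phi x * phi x + (- 2 * m) * phi x)).
  exact: (integrableD mQ i1 i2).
have iq : (leb R n).-integrable Q (EFin \o cst q).
  have := integrableZl mQ q (sqint_mul mQ s1 s1).
  by apply: eq_integrable => // x _ /=; rewrite -EFinM !mulr1.
have outer : (\int[leb R n]_(x in Q)
    (h ^+ n * phi x * phi x + (- 2 * m) * phi x + q)%:E =
    (2 * h ^+ n * q - 2 * m ^+ 2)%:E)%E.
  rewrite -[LHS]fineK; last exact: (integrable_fin_num mQ (integrableD mQ i3 iq)).
  congr EFin; rewrite -/(Rintegral (leb R n) Q (fun x => _)).
  rewrite RintegralD// RintegralD// RintegralZl//.
  have -> : Rintegral (leb R n) Q phi = m.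
    by apply: eq_Rintegral => x _; rewrite mulr1.
  have -> : Rintegral (leb R n) Q (fun x => h ^+ n * phi x * phi x) = h ^+ n * q.
    rewrite -RintegralZl//; last exact: sqint_mul.
    by apply: eq_Rintegral => x _; rewrite mulrA.
  rewrite Rintegral_cst// (congr1 fine (leb_cube a h0)) /=; ring.
rewrite outer sumEFin -EFinM lee_fin -/S => le.
have hn : 0 < h ^+ n by rewrite exprn_gt0.
have S0 : 0 <= S by apply: sumr_ge0 => i _; exact: ip_ge0.
have T0 : 0 <= 2 ^+ n * h ^+ n.+2 * S.
  by apply: mulr_ge0 => //; apply: mulr_ge0; apply: exprn_ge0; lra.
rewrite -(ler_pM2l hn) mulrDr mulVKf ?gt_eqF//.
rewrite (_ : h ^+ n * (2 ^+ n * h ^+ 2 * S) = 2 ^+ n * h ^+ n.+2 * S); first by lra.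
by rewrite !exprS; ring.
Qed.

End cube_poincare.

(** * Coercivity on test functions *)

Section grid.
Context (R : realType) (n : nat) (Omega : set 'rV[R]_n).
Hypotheses (oO : open Omega) (bO : bounded_set Omega).
Let mO : measurable Omega := measurable_open_rV oO.
Local Notation mu := (leb R n).

(** Through c the cells partition Omega; where they stick out of it, u vanishes. *)
Lemma sum_ip_cells (T : finType) (Q : T -> set 'rV[R]_n) (c : 'rV[R]_n -> T)
    (u : 'rV[R]_n -> R) :
  (forall t, measurable (Q t)) -> (forall t, bounded_set (Q t)) ->
  (forall x t, Omega x -> (Q t x <-> c x = t)) ->
  continuous u -> (forall x, ~ Omega x -> u x = 0) ->
  \sum_t dotL2 mu (Q t) u u = dotL2 mu Omega u u.
Proof.
move=> mQ bQ Qc cu u0.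
have sO : sqint mu Omega u by exact: sqint_continuous.
have sQ t : sqint mu (Q t) u by exact: sqint_continuous.
have mu2 D : measurable_fun D (fun x => (u x ^+ 2)%:E).
  apply: measurable_funTS; apply/measurable_EFinP; apply: measurable_funX.
  exact: continuous_measurable_rVT.
apply: EFin_inj; rewrite -sumEFin -sqr_nrm -integral_sqr//.
transitivity (\sum_t \int[mu]_(x in Omega) ((u x * \1_(Q t) x) ^+ 2)%:E)%E.
  apply: eq_bigr => t _; rewrite -sqr_nrm -integral_sqr//.
  rewrite integral_mkcond [RHS]integral_mkcond; apply: eq_integral => x _.
  rewrite !patchE indicE; have [Qx|nQx] := boolP (x \in Q t).
    rewrite mulr1; case: ifPn => // /negP nOx.
    by rewrite u0 ?expr0n// => Ox; apply: nOx; rewrite inE.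
  by rewrite mulr0 expr0n; case: ifP.
rewrite -ge0_integral_sum//; last 2 first.
- move=> t; apply/measurable_EFinP; apply: measurable_funX; apply: measurable_funM => //.
  exact: measurable_funTS (continuous_measurable_rVT cu).
- by move=> t x _; rewrite lee_fin sqr_ge0.
apply: eq_integral => x /set_mem Ox.
rewrite sumEFin; congr EFin; rewrite (bigD1 (c x))//= big1 ?addr0.
  by rewrite indicE mem_set ?mulr1//; exact/Qc.
move=> t tc; rewrite indicE memNset ?mulr0 ?expr0n//.
by move=> /(Qc _ _ Ox) h; rewrite h eqxx in tc.
Qed.

(** A cube that contains Omega is cut into cells of side h and [cube_poincare] is
    applied in each cell: the means over the cells become the functionals, and the
    factor of the gradient term is small with h. *)
Lemma rellich_functionals (e : R) : 0 < e ->
  exists (T : finType) (Q : T -> set 'rV[R]_n) (C : R),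
  [/\ forall t, measurable (Q t), 0 <= C &
    forall phi, test_function Omega phi ->
      dotL2 mu Omega phi phi <= C * \sum_t dotL2 mu Omega phi (\1_(Q t)) ^+ 2
        + e * \sum_(i < n) dotL2 mu Omega (partial i phi) (partial i phi)].
Proof.
move=> e0; have [M0 M00 OM0] := bounded_sub_box bO.
pose M := M0 + 1.
have M_gt0 : 0 < M by rewrite addr_gt0.
(* The side h is at most d, so that 2^n h^2 <= 2^n h <= e. *)
pose d : R := Num.min 1 (e / 2 ^+ n).
have d0 : 0 < d by rewrite lt_min ltr01 divr_gt0 ?exprn_gt0.
pose N := Num.trunc (2 * M / d).
pose h := 2 * M / N.+1%:R.
have h0 : 0 < h by rewrite divr_gt0// mulr_gt0.
have hd : h <= d.
  rewrite ler_pdivrMr// [d * _]mulrC -ler_pdivrMr//.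
  by rewrite /N ltW// truncnS_gt.
have he : 2 ^+ n * h ^+ 2 <= e.
  have h1 : h <= 1 by rewrite (le_trans hd)// ge_min lexx.
  have h2 : h <= e / 2 ^+ n by rewrite (le_trans hd)// ge_min lexx orbT.
  rewrite mulrC -ler_pdivlMr ?exprn_gt0// (le_trans _ h2)// expr2.
  by rewrite ler_piMr// ltW.
(* A cell is indexed by the integer coordinates of its corner. *)
pose T := {ffun 'I_n -> 'I_N.+1}.
pose a (t : T) i : R := - M + (t i)%:R * h.
pose Q (t : T) := cube (a t) h.
pose c (x : 'rV[R]_n) : T := [ffun i => inord (Num.trunc ((x ord0 i + M) / h))].
have mQ t : measurable (Q t) by exact: measurable_box.
have bQ t : bounded_set (Q t).
  apply: (@bounded_box _ _ (a t) (fun i => a t i + h)) => x hx i; have := hx i.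
  by rewrite !in_itv /= => /andP[-> /ltW ->].
have Qc x t : Omega x -> (Q t x <-> c x = t).
  move=> Ox.
  have cell i : exists2 k : 'I_N.+1, c x i = k & k%:R * h <= x ord0 i + M < k.+1%:R * h.
    have := OM0 _ Ox i; rewrite in_itv /= => /andP[x1 x2].
    have y0 : 0 <= (x ord0 i + M) / h by rewrite divr_ge0 ?(ltW h0)// /M; lra.
    have := truncn_itv y0; set k := Num.trunc _ => /andP[k1 k2].
    have kN : (k < N.+1)%N.
      rewrite -(ltr_nat R) (le_lt_trans k1)// ltr_pdivrMr// /h mulrC divfK ?pnatr_eq0//.
      by rewrite /M; lra.
    exists (inord k); first by rewrite ffunE.
    by rewrite inordK// -ler_pdivlMr// k1 -ltr_pdivrMr.
  split=> [Qx|<-].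
    apply/ffunP => i; have [k -> /andP[k1 k2]] := cell i.
    have := Qx i; rewrite in_itv /= /a => /andP[t1 t2].
    have l1 : (k <= t i)%N.
      rewrite -ltnS -(ltr_nat R) -(ltr_pM2r h0) -[(t i).+1%:R]natr1 mulrDl; lra.
    have l2 : (t i <= k)%N.
      by rewrite -ltnS -(ltr_nat R) -(ltr_pM2r h0); lra.
    by apply/val_inj/eqP; rewrite eqn_leq l1.
  move=> i; have [k ck /andP[k1 k2]] := cell i.
  by rewrite in_itv /= /a ck; move: k2; rewrite -natr1 mulrDl; lra.
exists T, Q, (h ^- n); split=> //; first by rewrite invr_ge0 exprn_ge0 ?ltW.
move=> phi tphi; have [sphi _ _] := tphi.
have dphi := smooth_diffk sphi; have [cphi pphi] := dphi.
have out := fun x => @test_out _ _ _ _ x tphi.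
rewrite -(sum_ip_cells mQ bQ Qc cphi out).
apply: (@le_trans _ _ (\sum_t (h ^- n * dotL2 mu Omega phi \1_(Q t) ^+ 2
   + e * \sum_(i < n) dotL2 mu (Q t) (partial i phi) (partial i phi)))).
  apply: ler_sum => t _; apply: le_trans (cube_poincare _ h0 dphi) _; apply: lerD.
    rewrite (_ : dotL2 _ (cube _ _) _ _ = dotL2 mu Omega phi \1_(Q t))//.
    rewrite /dotL2 Rintegral_mkcond [RHS]Rintegral_mkcond; apply: eq_Rintegral => x _.
    rewrite !patchE indicE; have [Qx|nQx] := boolP (x \in Q t).
      case: ifPn => // /negP nOx.
      by rewrite out ?mul0r// => Ox; apply: nOx; rewrite inE.
    by rewrite mulr0; case: ifP.
  by rewrite ler_wpM2r// sumr_ge0// => i _; exact: ip_ge0.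
rewrite big_split /= -!mulr_sumr lerD2l ler_wpM2l ?(ltW e0)//.
rewrite exchange_big /= ler_sum// => i _.
rewrite (sum_ip_cells mQ bQ Qc)//.
  by have [_ [cp _]] := pphi i.
by move=> x; exact: test_out (test_partial i tphi).
Qed.

End grid.

Section poincare.
Context (R : realType) (n : nat) (Omega : set 'rV[R]_n.+1).
Hypotheses (oO : open Omega) (bO : bounded_set Omega).
Let mO : measurable Omega := measurable_open_rV oO.
Local Notation mu := (leb R n.+1).
Local Notation lam := (@lebesgue_measure R).

(** A test function vanishes on a face of a cube that contains Omega, so its value
    at a point is its increment from that face along the first coordinate. *)
Lemma poincare : exists2 C : R, 0 < C & forall phi, test_function Omega phi ->
  dotL2 mu Omega phi phi <= C * dotL2 mu Omega (partial ord0 phi) (partial ord0 phi).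
Proof.
have [M0 M00 OM0] := bounded_sub_box bO.
(* The margin 1 puts the face of first coordinate - M outside Omega. *)
pose M := M0 + 1; have M_gt0 : 0 < M by rewrite addr_gt0.
exists ((2 * M) ^+ 2); first by rewrite exprn_gt0// mulr_gt0.
move=> phi tphi; have [sphi _ _] := tphi.
have dphi := smooth_diffk sphi; have [cphi pphi] := dphi.
have [_ [cpart _]] := pphi ord0.
have tpart := test_partial ord0 tphi.
pose B : 'I_n.+1 -> interval R := fun=> `[- M, M].
have OB : Omega `<=` box B.
  move=> x /OM0 h i; have := h i; rewrite !in_itv /= => /andP[h1 h2].
  by rewrite /M; lra.
have extend u : test_function Omega u -> (dotL2 mu Omega u u)%:E =
    (\int[mu]_(x in box B) (u x ^+ 2)%:E)%E.
  move=> tu; have [/smooth_diffk[cu _] _ _] := tu.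
  rewrite -sqr_nrm -integral_sqr//; last exact: sqint_continuous.
  rewrite integral_mkcond [RHS]integral_mkcond; apply: eq_integral => x _.
  rewrite !patchE; have [/set_mem Ox|/negP nOx] := boolP (x \in Omega).
    by rewrite mem_set//; exact: OB.
  by rewrite (test_out tu) ?expr0n; [case: ifP|move=> Ox; apply: nOx; rewrite inE].
rewrite -lee_fin EFinM !extend//.
have mphi := continuous_measurable_rVT cphi.
have mpart := continuous_measurable_rVT cpart.
rewrite !integral_box_cons; last 4 first.
- by apply/measurable_EFinP; exact: measurable_funX.
- by move=> x; rewrite lee_fin sqr_ge0.
- by apply/measurable_EFinP; exact: measurable_funX.
- by move=> x; rewrite lee_fin sqr_ge0.
set I := [set` B ord0]; set Q := box _.
have mQ : measurable Q by exact: measurable_box.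
have mI : measurable (I : set (measurableTypeR R)) by exact: measurable_itv.
pose D v := (\int[lam]_(t in I) (slice (partial ord0 phi) t v ^+ 2)%:E)%E.
have mXX (u : 'rV[R]_n.+1 -> R) : measurable_fun setT u ->
    measurable_fun setT (fun z : measurableTypeR R * 'rV[R]_n => slice u z.1 z.2).
  move=> mu; have := measurableT_comp mu (@measurable_cons_rV R n).
  by congr measurable_fun; apply/funext => -[t v].
have mD : measurable_fun setT D.
  apply: (@measurable_integral_section _ _ _ _ _ lam
    (fun z : 'rV[R]_n * measurableTypeR R => (slice (partial ord0 phi) z.2 z.1 ^+ 2)%:E)) => //.
    apply/measurable_EFinP; apply: measurable_funX.
    exact: (measurableT_comp (mXX _ mpart) (@measurable_swap _ _ _ _)).
  by move=> z; rewrite lee_fin sqr_ge0.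
have D0 v : (0 <= D v)%E by apply: integral_ge0 => t _; rewrite lee_fin sqr_ge0.
have bound t v : I t -> ((slice phi t v ^+ 2)%:E <= (2 * M)%:E * D v)%E.
  move=> tI; have M1 : - M \in `[- M, M] by rewrite in_itv /= lexx; lra.
  have := sqr_slice_increment_le v dphi M1 tI.
  rewrite (_ : slice phi (- M) v = 0) ?subr0; last first.
    apply: (test_out tphi) => /OM0/(_ ord0).
    by rewrite mxE unlift_none /= in_itv /= => /andP[+ _]; rewrite /M; lra.
  by rewrite (_ : M - - M = 2 * M)//; lra.
have -> : (\int[lam]_(t in I) \int[leb R n]_(v in Q) (slice (partial ord0 phi) t v ^+ 2)%:E =
    \int[leb R n]_(v in Q) D v)%E.
  apply: (@restricted_tonelli _ _ _ _ R lam (leb R n)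
    (fun z : measurableTypeR R * 'rV[R]_n => (slice (partial ord0 phi) z.1 z.2 ^+ 2)%:E)) => //.
    by apply/measurable_EFinP; apply: measurable_funX; exact: mXX.
  by move=> z; rewrite lee_fin sqr_ge0.
apply: (@le_trans _ _ (\int[lam]_(t in I) ((2 * M)%:E * \int[leb R n]_(v in Q) D v))%E).
  apply: ge0_le_integral => //.
  - by move=> t _; apply: integral_ge0 => v _; rewrite lee_fin sqr_ge0.
  - apply: measurable_funTS.
    apply: (@measurable_integral_section _ _ _ _ _ (leb R n)
      (fun z : measurableTypeR R * 'rV[R]_n => (slice phi z.1 z.2 ^+ 2)%:E)) => //.
      by apply/measurable_EFinP; apply: measurable_funX; exact: mXX.
    by move=> z; rewrite lee_fin sqr_ge0.
  - move=> t tI; rewrite -ge0_integralZl_EFin//; last 2 first.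
    + exact: measurable_funTS.
    + lra.
    apply: ge0_le_integral => //.
    + by move=> v _; rewrite lee_fin sqr_ge0.
    + apply: measurable_funTS; apply/measurable_EFinP; apply: measurable_funX.
      exact: (measurableT_comp (mXX _ mphi) (pair1_measurable t)).
    + by apply: measurable_funTS; apply: measurable_funeM.
    + by move=> v _; exact: bound.
have muI : lam I = (2 * M)%:E.
  rewrite /I /B lebesgue_measure_itv /= lte_fin ifT; last lra.
  by rewrite -EFinB; congr EFin; lra.
have intc (K : \bar R) : (\int[lam]_(t in I) K = K * (2 * M)%:E)%E.
  by rewrite integral_cst//; congr (_ * _)%E; exact: muI.
rewrite intc.
by rewrite muleC muleA -EFinM expr2.
Qed.

End poincare.

(** * Lebesgue spaces on a domain of finite measure *)

Section Lp_spaces.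
Context (R : realType) (n : nat) (Omega : set 'rV[R]_n).
Hypotheses (mO : measurable Omega) (fO : (leb R n Omega < +oo)%E).
Local Notation mu := (leb R n).
Implicit Types (u v : 'rV[R]_n -> R) (p q : R).

Lemma Lnorm_restrict p u : 0 < p ->
  ('N[mu]_(p%:E)[EFin \o (u \_ Omega)] `^ p = \int[mu]_(x in Omega) (`|u x| `^ p)%:E)%E.
Proof.
move=> p0; rewrite powR_Lnorm ?gt_eqF// [RHS]integral_mkcond.
apply: eq_integral => x _ /=; rewrite !patchE.
by case: ifP => // _; rewrite normr0 powR0 ?gt_eqF.
Qed.

Lemma measurable_powR_norm p u : measurable_fun Omega u ->
  measurable_fun Omega (fun x => (`|u x| `^ p)%:E).
Proof.
move=> mu_; apply/measurable_EFinP; apply: (measurableT_comp (measurable_powR p)).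
exact: measurableT_comp.
Qed.

Lemma LpP p u : 0 < p -> Lp Omega p u <->
  measurable_fun Omega u /\ (\int[mu]_(x in Omega) (`|u x| `^ p)%:E < +oo)%E.
Proof.
move=> p0; split.
  move=> lu; have : u \_ Omega \in Lfun mu p%:E := lu.
  move=> /andP[/set_mem mu_ /set_mem fu].
  split; first exact: ((measurable_restrictT u mO).2 mu_).
  by rewrite -Lnorm_restrict// poweR_lty.
move=> [mu_ fu]; suff : u \_ Omega \in Lfun mu p%:E by [].
apply/andP; split; apply/mem_set => /=.
  exact: ((measurable_restrictT u mO).1 mu_).
rewrite /finite_norm ltNge; apply/negP => h.
move: fu; rewrite -Lnorm_restrict//.
have -> : ('N[mu]_(p%:E)[EFin \o (u \_ Omega)] = +oo)%E.
  by apply/eqP; rewrite eq_le h leey.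
by rewrite poweRyr ?ltxx// gt_eqF.
Qed.

Lemma Lp_measurable p u : 0 < p -> Lp Omega p u -> measurable_fun Omega u.
Proof. by move=> p0 /(LpP _ p0)[]. Qed.

Lemma Lp_norm_powR p u : 0 < p -> Lp Omega p u ->
  ((Lp_norm Omega p u `^ p)%:E = \int[mu]_(x in Omega) (`|u x| `^ p)%:E)%E.
Proof.
move=> p0 lu; have : u \_ Omega \in Lfun mu p%:E := lu.
move=> /andP[_ /set_mem fu].
rewrite -Lnorm_restrict// -poweR_EFin fineK//.
by rewrite ge0_fin_numE// Lnorm_ge0.
Qed.

Lemma Lp_norm_ge0 p u : 0 <= Lp_norm Omega p u.
Proof. by rewrite fine_ge0// Lnorm_ge0. Qed.

Let pow_le p q (t : R) : 0 < q -> q <= p -> 0 <= t -> t `^ q <= 1 + t `^ p.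
Proof.
move=> q0 qp t0; have [t1|/ltW t1] := leP t 1.
  have : t `^ q <= 1 `^ q by apply: ge0_ler_powR => //; rewrite ?nnegrE// ltW.
  by rewrite powR1 => /le_trans; apply; rewrite lerDl powR_ge0.
by apply: (le_trans (ler_powR t1 qp)); rewrite lerDr.
Qed.

Lemma Lp_le p q u : 0 < q -> q <= p -> Lp Omega p u -> Lp Omega q u.
Proof.
move=> q0 qp; have p0 : 0 < p by exact: lt_le_trans qp.
move=> /(LpP _ p0)[mu_ fu]; apply/(LpP _ q0); split=> //.
apply: (@le_lt_trans _ _ (\int[mu]_(x in Omega) (1 + (`|u x| `^ p)%:E))%E).
  apply: ge0_le_integral => //.
  - exact: measurable_powR_norm.
  - by apply: emeasurable_funD; [exact: measurable_cst|exact: measurable_powR_norm].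
  - by move=> x _; rewrite -EFinD lee_fin pow_le.
rewrite ge0_integralD//; last exact: measurable_powR_norm.
by rewrite integral_cst// mul1e lte_add_pinfty.
Qed.

Lemma Lp2_sqint u : Lp Omega 2 u <-> sqint mu Omega u.
Proof.
have e : (\int[mu]_(x in Omega) `|(u x ^+ 2)%:E| = \int[mu]_(x in Omega) (`|u x| `^ 2)%:E)%E.
  by apply: eq_integral => x _; rewrite powR_mulrn// /= normrX.
split=> [/LpP[//|mu_ fu]|[mu_ /integrableP[_]]].
  split=> //; apply/integrableP; split.
    by apply/measurable_EFinP; exact: measurable_funX.
  by rewrite [X in (X < _)%E]e.
by rewrite [X in (X < _)%E]e => fu; apply/LpP.
Qed.

Lemma Lp_norm2 u : sqint mu Omega u -> Lp_norm Omega 2 u = normL2 mu Omega u.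
Proof.
move=> su; have /Lp2_sqint lu := su; have := @Lp_norm_powR 2 u (ltac:(lra)) lu.
rewrite powR_mulrn ?Lp_norm_ge0// => h.
have : Lp_norm Omega 2 u ^+ 2 = normL2 mu Omega u ^+ 2.
  apply: EFin_inj; rewrite -integral_sqr// h; apply: eq_integral => x _.
  by rewrite powR_mulrn// real_normK// num_real.
by move/eqP; rewrite eqrXn2 ?Lp_norm_ge0 ?nrm_ge0// => /eqP.
Qed.

Lemma Lp_sqint p u : 2 <= p -> Lp Omega p u -> sqint mu Omega u.
Proof. by move=> p2 lu; apply/Lp2_sqint; apply: Lp_le lu => //; lra. Qed.

(** For every c above the L^p norm, u^2 <= c^2 (1 + |u / c|^p) pointwise, and the
    integral of |u / c|^p is at most 1. *)
Lemma nrm_le_Lp_norm p u : 2 <= p -> Lp Omega p u ->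
  normL2 mu Omega u <= Num.sqrt (fine (mu Omega) + 1) * Lp_norm Omega p u.
Proof.
move=> p2 lu; have su := Lp_sqint p2 lu; have p0 : 0 < p by lra.
set K := Num.sqrt _.
have m0 : 0 <= fine (mu Omega) by rewrite fine_ge0.
have K2 : K ^+ 2 = fine (mu Omega) + 1 by rewrite sqr_sqrtr// addr_ge0.
have K0 : 0 < K by rewrite sqrtr_gt0 ltr_wpDl.
(* Dividing by some c > |u|_p instead of |u|_p itself avoids the case |u|_p = 0. *)
suff main c : Lp_norm Omega p u < c -> normL2 mu Omega u <= K * c.
  apply/ler_addgt0Pr => e e0.
  have := main (Lp_norm Omega p u + e / K); rewrite ltrDl divr_gt0// => /(_ isT).
  by rewrite mulrDr mulrCA divff ?mulr1// gt_eqF.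
move=> Nc; have c0 : 0 < c by apply: le_lt_trans Nc; exact: Lp_norm_ge0.
rewrite -(@ler_pXn2r _ 2)// ?nnegrE ?nrm_ge0 ?mulr_ge0 ?(ltW c0) ?(ltW K0)//.
rewrite exprMn K2 -lee_fin -integral_sqr//.
have [mu_ _] := su.
have Np : (\int[mu]_(x in Omega) (`|u x| `^ p)%:E <= (c `^ p)%:E)%E.
  rewrite -Lp_norm_powR// lee_fin ge0_ler_powR ?nnegrE ?Lp_norm_ge0 ?(ltW c0)//.
    exact: ltW.
  exact: ltW.
apply: (@le_trans _ _ (\int[mu]_(x in Omega) ((c ^+ 2)%:E +
   (c ^+ 2 * c^-1 `^ p)%:E * (`|u x| `^ p)%:E))%E).
  apply: ge0_le_integral => //; first by move=> x _; rewrite lee_fin sqr_ge0.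
  - by apply/measurable_EFinP; exact: measurable_funX.
  - apply: emeasurable_funD; first exact: measurable_cst.
    by apply: measurable_funeM; exact: measurable_powR_norm.
  - move=> x _; rewrite -EFinM -EFinD lee_fin.
    have := @pow_le p 2 (`|u x| / c) (ltac:(lra)) p2 (ltac:(by rewrite divr_ge0// ltW)).
    have ic : 0 <= c^-1 by rewrite invr_ge0 ltW.
    rewrite powR_mulrn ?divr_ge0// ?(ltW c0)// powRM//.
    move=> h; have := ler_wpM2l (ltW (exprn_gt0 2 c0)) h.
    rewrite (_ : c ^+ 2 * (`|u x| / c) ^+ 2 = u x ^+ 2); last first.
      by rewrite exprMn -[u x ^+ 2]real_normK ?num_real//; field; rewrite gt_eqF.
    by have -> : c ^+ 2 * (1 + `|u x| `^ p * c^-1 `^ p) =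
        c ^+ 2 + c ^+ 2 * c^-1 `^ p * `|u x| `^ p by ring.
rewrite ge0_integralD//; last 3 first.
- by move=> x _; rewrite lee_fin sqr_ge0.
- move=> x _; rewrite -EFinM lee_fin; apply: mulr_ge0; last exact: powR_ge0.
  by apply: mulr_ge0; [exact: sqr_ge0|exact: powR_ge0].
- by apply: measurable_funeM; exact: measurable_powR_norm.
rewrite integral_cst// ge0_integralZl_EFin//; last 2 first.
- exact: measurable_powR_norm.
- by rewrite mulr_ge0 ?powR_ge0 ?sqr_ge0.
have e : mu Omega = (fine (mu Omega))%:E by rewrite fineK// ge0_fin_numE.
rewrite [X in (_ * X + _)%E]e.
apply: (@le_trans _ _ ((c ^+ 2)%:E * (fine (mu Omega))%:E +
   (c ^+ 2 * c^-1 `^ p)%:E * (c `^ p)%:E)%E).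
  by apply: leeD2l; apply: lee_wpmul2l => //; rewrite lee_fin mulr_ge0 ?powR_ge0 ?sqr_ge0.
have cp : c^-1 `^ p * c `^ p = 1.
  by rewrite -powRM ?invr_ge0 ?(ltW c0)// mulVf ?gt_eqF// powR1.
rewrite -!EFinM -EFinD lee_fin -(mulrA (c ^+ 2) (c^-1 `^ p)) cp; lra.
Qed.

End Lp_spaces.

(** * Weak derivatives and linearity of the operator *)

Section Lp_linear.
Context (R : realType) (n : nat) (Omega : set 'rV[R]_n).
Hypotheses (mO : measurable Omega) (fO : (leb R n Omega < +oo)%E).
Local Notation mu := (leb R n).
Variable p : R.
Hypothesis p1 : 1 <= p.
Implicit Types (u v : 'rV[R]_n -> R).

Let p0 : 0 < p. Proof. exact: lt_le_trans p1. Qed.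
Let p1e : (1 <= p%:E)%E. Proof. by rewrite lee_fin. Qed.

Let restrict_lin a u v :
  (a \*o u \+ v) \_ Omega = a *: (u \_ Omega) + v \_ Omega.
Proof.
apply/funext => x; rewrite !fctE !patchE; case: ifP => //= _.
by rewrite scaler0 addr0.
Qed.

Lemma Lp_lin a u v : Lp Omega p u -> Lp Omega p v -> Lp Omega p (a \*o u \+ v).
Proof.
move=> lu lv.
have [_ h] := Lfun_submod_closed mu p1e.
have := h a (u \_ Omega) (v \_ Omega) lu lv.
by rewrite -restrict_lin.
Qed.

Lemma Lp_norm_lin a u v : Lp Omega p u -> Lp Omega p v ->
  Lp_norm Omega p (a \*o u \+ v) <= `|a| * Lp_norm Omega p u + Lp_norm Omega p v.
Proof.
move=> lu lv; rewrite /Lp_norm restrict_lin.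
have lu' : u \_ Omega \in Lfun mu p%:E := lu.
have lv' : v \_ Omega \in Lfun mu p%:E := lv.
have := ler_LnormD (a *: Lfun_Sub p1e lu') (Lfun_Sub p1e lv').
move=> /le_trans; apply; rewrite lerD2r.
rewrite [X in fine X](LnormZ (Lfun_Sub p1e lu') a) fineM//.
by rewrite -(finite_norm_fine (Lfun_Sub p1e lu')).
Qed.

Lemma Lp_norm_ae u v : Lp Omega p u -> Lp Omega p v -> ae_eq mu Omega u v ->
  Lp_norm Omega p u = Lp_norm Omega p v.
Proof.
move=> lu lv uv.
have e : Lp_norm Omega p u `^ p = Lp_norm Omega p v `^ p.
  apply: EFin_inj; rewrite !Lp_norm_powR//; apply: ae_eq_integral => //.
  - by apply: measurable_powR_norm; exact: Lp_measurable lu.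
  - by apply: measurable_powR_norm; exact: Lp_measurable lv.
  - by apply: filterS uv => x h Dx; rewrite h.
have := congr1 (fun x => x `^ p^-1) e.
by rewrite -!powRrM divff ?gt_eqF// !powRr1 ?Lp_norm_ge0.
Qed.

Lemma Lp_continuous u : bounded_set Omega -> continuous u -> Lp Omega p u.
Proof.
move=> bO cu.
have mu_ : measurable_fun Omega u by exact: measurable_funTS (continuous_measurable_rVT cu).
have [M M0 UM] := bounded_sub_box bO.
have cpt : compact (u @` cbox (fun=> - M) (fun=> M)).
  apply: continuous_compact; last exact: compact_cbox.
  exact: continuous_subspaceT.
have [K [_ hK]] := compact_bounded cpt.
apply/LpP => //; split=> //.
apply: (@le_lt_trans _ _ (\int[mu]_(x in Omega) (cst ((`|K| + 1) `^ p)%:E) x)%E).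
  apply: ge0_le_integral => //.
  - exact: measurable_powR_norm.
  - move=> x Ox; rewrite lee_fin ge0_ler_powR ?nnegrE ?addr_ge0 ?(ltW p0)//.
    apply: (hK (`|K| + 1)); last by exists x => //; exact: UM.
    by rewrite (le_lt_trans (ler_norm K))// ltrDl.
by rewrite integral_cst// lte_mul_pinfty// lee_fin powR_ge0.
Qed.

End Lp_linear.

Section weak_derivatives.
Context (R : realType) (n : nat) (Omega : set 'rV[R]_n) (p : R).
Hypotheses (oO : open Omega) (bO : bounded_set Omega) (p2 : 2 <= p).
Local Notation mu := (leb R n).
Implicit Types (u v w : 'rV[R]_n -> R) (s : seq 'I_n).

Let mO : measurable Omega := measurable_open_rV oO.
Let fO : (mu Omega < +oo)%E := leb_bounded mO bO.
#[local] Hint Resolve mO fO : core.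

Let p1 : 1 <= p. Proof. by rewrite (le_trans _ p2)//; lra. Qed.

Lemma sqint_test phi s : test_function Omega phi -> sqint mu Omega (partials s phi).
Proof. by move=> [sphi _ _]; apply: sqint_continuous => //; case: (sphi s). Qed.

Lemma Lp_test phi s : test_function Omega phi -> Lp Omega p (partials s phi).
Proof. by move=> [sphi _ _]; apply: Lp_continuous => //; case: (sphi s). Qed.

Lemma weak_partial_lin a s u v u' v' :
  Lp Omega p u -> Lp Omega p v -> Lp Omega p u' -> Lp Omega p v' ->
  weak_partial Omega s u v -> weak_partial Omega s u' v' ->
  weak_partial Omega s (a \*o u \+ u') (a \*o v \+ v').
Proof.
move=> lu lv lu' lv' h h' phi tphi.
have [su sv] := (Lp_sqint mO fO p2 lu, Lp_sqint mO fO p2 lv).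
have [su' sv'] := (Lp_sqint mO fO p2 lu', Lp_sqint mO fO p2 lv').
have st := sqint_test s tphi; have st0 := sqint_test [::] tphi.
have e w w' t : sqint mu Omega w -> sqint mu Omega w' -> sqint mu Omega t ->
    L2_inner Omega (a \*o w \+ w') t = a * L2_inner Omega w t + L2_inner Omega w' t.
  by move=> sw sw' st'; rewrite -[LHS]/(dotL2 _ _ _ _) ipDl ?ipZl//; exact: sqintZ.
by rewrite !e// h// h'// mulrDr mulrCA.
Qed.

Lemma weak_partial_unique s u v w :
  Lp Omega p v -> Lp Omega p w ->
  weak_partial Omega s u v -> weak_partial Omega s u w -> ae_eq mu Omega v w.
Proof.
move=> lv lw hv hw.
have [sv sw] := (Lp_sqint mO fO p2 lv, Lp_sqint mO fO p2 lw).
have svw := sqintB mO sv sw.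
have : ae_eq mu Omega (v \- w) (cst 0).
  apply: ae0_of_test => //.
    have := sqint_mul mO svw (sqint_cst mO 1 fO).
    by apply: eq_integrable => // x _ /=; rewrite mulr1.
  move=> phi tphi; have st0 := sqint_test [::] tphi.
  rewrite -[LHS]/(dotL2 _ _ _ _) ipBl//; apply/eqP; rewrite subr_eq0; apply/eqP.
  have := hv _ tphi; rewrite (hw _ tphi) => /(congr1 (fun z => (-1) ^+ size s * z)).
  rewrite !mulrA -exprMn mulrNN mulr1 expr1n !mul1r => e; exact: (esym e).
by apply: filterS => x h Ox; have /eqP := h Ox; rewrite subr_eq0 => /eqP.
Qed.

Lemma wpartialP m s u : sobolev Omega m p u -> (size s <= m)%N ->
  Lp Omega p (wpartial Omega p s u) /\ weak_partial Omega s u (wpartial Omega p s u).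
Proof.
move=> [_ h] /h[v lv wv].
exact: (@getPex _ [set v | Lp Omega p v /\ weak_partial Omega s u v] (ex_intro _ v (conj lv wv))).
Qed.

Lemma wpartial_ae s u v : Lp Omega p v -> weak_partial Omega s u v ->
  ae_eq mu Omega (wpartial Omega p s u) v.
Proof.
move=> lv wv.
have [lw ww] := @getPex _ [set v | Lp Omega p v /\ weak_partial Omega s u v]
  (ex_intro _ v (conj lv wv)).
exact: weak_partial_unique lw lv ww wv.
Qed.

Lemma weak_partial_nil u : weak_partial Omega [::] u u.
Proof. by move=> phi _; rewrite expr0 mul1r. Qed.

Lemma sobolev_lin m a u u' : sobolev Omega m p u -> sobolev Omega m p u' ->
  sobolev Omega m p (a \*o u \+ u').
Proof.
move=> [lu h] [lu' h']; split; first exact: Lp_lin.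
move=> s sm; have [v lv wv] := h s sm; have [v' lv' wv'] := h' s sm.
by exists (a \*o v \+ v'); [exact: Lp_lin|exact: weak_partial_lin].
Qed.

(** The representatives chosen by [wpartial] need not depend linearly on the
    function; their equivalence classes do, by uniqueness. *)
Lemma wpartial_lin m s a u u' : sobolev Omega m p u -> sobolev Omega m p u' ->
  (size s <= m)%N -> ae_eq mu Omega (wpartial Omega p s (a \*o u \+ u'))
    (a \*o wpartial Omega p s u \+ wpartial Omega p s u').
Proof.
move=> su su' sm; have [lu wu] := wpartialP su sm; have [lu' wu'] := wpartialP su' sm.
apply: wpartial_ae; first exact: Lp_lin.
by apply: weak_partial_lin => //; [case: su|case: su'].
Qed.

Lemma test_lin a phi psi : test_function Omega phi -> test_function Omega psi ->
  test_function Omega (a \*o phi \+ psi) /\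
  forall s, partials s (a \*o phi \+ psi) = a \*o partials s phi \+ partials s psi.
Proof.
move=> [sphi cphi Ophi] [spsi cpsi Opsi].
have E s : partials s (a \*o phi \+ psi) = a \*o partials s phi \+ partials s psi.
  elim: s => [//|i s ih]; rewrite /partials /= -/(partials s _) ih.
  apply/funext => x; rewrite /partial.
  have [_ d1] := sphi s; have [_ d2] := spsi s.
  rewrite -[_ \+ _]/((a \*: partials s phi) + partials s psi).
  rewrite deriveD ?deriveZ//; exact: derivableZ.
have sub : closure [set x | (a \*o phi \+ psi) x != 0] `<=`
    closure [set x | phi x != 0] `|` closure [set x | psi x != 0].
  rewrite -closureU; apply: closureS => x /=.
  have [->|] := eqVneq (phi x) 0; last by left.
  by rewrite mulr0 add0r; right.
split=> //; split.
- move=> s; rewrite E; have [c1 d1] := sphi s; have [c2 d2] := spsi s; split.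
    by move=> x; exact: (cvgD (cvgM (cvg_cst a) (c1 x)) (c2 x)).
  move=> i x; rewrite -[_ \+ _]/((a \*: partials s phi) + partials s psi).
  by apply: derivableD => //; exact: derivableZ.
- exact: subclosed_compact (@closed_closure _ _) (compactU cphi cpsi) sub.
- by move=> x /sub[/Ophi|/Opsi].
Qed.

Lemma sobolev0_lin a u u' : sobolev0 Omega p u -> sobolev0 Omega p u' ->
  sobolev0 Omega p (a \*o u \+ u').
Proof.
move=> [su [phi tphi cphi]] [su' [psi tpsi cpsi]]; split; first exact: sobolev_lin.
exists (fun k => a \*o phi k \+ psi k) => [k|s s1]; first by have [] := test_lin a (tphi k) (tpsi k).
have [lu _] := wpartialP su s1; have [lu' _] := wpartialP su' s1.
have [lw _] := wpartialP (sobolev_lin a su su') s1.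
have lB v w : Lp Omega p v -> Lp Omega p w -> Lp Omega p (w \- v).
  move=> lv lw0; have := Lp_lin p1 (-1) lv lw0; congr (Lp _ _ _).
  by apply/funext => x /=; rewrite mulN1r addrC.
apply: (squeeze_cvgr (f := cst 0) (h := fun k =>
  `|a| * Lp_norm Omega p (wpartial Omega p s u \- partials s (phi k)) +
  Lp_norm Omega p (wpartial Omega p s u' \- partials s (psi k)))).
- apply: nearW => k; rewrite Lp_norm_ge0 /=.
  have lphi := Lp_test s (tphi k); have lpsi := Lp_test s (tpsi k).
  apply: le_trans (Lp_norm_lin p1 a (lB _ _ lphi lu) (lB _ _ lpsi lu')).
  have [t tE] := test_lin a (tphi k) (tpsi k).
  rewrite le_eqVlt; apply/orP; left; apply/eqP; apply: Lp_norm_ae => //.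
  + by apply: lB => //; exact: Lp_test.
  + by apply: Lp_lin => //; apply: lB.
  + rewrite tE; apply: filterS (wpartial_lin a su su' s1) => x h Ox /=.
    by rewrite h//=; ring.
- exact: cvg_cst.
- rewrite [X in _ --> X](_ : _ = `|a| * 0 + 0); last by rewrite mulr0 addr0.
  by apply: cvgD; [apply: cvgM; [exact: cvg_cst|exact: cphi]|exact: cpsi].
Qed.

Lemma domA_lin a u u' : domA Omega p u -> domA Omega p u' ->
  domA Omega p (a \*o u \+ u').
Proof.
by move=> [s0 s1] [s0' s1']; split; [exact: sobolev_lin|exact: sobolev0_lin].
Qed.

Lemma Lp0 : Lp Omega p (cst 0).
Proof. by apply: Lp_continuous => // x; exact: cst_continuous. Qed.

Lemma opA_Lp u : domA Omega p u -> Lp Omega p (opA Omega p u).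
Proof.
move=> [su _].
have lsum (s : seq 'I_n) : Lp Omega p (fun x => \sum_(i <- s) wpartial Omega p [:: i; i] u x).
  elim: s => [|i s ih].
    under eq_fun do rewrite big_nil.
    exact: Lp0.
  have [li _] := @wpartialP 2 [:: i; i] u su isT.
  have := Lp_lin p1 1 li ih; congr (Lp _ _ _).
  by apply/funext => x /=; rewrite big_cons mul1r.
have := Lp_lin p1 (-1) (lsum (index_enum 'I_n)) Lp0.
by congr (Lp _ _ _); apply/funext => x; rewrite /opA /= addr0 mulN1r.
Qed.

Lemma opA_lin a u u' : domA Omega p u -> domA Omega p u' ->
  ae_eq mu Omega (opA Omega p (a \*o u \+ u')) (a \*o opA Omega p u \+ opA Omega p u').
Proof.
move=> [su _] [su' _].
have h : {ae mu, forall x, forall i : 'I_n, Omega x ->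
    wpartial Omega p [:: i; i] (a \*o u \+ u') x =
    (a \*o wpartial Omega p [:: i; i] u \+ wpartial Omega p [:: i; i] u') x}.
  by apply: filter_forall => i; exact: (@wpartial_lin 2).
apply: filterS h => x h Ox /=; rewrite /opA.
rewrite (eq_bigr (fun i => a * wpartial Omega p [:: i; i] u x + wpartial Omega p [:: i; i] u' x)).
  by rewrite big_split /= -mulr_sumr; ring.
by move=> i _; exact: h.
Qed.

Lemma kerA_lin m a u u' : kerA Omega p m u -> kerA Omega p m u' ->
  kerA Omega p m (a \*o u \+ u').
Proof.
move=> [du eu] [du' eu']; split; first exact: domA_lin.
move: (opA_lin a du du') eu eu'; apply: filterS3 => x e e1 e2 Ox.
by rewrite e//= e1// e2//; ring.
Qed.

End weak_derivatives.

(** * The weight in Balakrishnan's formula *)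

Section balakrishnan_weight.
Context (R : realType).
Local Notation lam := (@lebesgue_measure R).
Variables (alpha c : R).
Hypotheses (a0 : 0 < alpha) (a1 : alpha < 1) (c0 : 0 < c).

Lemma integral_powR (s a b : R) : s != 0 -> 0 < a -> a < b ->
  (\int[lam]_(t in `[a, b]) (t `^ (s - 1))%:E = ((b `^ s - a `^ s) / s)%:E)%E.
Proof.
move=> s0 a_gt0 ab.
have dF (t : R) : 0 < t -> is_derive t (1 : R) (fun t => t `^ s / s) (t `^ (s - 1)).
  move=> t0; have h := is_deriveM (is_derive1_powR s t0) (is_derive_cst (s^-1) t (1 : R)).
  by apply: is_derive_eq h _; rewrite /GRing.scale /= /cst; field.
have cF (t : R) : 0 < t -> {for t, continuous (fun t => t `^ s / s)}.
  by move=> t0; apply: differentiable_continuous; apply/derivable1_diffP; case: (dF t t0).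
have cf (t : R) : 0 < t -> {for t, continuous (fun t => t `^ (s - 1))}.
  move=> t0; apply: differentiable_continuous; apply/derivable1_diffP.
  by case: (is_derive1_powR (s - 1) t0).
rewrite (@continuous_FTC2 _ _ (fun t => t `^ s / s))//.
- by rewrite -EFinB mulrBl.
- apply: continuous_in_subspaceT => t /set_mem /=; rewrite in_itv /= => /andP[h _].
  by apply: cf; exact: lt_le_trans h.
- split.
  + move=> t; rewrite in_itv /= => /andP[h _].
    by case: (dF t (lt_trans a_gt0 h)).
  + by apply: cvg_at_right_filter; exact: cF.
  + by apply: cvg_at_left_filter; apply: cF; exact: lt_trans ab.
- move=> t; rewrite in_itv /= => /andP[h _]; rewrite derive1E.
  by case: (dF t (lt_trans a_gt0 h)).
Qed.

Definition weight (t : R) : R := t `^ (- alpha) / (t + c).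

Lemma measurable_weight : measurable_fun (`]0, +oo[ : set R) weight.
Proof.
apply: open_continuous_measurable_fun; first exact: interval_open.
move=> t /set_mem /=; rewrite in_itv /= andbT => t0.
have h1 : {for t, continuous (fun t : R => t `^ (- alpha))}.
  apply: differentiable_continuous; apply/derivable1_diffP.
  by case: (is_derive1_powR (- alpha) t0).
have h2 : {for t, continuous (fun t : R => t + c)}.
  by apply: cvgD; [exact: cvg_id|exact: cvg_cst].
have tc : t + c != 0 by rewrite gt_eqF// addr_gt0.
exact: (cvgM h1 (cvgV tc h2)).
Qed.

Lemma weight_ge0 t : 0 < t -> 0 <= weight t.
Proof. by move=> t0; rewrite divr_ge0 ?powR_ge0// addr_ge0// ltW. Qed.

(** Near 0 the weight is at most t^-alpha / c, at infinity at most t^(-alpha-1);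
    both powers are integrable because 0 < alpha < 1. *)
Lemma integral_weight_lty : (\int[lam]_(t in `]0%R, +oo[) (weight t)%:E < +oo)%E.
Proof.
pose F k : set R := [set` `[(k.+2%:R)^-1, k.+2%:R]%R].
have F1 k : (k.+2%:R)^-1 < 1 :> R by rewrite invf_lt1// ltr1n.
have F2 k : 1 < k.+2%:R :> R by rewrite ltr1n.
have k0 k : 0 < k.+2%:R :> R by rewrite ltr0n.
have UF : \bigcup_k F k = [set` `](0 : R), +oo[%R].
  apply/seteqP; split => [t [k _]|t] ; rewrite /F /= !in_itv /= ?andbT.
    by move=> /andP[h _]; apply: (lt_le_trans _ h); rewrite invr_gt0.
  move=> t0; have [k kt] : exists k, Num.max t t^-1 < k.+2%:R.
    exists (Num.trunc (Num.max t t^-1)); apply: lt_le_trans (truncnS_gt _) _.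
    by rewrite ler_nat.
  exists k => //; rewrite /F /= in_itv /=; move: kt; rewrite gt_max => /andP[/ltW -> /ltW h].
  by rewrite andbT -[t]invrK lef_pV2// posrE// invr_gt0.
have mw k : measurable_fun (F k) (EFin \o weight).
  apply/measurable_EFinP; apply: measurable_funS measurable_weight; first exact: measurable_itv.
  by rewrite -UF; exact: bigcup_sup.
have pos k t : F k t -> 0 < t.
  by rewrite /F /= in_itv /= => /andP[h _]; apply: (lt_le_trans _ h); rewrite invr_gt0.
have mpow s (A : set R) : measurable_fun A (fun t : R => (t `^ s)%:E).
  by apply: measurable_funTS; apply/measurable_EFinP; exact: measurable_powR.
have mcpow s (A : set R) : measurable_fun A (fun t : R => (c^-1%:E * (t `^ s)%:E)%E).
  suff : measurable_fun A (fun t : R => (c^-1 * t `^ s)%:E) by [].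
  apply: measurable_funTS; apply/measurable_EFinP.
  by apply: measurable_funM; [exact: measurable_cst|exact: measurable_powR].
have bound k : (\int[lam]_(t in F k) (weight t)%:E <= (c^-1 / (1 - alpha) + alpha^-1)%:E)%E.
  pose a : R := (k.+2%:R)^-1; pose b : R := k.+2%:R.
  have a_gt0 : 0 < a by rewrite invr_gt0.
  have FU : F k = `[a, 1[ `|` `[1, b].
    apply/seteqP; split=> t; rewrite /F /= !in_itv /= -/a -/b.
      by move=> /andP[h1 h2]; have [t1|t1] := ltP t 1; [left; rewrite h1|right].
    case=> /andP[h1 h2]; first by rewrite h1 ltW// (lt_trans h2)// /b ltr1n.
    by rewrite h2 (le_trans _ h1)// /a ltW.
  have split_le : (\int[lam]_(t in F k) (weight t)%:E <=
     \int[lam]_(t in `[a, 1%R]) (c^-1%:E * (t `^ ((1 - alpha) - 1))%:E) +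
     \int[lam]_(t in `[1%R, b]) (t `^ ((- alpha) - 1))%:E)%E.
    have mwl : measurable_fun (`[a, 1%R[ : set R) (EFin \o weight).
      by apply: (measurable_funS _ _ (mw k)); [exact: measurable_itv|rewrite FU => t; left].
    have mwr : measurable_fun (`[1%R, b] : set R) (EFin \o weight).
      by apply: (measurable_funS _ _ (mw k)); [exact: measurable_itv|rewrite FU => t; right].
    rewrite FU ge0_integral_setU//; last 3 first.
    - by rewrite -FU; exact: mw.
    - by move=> t; rewrite -FU => /pos t0; rewrite lee_fin weight_ge0.
    - apply/disj_setPS => t [] /=; rewrite !in_itv /= => /andP[_ h1] /andP[h2 _].
      by move: h1; rewrite ltNge h2.
    rewrite -[X in (_ <= X + _)%E]integral_itv_bndo_bndc; last exact: mcpow.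
    apply: leeD; apply: ge0_le_integral => //.
    - move=> t /= h; rewrite lee_fin weight_ge0// (pos k)// FU; by left.
    - exact: (mcpow (1 - alpha - 1) _).
    - move=> t /= h; have t0 : 0 < t by apply: (pos k); rewrite FU; left.
      rewrite -EFinM lee_fin /weight mulrC addrAC subrr add0r.
      by rewrite ler_wpM2r ?powR_ge0// lef_pV2 ?posrE ?addr_gt0// lerDr ltW.
    - move=> t /= h; rewrite lee_fin weight_ge0// (pos k)// FU; by right.
    - exact: (mpow (- alpha - 1) _).
    - move=> t /= h; have t0 : 0 < t by apply: (pos k); rewrite FU; right.
      rewrite lee_fin /weight powRD; last by apply/implyP => _; rewrite gt_eqF.
      rewrite powR_inv1 ?(ltW t0)// ler_wpM2l ?powR_ge0//.
      by rewrite lef_pV2 ?posrE ?addr_gt0// lerDl ltW.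
  apply: (le_trans split_le).
  have ci0 : 0 <= c^-1 by rewrite invr_ge0 ltW.
  rewrite ge0_integralZl_EFin//; last 2 first.
  - by move=> t _; rewrite lee_fin powR_ge0.
  - exact: (mpow (1 - alpha - 1) _).
  have n1 : 1 - alpha != 0 by rewrite subr_eq0 gt_eqF.
  have n2 : - alpha != 0 by rewrite oppr_eq0 gt_eqF.
  rewrite (integral_powR n1 a_gt0 (F1 k)) (integral_powR n2 ltr01 (F2 k)).
  rewrite !powR1 -EFinM -EFinD lee_fin lerD//.
    rewrite mulrA ler_wpM2r ?invr_ge0 ?subr_ge0 ?(ltW a1)//.
    by rewrite ler_piMr ?invr_ge0 ?(ltW c0)// gerBl powR_ge0.
  by rewrite invrN mulrN -mulNr opprB ler_piMl ?invr_ge0 ?(ltW a0)// gerBl powR_ge0.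
have mF k : measurable (F k) by exact: measurable_itv.
have ndF : nondecreasing_seq F.
  move=> i j ij; rewrite subsetEset => t; rewrite /F /= !in_itv /= => /andP[h1 h2].
  have ij' : i.+2%:R <= j.+2%:R :> R by rewrite ler_nat.
  by rewrite (le_trans h2)// andbT (le_trans _ h1)// lef_pV2// posrE.
have cv := @ge0_nondecreasing_set_cvg_integral _ (measurableTypeR R) R F (EFin \o weight) lam ndF mF mw
  (fun k t Ft => ltac:(by rewrite lee_fin; apply: weight_ge0; exact: pos Ft)).
rewrite UF in cv.
apply: (@le_lt_trans _ _ (c^-1 / (1 - alpha) + alpha^-1)%:E); last exact: ltry.
rewrite -(cvg_lim _ cv)//; apply: lime_le; first by apply/cvg_ex; eexists; exact: cv.
by apply: nearW => k; exact: bound.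
Qed.
End balakrishnan_weight.

(** * Energy of the operator *)

Section energy.
Context (R : realType) (n : nat) (Omega : set 'rV[R]_n) (p : R).
Hypotheses (oO : open Omega) (bO : bounded_set Omega) (p2 : 2 <= p).
Local Notation mu := (leb R n).
Local Notation ip := (dotL2 mu Omega).
Local Notation nrm := (normL2 mu Omega).
Implicit Types (u v w : 'rV[R]_n -> R) (s : seq 'I_n).

Let mO : measurable Omega := measurable_open_rV oO.
Let fO : (mu Omega < +oo)%E := leb_bounded mO bO.
#[local] Hint Resolve mO fO : core.

Lemma nrm_ae u v : sqint mu Omega u -> sqint mu Omega v -> ae_eq mu Omega u v ->
  nrm u = nrm v.
Proof.
move=> [mu_ _] [mv _] uv; congr Num.sqrt.
by rewrite (ip_ae mO mu_ mv mu_ uv) ipC (ip_ae mO mu_ mv mv uv).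
Qed.

Lemma nrm_distC u v : nrm (u \- v) = nrm (v \- u).
Proof.
by congr Num.sqrt; apply: eq_Rintegral => x _ /=; ring.
Qed.

Lemma domA_sqint u : domA Omega p u -> sqint mu Omega u.
Proof. by move=> [[lu _] _]; exact: Lp_sqint lu. Qed.

(** Green's formula. The weak derivatives of u are tested against test functions
    phi_k that converge to u in W^{1,p}, hence in L^2 together with their first
    derivatives. The sequence is part of the conclusion because [energy_le] passes
    to the limit along it. *)
Lemma green u : domA Omega p u -> exists phi : nat -> 'rV[R]_n -> R,
  [/\ forall k, test_function Omega (phi k),
      nrm (phi k \- u) @[k --> \oo] --> (0 : R),
      (forall i, nrm (partial i (phi k) \- wpartial Omega p [:: i] u) @[k --> \oo] --> (0 : R)) &
      ip (opA Omega p u) u =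
        \sum_(i < n) ip (wpartial Omega p [:: i] u) (wpartial Omega p [:: i] u)].
Proof.
move=> du; have [[lu _] [s1 [phi tphi cphi]]] := du; have [s2 _] := du.
have su := domA_sqint du.
have Ls s : (size s <= 1)%N -> Lp Omega p (wpartial Omega p s u).
  by move=> h; case: (wpartialP s1 h).
have Ss s : (size s <= 1)%N -> sqint mu Omega (wpartial Omega p s u).
  by move=> h; apply: Lp_sqint (Ls s h).
have cn s : (size s <= 1)%N ->
    nrm (partials s (phi k) \- wpartial Omega p s u) @[k --> \oo] --> (0 : R).
  move=> h; apply: (squeeze_cvgr (f := cst 0) (h := fun k =>
    Num.sqrt (fine (mu Omega) + 1) *
    Lp_norm Omega p (wpartial Omega p s u \- partials s (phi k)))).
  - apply: nearW => k; rewrite nrm_ge0 nrm_distC /=.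
    apply: nrm_le_Lp_norm => //.
    have := Lp_lin (le_trans (ler1n R 2) p2) (-1) (Lp_test oO bO p2 s (tphi k)) (Ls s h).
    by congr (Lp _ _ _); apply/funext => x /=; rewrite mulN1r addrC.
  - exact: cvg_cst.
  - rewrite -[X in _ --> X](mulr0 (Num.sqrt (fine (mu Omega) + 1))).
    by apply: cvgM; [exact: cvg_cst|exact: cphi].
have c0 : nrm (phi k \- u) @[k --> \oo] --> (0 : R).
  have ae0 : ae_eq mu Omega (wpartial Omega p [::] u) u.
    by apply: wpartial_ae => //; exact: weak_partial_nil.
  rewrite (_ : (fun k => nrm (phi k \- u)) =
    (fun k => nrm (partials [::] (phi k) \- wpartial Omega p [::] u))); first exact: cn.
  apply/funext => k; have st := sqint_test oO bO [::] (tphi k).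
  have sw := Ss [::] isT.
  apply: nrm_ae; [exact: sqintB|exact: sqintB|].
  by apply: filterS ae0 => x h Ox /=; rewrite h.
exists phi; split=> //; first by move=> i; exact: cn [:: i] isT.
have sA : sqint mu Omega (opA Omega p u) by apply: Lp_sqint (opA_Lp oO bO p2 du).
have st s k : sqint mu Omega (partials s (phi k)) by exact: sqint_test.
have parts k : ip (opA Omega p u) (phi k) =
    \sum_(i < n) ip (wpartial Omega p [:: i] u) (partial i (phi k)).
  have Lii i := @wpartialP _ _ _ _ 2 [:: i; i] u s2 isT.
  have sii i : sqint mu Omega (wpartial Omega p [:: i; i] u).
    by apply: Lp_sqint (Lii i).1.
  have -> : ip (opA Omega p u) (phi k) =
      - ip (fun x => \sum_(i < n) wpartial Omega p [:: i; i] u x) (phi k).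
    have := ipZl mO (-1) (sqint_sum mO (index_enum 'I_n) sii) (st [::] k).
    rewrite mulN1r => <-; congr dotL2; apply/funext => x.
    by rewrite /opA /= mulN1r.
  rewrite ip_suml//; last exact: (st [::] k).
  rewrite -sumrN; apply: eq_bigr => i _.
  have e2 : ip (wpartial Omega p [:: i; i] u) (phi k) =
      ip u (partials [:: i; i] (phi k)).
    by have := (Lii i).2 _ (tphi k); rewrite -signr_odd /= expr0 mul1r => h; exact: (esym h).
  have [_ w1] := @wpartialP _ _ _ _ 1 [:: i] u s1 isT.
  have e1 : ip u (partials [:: i; i] (phi k)) =
      - ip (wpartial Omega p [:: i] u) (partial i (phi k)).
    by have h := w1 _ (test_partial i (tphi k)); rewrite /= expr1 mulN1r in h; exact: h.
  rewrite e2 e1.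
  by rewrite opprK.
have lim1 : ip (opA Omega p u) (phi k) @[k --> \oo] --> ip (opA Omega p u) u.
  apply: (ip_cvg mO (u := fun=> opA Omega p u)) => //; first by move=> k; exact: (st [::]).
  rewrite (_ : (fun _ => _) = cst 0); first exact: cvg_cst.
  apply/funext => k; rewrite /nrm /normL2 (_ : _ \- _ = cst 0) ?ip0l ?sqrtr0//.
  by apply/funext => x /=; rewrite subrr.
have lim2 : ip (opA Omega p u) (phi k) @[k --> \oo] -->
    \sum_(i < n) ip (wpartial Omega p [:: i] u) (wpartial Omega p [:: i] u).
  rewrite (_ : (fun k => ip _ _) = (fun k => \sum_(i < n)
    ip (wpartial Omega p [:: i] u) (partial i (phi k)))); last exact/funext.
  apply: cvg_big => [|i _]; first exact: add_continuous.
  apply: (ip_cvg mO (u := fun=> wpartial Omega p [:: i] u)).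
  - by move=> k; exact: (Ss [:: i]).
  - by move=> k; exact: (st [:: i]).
  - exact: (Ss [:: i]).
  - exact: (Ss [:: i]).
  - rewrite (_ : (fun _ => _) = cst 0); first exact: cvg_cst.
    apply/funext => k; rewrite /nrm /normL2 (_ : _ \- _ = cst 0) ?ip0l ?sqrtr0//.
    by apply/funext => x /=; rewrite subrr.
  - exact: cn [:: i] isT.
exact: cvg_unique lim1 lim2.
Qed.

(** Both sides are continuous along the sequence of [green]. *)
Lemma energy_le (T : finType) (Q : T -> set 'rV[R]_n) (C : R) (e : 'I_n -> R) :
  (forall t, measurable (Q t)) ->
  (forall phi, test_function Omega phi ->
     ip phi phi <= C * \sum_t ip phi (\1_(Q t)) ^+ 2
       + \sum_(i < n) e i * ip (partial i phi) (partial i phi)) ->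
  forall u, domA Omega p u ->
    ip u u <= C * \sum_t ip u (\1_(Q t)) ^+ 2
     + \sum_(i < n) e i * ip (wpartial Omega p [:: i] u) (wpartial Omega p [:: i] u).
Proof.
move=> mQ ineq u du; have [phi [tphi c0 c1 _]] := green du.
have su := domA_sqint du.
have st s k : sqint mu Omega (partials s (phi k)) by exact: sqint_test.
have S1 i : sqint mu Omega (wpartial Omega p [:: i] u).
  have [_ [s1 _]] := du.
  by apply: Lp_sqint (@wpartialP _ _ _ _ 1 [:: i] u s1 isT).1.
have sQ t : sqint mu Omega (\1_(Q t) : 'rV[R]_n -> R).
  apply: (sqint_bounded mO (a := 1)) => // x _.
  by rewrite indicE; case: (_ \in _); rewrite ?normr1 ?normr0.
apply: (ler_cvg_to (a := \oo) (f := fun k : nat => ip (phi k) (phi k))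
  (g := fun k : nat => C * \sum_t ip (phi k) (\1_(Q t)) ^+ 2
       + \sum_(i < n) e i * ip (partial i (phi k)) (partial i (phi k)))).
- exact: (ip_cvg mO (fun k => st [::] k) (fun k => st [::] k) su su c0 c0).
- apply: cvgD.
    apply: cvgM; first exact: cvg_cst.
    apply: cvg_big => [|t _]; first exact: add_continuous.
    have ct : ip (phi k) (\1_(Q t)) @[k --> \oo] --> ip u (\1_(Q t)).
      apply: (ip_cvg mO (v := fun=> \1_(Q t))) => //; first by move=> k; exact: (st [::]).
      rewrite (_ : (fun _ => _) = cst 0); first exact: cvg_cst.
      apply/funext => k; rewrite /nrm /normL2 (_ : _ \- _ = cst 0) ?ip0l ?sqrtr0//.
      by apply/funext => x /=; rewrite subrr.
    exact: (cvgM ct ct).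
  apply: cvg_big => [|i _]; first exact: add_continuous.
  apply: cvgM; first exact: cvg_cst.
  exact: (ip_cvg mO (fun k => st [:: i] k) (fun k => st [:: i] k) (S1 i) (S1 i) (c1 i) (c1 i)).
- by apply: nearW => k; exact: ineq.
Qed.

Lemma energy_rellich (e : R) : 0 < e ->
  exists (T : finType) (Q : T -> set 'rV[R]_n) (C : R),
  [/\ forall t, measurable (Q t), 0 <= C &
    forall u, domA Omega p u ->
      ip u u <= C * \sum_t ip u (\1_(Q t)) ^+ 2 + e * ip (opA Omega p u) u].
Proof.
move=> e0; have [T [Q [C [mQ C0 ineq]]]] := rellich_functionals oO bO e0.
exists T, Q, C; split=> // u du; have [_ [_ _ _ ->]] := green du.
rewrite [X in _ + X]mulr_sumr; apply: (energy_le (e := fun=> e) mQ _ du) => phi tphi.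
by rewrite -[X in _ + X]mulr_sumr; exact: ineq.
Qed.

End energy.

Section resolvent.
Context (R : realType) (n : nat) (Omega : set 'rV[R]_n.+1) (p : R).
Hypotheses (oO : open Omega) (bO : bounded_set Omega) (p2 : 2 <= p).
Local Notation mu := (leb R n.+1).
Local Notation ip := (dotL2 mu Omega).
Local Notation nrm := (normL2 mu Omega).
Implicit Types (u v w : 'rV[R]_n.+1 -> R).

Let mO : measurable Omega := measurable_open_rV oO.
Let fO : (mu Omega < +oo)%E := leb_bounded mO bO.
#[local] Hint Resolve mO fO : core.

Lemma energy_coercive : exists2 C : R, 0 < C &
  forall u, domA Omega p u -> ip u u <= C * ip (opA Omega p u) u.
Proof.
have [C C0 ineq] := poincare oO bO.
exists C => // u du; have [_ [_ _ _ ->]] := green oO bO p2 du.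
have := @energy_le _ _ _ _ oO bO p2 void (fun=> set0) 0 (fun=> C) (fun=> measurable0) _ u du.
rewrite mul0r add0r -mulr_sumr; apply => phi tphi.
rewrite mul0r add0r -mulr_sumr (le_trans (ineq _ tphi))// ler_pM2l//.
by rewrite big_ord_recl lerDl sumr_ge0// => i _; exact: ip_ge0.
Qed.

(** Testing t r + A r = w against r gives (t + c) |r|^2 <= |w| |r|, where c is
    the coercivity constant of A. *)
Lemma resolvent_bound : exists2 c : R, 0 < c &
  forall t r w, 0 < t -> domA Omega p r -> sqint mu Omega w ->
    ae_eq mu Omega (fun x => t * r x + opA Omega p r x) w ->
    nrm r <= nrm w / (t + c).
Proof.
have [C C0 coer] := energy_coercive.
exists C^-1; first by rewrite invr_gt0.
move=> t r w t0 dr sw rw.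
have sr := domA_sqint oO bO p2 dr.
have sA : sqint mu Omega (opA Omega p r) by apply: Lp_sqint (opA_Lp oO bO p2 dr).
have E : ip w r = t * ip r r + ip (opA Omega p r) r.
  rewrite -(ipZl mO t sr sr) -ipDl//; last exact: sqintZ.
  apply/esym; apply: ip_ae => //.
  - by case: (sqintD mO (sqintZ mO t sr) sA).
  - by case: sw.
  - by case: sr.
have tc : 0 < t + C^-1 by rewrite addr_gt0// invr_gt0.
rewrite ler_pdivlMr//.
have h : (t + C^-1) * nrm r ^+ 2 <= nrm w * nrm r.
  apply: le_trans (le_trans (ler_norm _) (cauchy_schwarz mO sw sr)).
  rewrite E mulrDl sqr_nrm lerD2l mulrC ler_pdivrMr// mulrC; exact: coer.
have [r0|r0] := eqVneq (nrm r) 0; first by rewrite r0 mul0r nrm_ge0.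
have {}r0 : 0 < nrm r by rewrite lt_neqAle eq_sym r0 nrm_ge0.
by rewrite -(ler_pM2r r0) (le_trans _ h)// expr2 mulrA [(t + _) * _]mulrC.
Qed.

End resolvent.

(** * Fractional powers *)

Section fractional_powers.
Context (R : realType) (n : nat) (Omega : set 'rV[R]_n) (p alpha : R).
Hypotheses (oO : open Omega) (bO : bounded_set Omega) (p2 : 2 <= p).
Local Notation mu := (leb R n).
Local Notation lam := (@lebesgue_measure R).
Local Notation nrm := (normL2 mu Omega).
Implicit Types (u v w phi : 'rV[R]_n -> R).

Let mO : measurable Omega := measurable_open_rV oO.
Let fO : (mu Omega < +oo)%E := leb_bounded mO bO.
#[local] Hint Resolve mO fO : core.

Let p1 : 1 <= p. Proof. by rewrite (le_trans _ p2)//; lra. Qed.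

(** Young's inequality bounds the product by the sum of the two powers. *)
Lemma Lp_conjugate_integrable u phi : Lp Omega p u -> Lp Omega (p / (p - 1)) phi ->
  mu.-integrable Omega (EFin \o (fun x => u x * phi x)).
Proof.
have hp := p2; move=> lu lv.
have p0 : 0 < p by exact: lt_le_trans p2.
have q0 : 0 < p / (p - 1) by rewrite divr_gt0// subr_gt0 (lt_le_trans _ p2)// ltr1n.
have /(LpP mO _ p0)[mu_ fu] := lu; have /(LpP mO _ q0)[mv fv] := lv.
have pq : p^-1 + (p / (p - 1))^-1 = 1.
  by rewrite invf_div mulrBl mul1r divff ?gt_eqF//; lra.
have iu : mu.-integrable Omega (EFin \o (fun x => `|u x| `^ p)).
  apply/integrableP; split; first exact: measurable_powR_norm.
  by under eq_integral do rewrite gee0_abs ?lee_fin ?powR_ge0//.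
have iv : mu.-integrable Omega (EFin \o (fun x => `|phi x| `^ (p / (p - 1)))).
  apply/integrableP; split; first exact: measurable_powR_norm.
  by under eq_integral do rewrite gee0_abs ?lee_fin ?powR_ge0//.
apply: (le_integrable mO (g := EFin \o
    (fun x => `|u x| `^ p + `|phi x| `^ (p / (p - 1))))).
- by apply/measurable_EFinP; exact: measurable_funM.
- move=> x _ /=; rewrite lee_fin [leRHS]ger0_norm ?addr_ge0 ?powR_ge0// normrM.
  apply: le_trans (conjugate_powR (normr_ge0 _) (normr_ge0 _) p0 q0 pq) _.
  apply: lerD.
    by rewrite ler_pdivrMr// ler_peMr// powR_ge0.
  rewrite ler_pdivrMr// ler_peMr// ?powR_ge0// ler_pdivlMr ?mul1r; lra.
- exact: (integrableD mO iu iv).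
Qed.

Lemma L2_inner_lin a u v phi : Lp Omega p u -> Lp Omega p v ->
  Lp Omega (p / (p - 1)) phi ->
  L2_inner Omega (a \*o u \+ v) phi = a * L2_inner Omega u phi + L2_inner Omega v phi.
Proof.
move=> lu lv lphi.
have iu := Lp_conjugate_integrable lu lphi; have iv := Lp_conjugate_integrable lv lphi.
rewrite /L2_inner -RintegralZl// -RintegralD//; last exact: (integrableZl mO a iu).
by apply: eq_Rintegral => x _ /=; ring.
Qed.

Lemma neg_powA_lin a w u w' u' : neg_powA Omega p alpha w u ->
  neg_powA Omega p alpha w' u' ->
  neg_powA Omega p alpha (a \*o w \+ w') (a \*o u \+ u').
Proof.
move=> [lw lu [r hr gr]] [lw' lu' [r' hr' gr']].
split; [exact: Lp_lin|exact: Lp_lin|].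
exists (fun t => a \*o r t \+ r' t) => [t t0|phi lphi g].
  have [d e] := hr t t0; have [d' e'] := hr' t t0.
  split; first exact: domA_lin.
  move: (opA_lin oO bO p2 a d d') e e'; apply: filterS3 => x /= e0 e e' Ox.
  by rewrite e0//= -e// -e'//; ring.
have [/= i1 E1] := gr _ lphi; have [/= i2 E2] := gr' _ lphi.
pose h t := t `^ (- alpha) * L2_inner Omega (r t) phi.
pose h' t := t `^ (- alpha) * L2_inner Omega (r' t) phi.
have mI : measurable (`]0%R, +oo[ : set (measurableTypeR R)) by exact: measurable_itv.
have gE (t : R) : 0 < t -> a * h t + h' t = g t.
  move=> t0; rewrite /g L2_inner_lin//; first by rewrite /h /h'; ring.
  - by have [[[]]] := hr t t0.
  - by have [[[]]] := hr' t t0.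
split.
  have := integrableD mI (integrableZl mI a i1) i2.
  apply: eq_integrable => // t /set_mem /=; rewrite in_itv /= andbT => t0.
  by rewrite /= -EFinM -EFinD -gE.
have -> : \int[lam]_(t in `]0%R, +oo[) g t = \int[lam]_(t in `]0%R, +oo[) (a * h t + h' t).
  by apply: eq_Rintegral => t /set_mem /=; rewrite in_itv /= andbT => t0; rewrite gE.
rewrite L2_inner_lin// E1 E2 RintegralD//; last exact: (integrableZl mI a i1).
rewrite RintegralZl//; ring.
Qed.

Lemma Xalpha_lin a u u' : Xalpha Omega p alpha u -> Xalpha Omega p alpha u' ->
  Xalpha Omega p alpha (a \*o u \+ u').
Proof. by move=> [w h] [w' h']; exists (a \*o w \+ w'); exact: neg_powA_lin. Qed.

End fractional_powers.

Section fractional_bound.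
Context (R : realType) (n : nat) (Omega : set 'rV[R]_n.+1) (p alpha : R).
Hypotheses (oO : open Omega) (bO : bounded_set Omega) (p2 : 2 <= p).
Hypotheses (alpha0 : 0 < alpha) (alpha1 : alpha < 1).
Local Notation mu := (leb R n.+1).
Local Notation lam := (@lebesgue_measure R).
Local Notation nrm := (normL2 mu Omega).
Implicit Types (u v w phi : 'rV[R]_n.+1 -> R).

Let mO : measurable Omega := measurable_open_rV oO.
Let fO : (mu Omega < +oo)%E := leb_bounded mO bO.
#[local] Hint Resolve mO fO : core.

(** Balakrishnan's formula is tested against u itself, which belongs to the dual
    space as p / (p - 1) <= 2 <= p; the resolvent at t has L^2 norm at most
    1 / (t + c). *)
Lemma neg_powA_bound : exists2 K : R, 0 <= K &
  forall w u, neg_powA Omega p alpha w u -> nrm u <= K * nrm w.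
Proof.
have hp := p2; have [c c0 rb] := resolvent_bound oO bO p2.
have mI : measurable (`]0%R, +oo[ : set (measurableTypeR R)) by exact: measurable_itv.
have iw : lam.-integrable `]0%R, +oo[ (EFin \o weight alpha c).
  apply/integrableP; split; first by apply/measurable_EFinP; exact: measurable_weight.
  rewrite (_ : integral _ _ _ = (\int[lam]_(t in `]0%R, +oo[) (weight alpha c t)%:E)%E).
    exact: integral_weight_lty.
  apply: eq_integral => t /set_mem /=; rewrite in_itv /= andbT => t0.
  by rewrite ger0_norm// weight_ge0.
pose S := sin (pi * alpha) / pi : R.
pose W := \int[lam]_(t in `]0%R, +oo[) weight alpha c t.
exists (`|S| * W).
  rewrite mulr_ge0// Rintegral_ge0// => t /=; rewrite in_itv /= andbT => t0.
  exact: weight_ge0.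
move=> w u [lw lu [r hr gr]].
have sw := Lp_sqint mO fO p2 lw; have su := Lp_sqint mO fO p2 lu.
have lphi : Lp Omega (p / (p - 1)) u.
  apply: Lp_le lu => //; first by rewrite divr_gt0//; lra.
  by rewrite ler_pdivrMr; [nra|lra].
have [/= ig E] := gr u lphi.
have [u0|u0] := eqVneq (nrm u) 0.
  rewrite u0 mulr_ge0 ?nrm_ge0// mulr_ge0// Rintegral_ge0// => t /=.
  rewrite in_itv /= andbT => t0; exact: weight_ge0.
have {}u0 : 0 < nrm u by rewrite lt_neqAle eq_sym u0 nrm_ge0.
rewrite -(ler_pM2r u0) -expr2 (sqr_nrm mu Omega u).
rewrite (_ : dotL2 mu Omega u u = L2_inner Omega u u)// E.
apply: le_trans (ler_norm _) _; rewrite normrM -/S -!mulrA ler_wpM2l//.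
apply: le_trans (le_normr_Rintegral mI ig) _.
rewrite mulrC -RintegralZl//; apply: le_Rintegral => //.
- exact: (integrable_norm ig).
- exact: (integrableZl mI (nrm w * nrm u) iw).
move=> t /=; rewrite in_itv /= andbT => t0.
have [d e] := hr t t0; have sr := domA_sqint oO bO p2 d.
rewrite normrM ger0_norm ?powR_ge0//.
rewrite /weight mulrCA ler_wpM2l ?powR_ge0//.
apply: le_trans (cauchy_schwarz mO sr su) _.
rewrite mulrAC ler_pM2r//; exact: rb.
Qed.

Lemma Xalpha_bound : exists2 K : R, 0 <= K &
  forall u, Xalpha Omega p alpha u ->
    sqint mu Omega u /\ nrm u <= K * Xalpha_norm Omega p alpha u.
Proof.
have [K K0 h] := neg_powA_bound.
exists (K * Num.sqrt (fine (mu Omega) + 1)).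
  by rewrite mulr_ge0.
move=> u Xu; have pu := @getPex _ [set w | neg_powA Omega p alpha w u] Xu.
have [lw lu _] := pu; split; first exact: Lp_sqint lu.
apply: le_trans (h _ _ pu) _; rewrite -mulrA ler_wpM2l//.
exact: nrm_le_Lp_norm.
Qed.

End fractional_bound.

(** * Compactness of eigenspaces *)

(** A rate is imposed so that the selected functions converge almost everywhere
    through [fast_cvg_ae]. The selection s need not be monotone: j <= s j is
    enough for quantities that grow along the original sequence. *)
Lemma bolzano_weierstrass (R : realType) (r : nat) (c : nat -> 'rV[R]_r) (M : R) :
  (forall k i, `|c k 0 i| <= M) ->
  exists (c0 : 'rV[R]_r) (s : nat -> nat), forall j,
    (j <= s j)%N /\ forall i, `|c (s j) 0 i - c0 0 i| <= 2^-1 ^+ j.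
Proof.
move=> cM; have := @compact_cbox R r (fun=> - M) (fun=> M) (c @ \oo) _.
have inb : (c @ \oo) (cbox (fun=> - M) (fun=> M)).
  by exists 0%N => // k _; apply/cboxP => i; rewrite -ler_norml.
move=> /(_ _ inb)[c0 [_ clc]].
have /choice[s sP] : forall j, exists k, (j <= k)%N /\ forall i, `|c k 0 i - c0 0 i| <= 2^-1 ^+ j.
  move=> j; have e0 : 0 < 2^-1 ^+ j :> R by rewrite exprn_gt0// invr_gt0.
  have A : (c @ \oo) (c @` [set k | (j <= k)%N]).
    rewrite /fmap /=; apply: (filterS _ (nbhs_infty_ge j)) => k jk; by exists k.
  have [_ [[k jk <-] kb]] := clc _ _ A (nbhsx_ballx c0 _ e0).
  by exists k; split=> // i; have [_ kb0] := kb; have := kb0 0 i; rewrite /ball /= distrC => /ltW.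
by exists c0, s.
Qed.

(** A linear space V of square-integrable functions whose norm is controlled by
    finitely many functionals <., q i> has a relatively compact unit ball. *)
Section finite_rank_compactness.
Context d (T : measurableType d) (R : realType).
Variables (mu : {measure set T -> \bar R}) (D : set T).
Hypothesis mD : measurable D.
Local Notation ip := (dotL2 mu D).
Local Notation nrm := (normL2 mu D).
Variables (V : set (T -> R)) (N : nat) (q : 'I_N -> T -> R) (C : R).
Hypothesis V_sqint : forall v, V v -> sqint mu D v.
Hypothesis V_nonempty : V !=set0.
Hypothesis V_lin : forall a v w, V v -> V w -> V (a \*o v \+ w).
Hypothesis q_sqint : forall i, sqint mu D (q i).
Hypothesis V_ip_le : forall v, V v -> ip v v <= C * \sum_i ip v (q i) ^+ 2.

Let coords (v : T -> R) : 'rV[R]_N := \row_i ip v (q i).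

Let coords_lin a v w : V v -> V w -> coords (a \*o v \+ w) = a *: coords v + coords w.
Proof.
move=> /V_sqint sv /V_sqint sw; apply/rowP => i.
by rewrite !mxE ipDl ?ipZl//; exact: sqintZ.
Qed.

Let V0 : V (cst 0).
Proof.
have [v Vv] := V_nonempty; have := V_lin (-1) Vv Vv.
by congr V; apply/funext => x /=; rewrite mulN1r addNr.
Qed.

Let lin_comb r (c : 'rV[R]_r) (v : 'I_r -> T -> R) x := \sum_i c 0 i * v i x.

Let V_comb r (c : 'rV[R]_r) (v : 'I_r -> T -> R) : (forall i, V (v i)) ->
  V (lin_comb c v) /\ coords (lin_comb c v) = \sum_i c 0 i *: coords (v i).
Proof.
move=> Vv.
suff h (s : seq 'I_r) : V (fun x => \sum_(i <- s) c 0 i * v i x) /\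
    coords (fun x => \sum_(i <- s) c 0 i * v i x) = \sum_(i <- s) c 0 i *: coords (v i).
  exact: h.
elim: s => [|i s [ih1 ih2]].
  rewrite big_nil; under eq_fun do rewrite big_nil.
  by split; [exact: V0|apply/rowP => i; rewrite !mxE ip0l].
rewrite big_cons -ih2; under eq_fun do rewrite big_cons.
by split; [exact: V_lin|exact: coords_lin].
Qed.

(** The coordinate vectors of the family v have the largest possible rank, so
    they span the coordinate vectors of V; an element of V with zero coordinates
    has norm 0. P recovers the coefficients from the coordinates. *)
Let V_basis : exists r (v : 'I_r -> T -> R) (P : 'M[R]_(N, r)),
  (forall i, V (v i)) /\
  forall w, V w -> nrm (w \- lin_comb (coords w *m P) v) = 0.
Proof.
pose rk (k : nat) := `[< exists m (v : 'I_m -> T -> R), (forall i, V (v i)) /\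
  \rank (\matrix_i coords (v i)) = k >].
have rk0 : exists k, rk k.
  exists 0; apply/asboolP; exists 0, (fun=> cst 0); split=> //.
  by apply/eqP; rewrite -leqn0 rank_leq_row.
have rkN k : rk k -> (k <= N)%N.
  by move=> /asboolP[m [v [_ <-]]]; exact: rank_leq_col.
have [k /asboolP[r [v [Vv vk]]] kmax] := ex_maxnP rk0 rkN.
pose B := \matrix_i coords (v i).
exists r, v, (pinvmx B); split=> // w Vw.
have wB : (coords w <= B)%MS.
  apply: contraT => wB; have /rank_ltmx : (B < B + coords w)%MS.
    by rewrite ltmxE addsmxSl /= addsmx_sub submx_refl.
  rewrite ltnNge addsmxE -/B => /negP[]; rewrite [\rank B]vk; apply: kmax.
  apply/asboolP; exists (r + 1)%N, (fun i => if fintype.split i is inl j then v j else w).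
  split=> [i|]; first by case: fintype.split.
  congr mxrank; apply/row_matrixP => i; rewrite rowK.
  case: split_ordP => j ->; rewrite ?rowKu ?rowKd ?rowK//.
  by apply/rowP => l; rewrite !mxE.
have [Vc cc] := V_comb (coords w *m pinvmx B) Vv.
set z := lin_comb _ _ in Vc cc *.
have cz : coords z = coords w.
  rewrite cc -[RHS](mulmxKpV wB) [RHS]mulmx_sum_row.
  by apply: eq_bigr => i _; rewrite rowK.
have Vwz : V (w \- z).
  by have := V_lin (-1) Vc Vw; congr V; apply/funext => x /=; rewrite mulN1r addrC.
have c0 i : ip (w \- z) (q i) = 0.
  rewrite ipBl//; [|exact: V_sqint|exact: V_sqint].
  by have := congr1 (fun M : 'rV_N => M 0 i) cz; rewrite !mxE => ->; rewrite subrr.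
have := V_ip_le Vwz; rewrite big1 ?mulr0 => [h|i _]; last by rewrite c0 expr0n.
by rewrite /normL2 (le_anti (introT andP (conj h (ip_ge0 _ _ _)))) sqrtr0.
Qed.

(** The coefficients of u_k on the basis are bounded, being linear in the
    functionals; a selection of them converges. *)
Lemma bounded_selection (u : nat -> T -> R) :
  (forall k, V (u k)) -> (forall k, nrm (u k) <= 1) ->
  exists (u0 : T -> R) (s : nat -> nat) (K : R), V u0 /\
    forall j, (j <= s j)%N /\ nrm (u (s j) \- u0) <= K * 2^-1 ^+ j.
Proof.
move=> Vu u1; have [r [v [P [Vv Pv]]]] := V_basis.
pose c k := coords (u k) *m P.
have cM k i : `|c k 0 i| <= \sum_i \sum_j nrm (q j) * `|P j i|.
  rewrite mxE (le_trans (ler_norm_sum _ _ _))//.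
  rewrite [leRHS](bigD1 i)//= ler_wpDr//.
    by apply: sumr_ge0 => l _; apply: sumr_ge0 => j _; rewrite mulr_ge0// nrm_ge0.
  apply: ler_sum => j _; rewrite normrM ler_wpM2r// mxE.
  apply: le_trans (cauchy_schwarz mD (V_sqint (Vu k)) (q_sqint j)) _.
  by rewrite ler_piMl// nrm_ge0.
have [c0 [s sP]] := bolzano_weierstrass cM.
have [Vc0 _] := V_comb c0 Vv.
exists (lin_comb c0 v), s, (\sum_i nrm (v i)); split=> // j.
have [js cs] := sP j; split=> //.
have Sv i : sqint mu D (v i) by exact: V_sqint.
have [Vc _] := V_comb (c (s j)) Vv.
have [Vd _] := V_comb (c (s j) - c0) Vv.
(* The first term is null by the choice of the basis. *)
have split_u : u (s j) \- lin_comb c0 v =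
    (u (s j) \- lin_comb (c (s j)) v) \+ lin_comb (c (s j) - c0) v.
  apply/funext => x /=; rewrite -addrA; congr (_ + _).
  rewrite addrC /lin_comb -!sumrN -big_split/=; apply: eq_bigr => i _.
  by rewrite !mxE; ring.
rewrite split_u (le_trans (nrmD mD _ _))//.
- by apply: sqintB => //; exact: V_sqint.
- exact: V_sqint.
rewrite Pv// add0r.
suff h (l : seq 'I_r) : sqint mu D (fun x => \sum_(i <- l) (c (s j) - c0) 0 i * v i x) /\
   nrm (fun x => \sum_(i <- l) (c (s j) - c0) 0 i * v i x) <= (\sum_(i <- l) nrm (v i)) * 2^-1 ^+ j.
  exact: (h _).2.
elim: l => [|i l [ih1 ih2]].
  under eq_fun do rewrite big_nil.
  have n0 : nrm (cst 0) = 0 by rewrite /normL2 ip0l// sqrtr0.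
  by split; [exact: sqint0|rewrite big_nil mul0r [X in X <= _]n0].
under eq_fun do rewrite big_cons.
have si : sqint mu D ((c (s j) - c0) 0 i \*o v i) by exact: sqintZ.
split; first exact: (sqintD mD si ih1).
rewrite (le_trans (nrmD mD si ih1))// big_cons mulrDl lerD//.
rewrite nrmZ// mulrC ler_wpM2l ?nrm_ge0//.
by have -> : (c (s j) - c0) 0 i = c (s j) 0 i - c0 0 i by rewrite mxE [X in _ + X]mxE.
Qed.

End finite_rank_compactness.

Section eigenspace.
Context (R : realType) (n : nat) (Omega : set 'rV[R]_n) (p m : R).
Hypotheses (oO : open Omega) (bO : bounded_set Omega) (p2 : 2 <= p).
Local Notation mu := (leb R n).
Local Notation ip := (dotL2 mu Omega).
Local Notation nrm := (normL2 mu Omega).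

Let mO : measurable Omega := measurable_open_rV oO.
Let fO : (mu Omega < +oo)%E := leb_bounded mO bO.
#[local] Hint Resolve mO fO : core.

Lemma kerA_sqint u : kerA Omega p m u -> sqint mu Omega u.
Proof. by move=> [d _]; exact: domA_sqint d. Qed.

Lemma kerA_energy u : kerA Omega p m u -> ip (opA Omega p u) u = m * nrm u ^+ 2.
Proof.
move=> ku; have su := kerA_sqint ku; have [d e] := ku.
rewrite sqr_nrm -(ipZl mO m su su); apply: (ip_ae mO) => //.
- by case: (Lp_sqint mO fO p2 (opA_Lp oO bO p2 d)).
- by case: (sqintZ mO m su).
- by case: su.
Qed.

(** On an eigenspace the energy is a multiple of the squared norm, so that the
    inequality with a small energy term leaves finitely many functionals. *)
Lemma kerA_selection (u : nat -> 'rV[R]_n -> R) :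
  (forall k, kerA Omega p m (u k)) -> (forall k, nrm (u k) <= 1) ->
  exists (u0 : 'rV[R]_n -> R) (s : nat -> nat) (K : R), kerA Omega p m u0 /\
    forall j, (j <= s j)%N /\ nrm (u (s j) \- u0) <= K * 2^-1 ^+ j.
Proof.
move=> ku u1.
(* With this e, the energy term e m |v|^2 is at most half of |v|^2. *)
have e0 : 0 < (2 * (`|m| + 1))^-1 by rewrite invr_gt0 mulr_gt0// ltr_wpDl.
have [T [Q [C [mQ C0 H]]]] := energy_rellich oO bO p2 e0.
have sQ (i : 'I_#|T|) : sqint mu Omega (\1_(Q (enum_val i)) : 'rV[R]_n -> R).
  apply: (sqint_bounded mO (a := 1)) => // x _.
  by rewrite indicE; case: (_ \in _); rewrite ?normr1 ?normr0.
apply: (bounded_selection (D := Omega) mO (q := fun i : 'I_#|T| => \1_(Q (enum_val i)))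
  (C := 2 * C)) => //.
- by move=> v; exact: kerA_sqint.
- by exists (u 0).
- by move=> a v w; exact: kerA_lin.
- move=> v kv; have [d _] := kv; have := H v d.
  rewrite (kerA_energy kv) sqr_nrm (reindex_onto (enum_val : 'I_#|T| -> T) enum_rank)/=; last first.
    by move=> i _; rewrite enum_rankK.
  rewrite (eq_bigl predT) => [h|i]; last by rewrite enum_valK eqxx.
  have i0 := ip_ge0 mu Omega v.
  have : (2 * (`|m| + 1))^-1 * (m * ip v v) <= 2^-1 * ip v v.
    rewrite mulrA ler_wpM2r// mulrC ler_pdivrMr ?mulr_gt0// ?ltr_wpDl//.
    rewrite mulrA mulVf// mul1r; have := ler_norm m; lra.
  rewrite -mulrA; move: h; set S := C * _; set q := _ * (m * _); lra.
Qed.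

End eigenspace.

(** * The Landesman-Lazer limit *)

Section superposition.
Context (R : realType) (n : nat).
Local Notation mu := (leb R n).
Implicit Types (U : set 'rV[R]_n) (w : 'rV[R]_n -> R) (f : 'rV[R]_n -> R -> R).

Lemma continuous_uncons :
  continuous (fun z : 'rV[R]_n.+1 => ((uncons_rV z).2, (uncons_rV z).1) : 'rV[R]_n * R).
Proof.
move=> z A /nbhs_ballP[e /= e0 eA]; apply/nbhs_ballP; exists e => //= y [_ zy].
apply: eA; split=> /=; last exact: zy.
by split=> // i j; rewrite !mxE; exact: zy.
Qed.

(** The graph map x |-> (w x, x) is measurable, and the preimage of an interval
    under f is open in U x R. *)
Lemma measurable_superposition U f w : open U ->
  {within U `*` [set: R], continuous (fun z : 'rV[R]_n * R => f z.1 z.2)} ->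
  measurable_fun U w -> measurable_fun U (fun x => f x (w x)).
Proof.
move=> oU cf mw; have mU := measurable_open_rV oU.
apply: (measurability _ (RGenOpens.measurableE R)) => _ [_ [a [b ->] <-]].
pose A := (U `*` [set: R]) `&` (fun z : 'rV[R]_n * R => f z.1 z.2) @^-1` `]a, b[%classic.
have oUT : open (U `*` [set: R]).
    rewrite (_ : _ `*` _ = fst @^-1` U); last by apply/seteqP; split=> -[x s] //= [].
    apply: open_comp => // x _; exact: cvg_fst.
have oA : open A.
  rewrite /A (@open_setSI _ (U `*` [set: R]))//.
  by move/continuousP: cf; apply; exact: interval_open.
pose h x : 'rV[R]_n.+1 := cons_rV ((w \_ U) x : measurableTypeR R, x).
have mh : measurable_fun setT h.
  apply: (measurableT_comp (@measurable_cons_rV R n)).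
  apply/measurable_fun_pairP; split; last exact: measurable_id.
  exact/(measurable_restrictT w mU).
pose g (z : 'rV[R]_n.+1) : 'rV[R]_n * R := ((uncons_rV z).2, (uncons_rV z).1).
have gh x : U x -> g (h x) = (x, w x).
  by move=> Ux; rewrite /g /h cons_rVK patchE mem_set.
have oB : open (g @^-1` A) by move/continuousP: continuous_uncons; exact.
rewrite (_ : _ `&` _ = U `&` h @^-1` (g @^-1` A)).
  apply: measurableI => //; rewrite -[X in measurable X]setTI; apply: mh => //.
  exact: measurable_open_rV.
apply/seteqP; split=> x [Ux hx]; split=> //.
  by change (A (g (h x))); rewrite gh.
by have : A (g (h x)) by []; rewrite gh// => -[].
Qed.

End superposition.

Section landesman_lazer_limit.
Context (R : realType) (n : nat) (Omega : set 'rV[R]_n).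
Context (f : 'rV[R]_n -> R -> R) (fp fm : 'rV[R]_n -> R) (M : R).
Local Notation mu := (leb R n).
Local Notation ip := (dotL2 mu Omega).
Hypotheses (oO : open Omega) (fO : (mu Omega < +oo)%E).
Hypothesis cf : {within Omega `*` [set: R], continuous (fun z : 'rV[R]_n * R => f z.1 z.2)}.
Hypothesis fM : forall x s, Omega x -> `|f x s| <= M.
Hypotheses (cfp : {within Omega, continuous fp}) (cfm : {within Omega, continuous fm}).
Hypothesis fpP : forall x, Omega x -> f x s @[s --> +oo] --> fp x.
Hypothesis fmP : forall x, Omega x -> f x s @[s --> -oo] --> fm x.
Implicit Types (u w : 'rV[R]_n -> R).

Let mO : measurable Omega := measurable_open_rV oO.

Lemma sqint_nemytskii w : measurable_fun Omega w -> sqint mu Omega (nemytskii f w).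
Proof.
move=> mw; apply: (sqint_bounded mO fO (a := M)).
  exact: measurable_superposition.
by move=> x Ox; exact: fM.
Qed.

(** Dominated convergence; the product vanishes on the zero set of u, whatever F
    does there. *)
Let convergent_factor (F : nat -> 'rV[R]_n -> R) (g u : 'rV[R]_n -> R) :
  (forall k, measurable_fun Omega (F k)) -> (forall k x, Omega x -> `|F k x| <= M) ->
  measurable_fun Omega g -> sqint mu Omega u ->
  {ae mu, forall x, Omega x -> u x != 0 -> F k x @[k --> \oo] --> g x} ->
  ip (F k) u @[k --> \oo] --> ip g u.
Proof.
move=> mF FM mg su Fg; have [mu_ _] := su.
have iu : mu.-integrable Omega (EFin \o (fun x => M * `|u x|)).
  have := integrable_norm (sqint_mul mO (sqint_cst mO M fO) su).
  apply: le_integrable => //=.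
    by apply/measurable_EFinP; apply: measurable_funM => //; apply: measurableT_comp.
  by move=> x _; rewrite /= lee_fin !normrM !normr_id.
have [|||||ig _ h] := @dominated_convergence _ _ _ mu Omega mO
  (fun k x => (F k x * u x)%:E) (fun x => (g x * u x)%:E) (fun x => (M * `|u x|)%:E).
- by move=> k; apply/measurable_EFinP; exact: measurable_funM.
- by apply/measurable_EFinP; exact: measurable_funM.
- apply: filterS Fg => x Fx Ox; apply: cvg_EFin; first exact: nearW.
  have [u0|u0] := eqVneq (u x) 0.
    rewrite u0 mulr0 (_ : fine \o _ = cst 0); first exact: cvg_cst.
    by apply/funext => k /=; rewrite mulr0.
  by apply: cvgM; [exact: Fx|exact: cvg_cst].
- exact: iu.
- by apply: aeW => x k Ox; rewrite lee_fin normrM ler_wpM2r// FM.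
apply: fine_cvg; rewrite /ip /dotL2 /Rintegral fineK//.
exact: integrable_fin_num.
Qed.

(** The pairing is split along the positive and negative parts of u: F tends to
    fp on the support of the former and to fm on that of the latter. *)
Lemma landesman_lazer_limit (w : nat -> 'rV[R]_n -> R) u :
  (forall k, measurable_fun Omega (w k)) -> sqint mu Omega u ->
  {ae mu, forall x, Omega x -> (0 < u x -> w k x @[k --> \oo] --> +oo) /\
                               (u x < 0 -> w k x @[k --> \oo] --> -oo)} ->
  ip (nemytskii f (w k)) u @[k --> \oo] --> landesman_lazer Omega fp fm u.
Proof.
move=> mw su wu; have [mu_ _] := su.
pose up x := Num.max (u x) 0; pose um x := Num.min (u x) 0.
have sup : sqint mu Omega up.
  apply: (sqint_le mO _ _ su); first exact: measurable_maxr.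
  by move=> x _; rewrite /up; case: (lerP (u x) 0) => h; rewrite ?normr0.
have sum : sqint mu Omega um.
  apply: (sqint_le mO _ _ su); first exact: measurable_minr.
  by move=> x _; rewrite /um; case: (lerP (u x) 0) => h; rewrite ?normr0.
have uE : u = up \+ um.
  apply/funext => x; rewrite /up /um /=.
  by case: (lerP (u x) 0) => h; rewrite ?add0r ?addr0.
have mfp : measurable_fun Omega fp by exact: continuous_measurable_rV.
have mfm : measurable_fun Omega fm by exact: continuous_measurable_rV.
have bound g (F : set_system R) : ProperFilter F ->
    (forall x, Omega x -> f x s @[s --> F] --> g x) -> forall x, Omega x -> `|g x| <= M.
  move=> FF gP x Ox.
  apply: (cvgr_to_le (F := F) (f := fun s => `|f x s|)).
    exact: cvg_norm (gP _ Ox).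
  by apply: nearW => s; exact: fM.
have sfp : sqint mu Omega fp by apply: (sqint_bounded mO fO mfp); exact: (bound _ +oo).
have sfm : sqint mu Omega fm by apply: (sqint_bounded mO fO mfm); exact: (bound _ -oo).
have LL : landesman_lazer Omega fp fm u = ip fp up + ip fm um.
  congr (_ + _); rewrite Rintegral_mkcondr; apply: eq_Rintegral => x _.
    rewrite patchE /up /=; case: ifPn => [/set_mem /=|/negP ux].
      by move=> h; rewrite max_l// ltW.
    by rewrite max_r ?mulr0// leNgt; apply/negP => h; apply: ux; exact/mem_set.
  rewrite patchE /um /=; case: ifPn => [/set_mem /=|/negP ux].
    by move=> h; rewrite min_l// ltW.
  by rewrite min_r ?mulr0// leNgt; apply/negP => h; apply: ux; exact/mem_set.
rewrite LL (_ : (fun k => ip _ u) = (fun k => ip (nemytskii f (w k)) up + ip (nemytskii f (w k)) um)); last first.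
  by apply/funext => k; rewrite {1}uE ipDr//; exact: sqint_nemytskii.
have mF k : measurable_fun Omega (nemytskii f (w k)) by case: (sqint_nemytskii (mw k)).
have FM k x : Omega x -> `|nemytskii f (w k) x| <= M by exact: fM.
apply: cvgD; apply: convergent_factor => //; apply: filterS wu => x wx Ox.
  rewrite /up; case: (lerP (u x) 0) => [_|u0 _]; first by rewrite eqxx.
  by have [/(_ u0) h _] := wx Ox; exact: (cvg_comp _ _ h (fpP Ox)).
rewrite /um; case: (ltrP (u x) 0) => [u0 _|_]; last by rewrite eqxx.
by have [_ /(_ u0) h] := wx Ox; exact: (cvg_comp _ _ h (fmP Ox)).
Qed.

End landesman_lazer_limit.

(** * Behaviour at infinity along an eigenspace *)

Lemma cvg_rescaled (R : realType) (N a : nat -> R) (l : R) :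
  N j @[j --> \oo] --> +oo -> a j @[j --> \oo] --> l -> 0 < l ->
  N j * a j @[j --> \oo] --> +oo.
Proof.
move=> Ny al l0; apply/cvgryPge => A.
have l2 : l / 2 < l by rewrite ltr_pdivrMr//; lra.
have l20 : 0 < l / 2 by rewrite divr_gt0.
have N0 : \forall j \near \oo, `|A| / (l / 2) <= N j by move/cvgryPge: Ny; apply.
have a0 := cvgr_ge l al _ l2.
near=> j; rewrite (le_trans (ler_norm A))// -[`|A|](divfK (lt0r_neq0 l20)).
rewrite ler_pM// ?divr_ge0// ?(ltW l0)//; first by near: j.
by near: j; exact: a0.
Unshelve. all: by end_near. Qed.

Section resonance.
Context (R : realType) (n : nat) (Omega : set 'rV[R]_n) (p m M : R).
Context (f : 'rV[R]_n -> R -> R) (fp fm : 'rV[R]_n -> R).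
Hypotheses (oO : open Omega) (bO : bounded_set Omega) (p2 : 2 <= p).
Hypothesis cf : {within Omega `*` [set: R], continuous (fun z : 'rV[R]_n * R => f z.1 z.2)}.
Hypothesis fM : forall x s, Omega x -> `|f x s| <= M.
Hypotheses (cfp : {within Omega, continuous fp}) (cfm : {within Omega, continuous fm}).
Hypothesis fpP : forall x, Omega x -> f x s @[s --> +oo] --> fp x.
Hypothesis fmP : forall x, Omega x -> f x s @[s --> -oo] --> fm x.
Local Notation mu := (leb R n).
Local Notation ip := (dotL2 mu Omega).
Local Notation nrm := (normL2 mu Omega).

Let mO : measurable Omega := measurable_open_rV oO.
Let fO : (mu Omega < +oo)%E := leb_bounded mO bO.
#[local] Hint Resolve mO fO : core.

Lemma nrm_nemytskii w : measurable_fun Omega w ->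
  nrm (nemytskii f w) <= nrm (cst M).
Proof.
move=> mw; apply: ler_wsqrtr; have sF := sqint_nemytskii oO fO cf fM mw.
apply: le_Rintegral => //; [exact: sqint_mul|apply: sqint_mul => //; exact: sqint_cst|].
move=> x Ox /=; rewrite -!expr2 -(real_normK (num_real (nemytskii f w x))).
by rewrite ler_pXn2r ?nnegrE// ?(le_trans _ (fM (w x) Ox))//; exact: fM.
Qed.

(** With N = |X|, U = X / N and F = f (., X + Y), the quantity equals
    <F, u> + <F, U - u> + <F, Z> / N, where U --> u along the selection. The last
    two terms tend to 0 because F is bounded. *)
Lemma resonance_limit (X Y Z : nat -> 'rV[R]_n -> R) (KY KZ : R) :
  (forall k, kerA Omega p m (X k)) -> (forall k, 2 ^+ k <= nrm (X k)) ->
  (forall k, sqint mu Omega (Y k)) -> (forall k, nrm (Y k) <= KY) ->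
  (forall k, sqint mu Omega (Z k)) -> (forall k, nrm (Z k) <= KZ) ->
  exists u, [/\ kerA Omega p m u, ~ ae_eq mu Omega u (cst 0) &
    exists (s : nat -> nat) (N : nat -> R), (forall j, 0 < N j) /\
      (N j)^-1 * (ip (nemytskii f (X (s j) \+ Y (s j))) (X (s j)) +
                  ip (nemytskii f (X (s j) \+ Y (s j))) (Z (s j)))
        @[j --> \oo] --> landesman_lazer Omega fp fm u].
Proof.
move=> kX X2 sY nY sZ nZ.
have X0 k : 0 < nrm (X k) by rewrite (lt_le_trans _ (X2 k))// exprn_gt0.
have sX k : sqint mu Omega (X k) by exact: kerA_sqint (kX k).
pose U k := (nrm (X k))^-1 \*o X k.
have kU k : kerA Omega p m (U k).
  have k0 := kerA_lin oO bO p2 (-1) (kX k) (kX k).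
  have := kerA_lin oO bO p2 (nrm (X k))^-1 (kX k) k0.
  by congr (kerA _ _ _); apply/funext => x /=; rewrite mulN1r addNr addr0.
have sU k : sqint mu Omega (U k) by exact: sqintZ.
have nU k : nrm (U k) = 1.
  by rewrite nrmZ// gtr0_norm ?invr_gt0// mulVf// gt_eqF.
have U1 k : nrm (U k) <= 1 by rewrite nU.
have [u [s [K [ku sP]]]] := kerA_selection oO bO p2 kU U1.
have su := kerA_sqint oO bO p2 ku.
pose N j := nrm (X (s j)).
have N0 j : 0 < N j by exact: X0.
have N2 j : 2 ^+ j <= N j.
  by rewrite (le_trans _ (X2 _))// ler_eXn2l ?ltr1n//; case: (sP j).
have Ninv j : (N j)^-1 <= 2^-1 ^+ j.
  by rewrite exprVn lef_pV2 ?posrE ?exprn_gt0.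
have geo c : c * 2^-1 ^+ j @[j --> \oo] --> (0 : R).
  rewrite -(mulr0 c); apply: cvgM; first exact: cvg_cst.
  by apply: cvg_expr; rewrite ger0_norm ?invr_ge0// invf_lt1 ?ltr1n.
(* V and W are the two perturbations of u in (X + Y) / N = u + V + W. *)
pose V j := U (s j) \- u.
pose W j := (N j)^-1 \*o Y (s j).
have sV j : sqint mu Omega (V j) by exact: sqintB.
have sW j : sqint mu Omega (W j) by exact: sqintZ.
have nV j : nrm (V j) <= K * 2^-1 ^+ j by case: (sP j).
have nW j : nrm (W j) <= KY * 2^-1 ^+ j.
  rewrite nrmZ// gtr0_norm ?invr_gt0// mulrC ler_pM ?nrm_ge0 ?invr_ge0//.
  exact: ltW.
have aeV := fast_cvg_ae mO sV nV.
have aeW_ := fast_cvg_ae mO sW nW.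
have Ny : N j @[j --> \oo] --> +oo.
  apply: (ger_cvgy (f := fun j => j%:R)); last exact: cvgr_idn.
  apply: nearW => j; rewrite (le_trans _ (N2 j))// -natrX ler_nat ltnW//.
  exact: ltn_expl.
exists u; split=> //.
  move=> u0; have : nrm (U (s j)) @[j --> \oo] --> nrm u.
    apply: (nrm_cvg mO) => //; apply: (squeeze_cvgr (f := cst 0) (h := fun j => K * 2^-1 ^+ j)).
    - by apply: nearW => j; rewrite nrm_ge0 nV.
    - exact: cvg_cst.
    - exact: geo.
  rewrite (_ : (fun j => _) = cst 1); last by apply/funext => j; rewrite nU.
  move=> /(cvg_unique (@norm_hausdorff _ R) (@cvg_cst _ _ _ _ _)).
  rewrite (nrm_ae oO su (sqint0 _ mO) u0)// /normL2 ip0l// sqrtr0 => /eqP.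
  by rewrite oner_eq0.
exists s, N; split=> //.
pose w j := X (s j) \+ Y (s j).
have sw j : sqint mu Omega (w j) by exact: sqintD.
have mw j : measurable_fun Omega (w j) by case: (sw j).
have lim := landesman_lazer_limit oO fO cf fM cfp cfm fpP fmP mw su.
have {lim} lim : ip (nemytskii f (w j)) u @[j --> \oo] --> landesman_lazer Omega fp fm u.
  apply: lim; apply: filterS2 aeV aeW_ => x cV cW Ox.
  have cUW : U (s j) x + W j x @[j --> \oo] --> u x.
    rewrite (_ : (fun j => _) = (fun j => V j x + u x + W j x)); last first.
      by apply/funext => j; rewrite /V /= subrK.
    rewrite -[X in _ --> X]addr0 -[X in _ --> X + _]add0r.
    exact: cvgD (cvgD (cV Ox) (cvg_cst (u x))) (cW Ox).
  have wE j : w j x = N j * (U (s j) x + W j x).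
    by rewrite /w /U /W /= mulrDr !mulrA divff ?gt_eqF// !mul1r.
  split=> ux.
    rewrite (_ : (fun j => _) = (fun j => N j * (U (s j) x + W j x))); last exact/funext.
    exact: cvg_rescaled ux.
  apply/cvgNry; rewrite (_ : - _ = (fun j => N j * - (U (s j) x + W j x))); last first.
    by apply/funext => j; rewrite mulrN -wE.
  by apply: (cvg_rescaled Ny (cvgN cUW)); rewrite oppr_gt0.
have sF j := sqint_nemytskii oO fO cf fM (mw j).
have nF j := nrm_nemytskii (mw j).
have nM := nrm_ge0 mu Omega (cst M).
pose D j := ip (nemytskii f (w j)) (V j) + (N j)^-1 * ip (nemytskii f (w j)) (Z (s j)).
have D0 : D j @[j --> \oo] --> (0 : R).
  apply/norm_cvg0P.
  apply: (squeeze_cvgr (f := cst 0) (h := fun j => (nrm (cst M) * (K + KZ)) * 2^-1 ^+ j)).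
  - apply: nearW => j; rewrite normr_ge0 /=.
    rewrite (le_trans (ler_normD _ _))// mulrDr mulrDl lerD//.
      rewrite (le_trans (cauchy_schwarz mO (sF j) (sV j)))// -mulrA.
      by rewrite ler_pM ?nrm_ge0.
    rewrite normrM gtr0_norm ?invr_gt0// mulrC ler_pM ?invr_ge0// ?(ltW (N0 j))//.
    rewrite (le_trans (cauchy_schwarz mO (sF j) (sZ (s j))))//.
    by rewrite ler_pM ?nrm_ge0.
  - exact: cvg_cst.
  - exact: geo.
rewrite -[X in _ --> X]addr0.
rewrite (_ : (fun j => _) = (fun j => ip (nemytskii f (w j)) u + D j)); first exact: cvgD.
apply/funext => j.
have XE : X (s j) = N j \*o U (s j).
  by apply/funext => x; rewrite /U /= mulrA divff ?mul1r// gt_eqF.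
rewrite -/(w j) [X in ip _ X + _]XE (ipZr mO)// mulrDr mulrA mulVf ?gt_eqF// mul1r addrA.
by rewrite /V (ipBr mO)//; ring.
Qed.

End resonance.

(** * Uniformity over balls *)

Section balls.
Context (R : realType) (n : nat) (Omega : set 'rV[R]_n.+1) (p alpha : R).
Context (lam : nat -> R) (k : nat).
Hypotheses (oO : open Omega) (bO : bounded_set Omega) (p2 : 2 <= p).
Hypotheses (alpha0 : 0 < alpha) (alpha1 : alpha < 1).
Local Notation mu := (leb R n.+1).
Local Notation nrm := (normL2 mu Omega).

Let mO : measurable Omega := measurable_open_rV oO.
Let fO : (mu Omega < +oo)%E := leb_bounded mO bO.
#[local] Hint Resolve mO fO : core.

(** Since X^alpha is a linear space, the difference of y and the centre of the
    ball belongs to it and is bounded in L^2 by [Xalpha_bound]. *)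
Lemma ball_pm_bounded c (r : R) : Xalpha_pm Omega p alpha lam k c ->
  exists K : R, forall y, ball_pm Omega p alpha lam k c r y ->
    sqint mu Omega y /\ nrm y <= K.
Proof.
have XE v : Xalpha_pm Omega p alpha lam k v -> Xalpha Omega p alpha v.
  move=> [vp [vm [[Xp _] [Xm _] ->]]].
  have := Xalpha_lin oO bO p2 1 Xp Xm.
  by congr (Xalpha _ _ _); apply/funext => x /=; rewrite mul1r.
move=> /XE Xc; have [K K0 h] := Xalpha_bound oO bO p2 alpha0 alpha1.
have [sc _] := h _ Xc.
exists (K * r + nrm c) => y [/XE Xy yr].
have [sy _] := h _ Xy; split=> //.
have [|sd nd] := h (y \- c).
  have := Xalpha_lin oO bO p2 (-1) Xc Xy.
  by congr (Xalpha _ _ _); apply/funext => x /=; rewrite mulN1r addrC.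
rewrite (_ : y = (y \- c) \+ c); last by apply/funext => x /=; rewrite subrK.
rewrite (le_trans (nrmD mO sd sc))// lerD2r (le_trans nd)// ler_wpM2l//.
exact: ltW.
Qed.

Lemma ball_ker_bounded m c (r : R) : kerA Omega p m c ->
  exists K : R, forall z, ball_ker Omega p m c r z ->
    sqint mu Omega z /\ nrm z <= K.
Proof.
move=> kc; have sc := kerA_sqint oO bO p2 kc.
exists (r + nrm c) => z [kz zr]; have sz := kerA_sqint oO bO p2 kz.
split=> //; have sd := sqintB mO sz sc.
rewrite (_ : z = (z \- c) \+ c); last by apply/funext => x /=; rewrite subrK.
rewrite (le_trans (nrmD mO sd sc))// lerD2r.
by move: zr; rewrite Lp_norm2// => /ltW.
Qed.

End balls.

Section dichotomy.
Context (R : realType) (n : nat) (Omega : set 'rV[R]_n.+1) (p alpha M : R).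
Context (lam : nat -> R) (k : nat).
Context (f : 'rV[R]_n.+1 -> R -> R) (fp fm : 'rV[R]_n.+1 -> R).
Hypotheses (oO : open Omega) (bO : bounded_set Omega) (p2 : 2 <= p).
Hypotheses (alpha0 : 0 < alpha) (alpha1 : alpha < 1).
Hypothesis cf : {within Omega `*` [set: R], continuous (fun z : 'rV[R]_n.+1 * R => f z.1 z.2)}.
Hypothesis fM : forall x s, Omega x -> `|f x s| <= M.
Hypotheses (cfp : {within Omega, continuous fp}) (cfm : {within Omega, continuous fm}).
Hypothesis fpP : forall x, Omega x -> f x s @[s --> +oo] --> fp x.
Hypothesis fmP : forall x, Omega x -> f x s @[s --> -oo] --> fm x.
Local Notation mu := (leb R n.+1).

(** Taking for C the open positive or negative half-line gives the two halves of
    the dichotomy. If no radius works, the conclusion fails for kernel elements of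
    norm at least 2^i for every i, although by [resonance_limit] the rescaled
    values have a limit in the open set C. *)
Lemma resonance_uniform c1 (r1 : R) c2 (r2 : R) (C : set R) :
  Xalpha_pm Omega p alpha lam k c1 -> kerA Omega p (lam k) c2 ->
  open C -> (forall c t, 0 < c -> C t -> C (c * t)) ->
  (forall u, kerA Omega p (lam k) u -> ~ ae_eq mu Omega u (cst 0) ->
     C (landesman_lazer Omega fp fm u)) ->
  exists2 rho : R, 0 < rho &
    forall y z x, ball_pm Omega p alpha lam k c1 r1 y ->
      ball_ker Omega p (lam k) c2 r2 z ->
      kerA Omega p (lam k) x -> rho <= Lp_norm Omega 2 x ->
      C (L2_inner Omega (nemytskii f (x \+ y)) x +
           L2_inner Omega (nemytskii f (x \+ y)) z).
Proof.
move=> Xc kc oC coneC LL.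
have [KY yP] := ball_pm_bounded oO bO p2 alpha0 alpha1 r1 Xc.
have [KZ zP] := ball_ker_bounded oO bO p2 r2 kc.
apply: contrapT => no_rho.
pose bad i (t : ('rV[R]_n.+1 -> R) * ('rV[R]_n.+1 -> R) * ('rV[R]_n.+1 -> R)) :=
  [/\ ball_pm Omega p alpha lam k c1 r1 t.1.1, ball_ker Omega p (lam k) c2 r2 t.1.2,
    kerA Omega p (lam k) t.2, 2 ^+ i <= Lp_norm Omega 2 t.2 &
    ~ C (L2_inner Omega (nemytskii f (t.2 \+ t.1.1)) t.2 +
           L2_inner Omega (nemytskii f (t.2 \+ t.1.1)) t.1.2)].
have /choice[t tP] : forall i, exists t, bad i t.
  move=> i; apply: contrapT => good; apply: no_rho; exists (2 ^+ i); first exact: exprn_gt0.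
  move=> y z x yb zb xk xi; apply: contrapT => nrel; apply: good.
  by exists (y, z, x).
have kX i : kerA Omega p (lam k) (t i).2 by case: (tP i).
have X2 i : 2 ^+ i <= normL2 mu Omega (t i).2.
  rewrite -(Lp_norm2 (measurable_open_rV oO) (kerA_sqint oO bO p2 (kX i))).
  by case: (tP i).
have [u [ku u0 [s [N [N0 lim]]]]] := resonance_limit oO bO p2 cf fM cfp cfm fpP fmP kX X2
  (fun i => (yP _ (let: And5 h _ _ _ _ := tP i in h)).1)
  (fun i => (yP _ (let: And5 h _ _ _ _ := tP i in h)).2)
  (fun i => (zP _ (let: And5 _ h _ _ _ := tP i in h)).1)
  (fun i => (zP _ (let: And5 _ h _ _ _ := tP i in h)).2).
have [j _ /(_ j (leqnn j)) Cj] := lim _ (open_nbhs_nbhs (conj oC (LL _ ku u0))).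
have := coneC _ _ (N0 j) Cj; rewrite mulrA divff ?gt_eqF// mul1r.
by case: (tP (s j)).
Qed.

End dichotomy.

Theorem theorem4p1 (R : realType) (n : nat) (Omega : set 'rV[R]_n)
    (f : 'rV[R]_n -> R -> R) (nu alpha p lambda : R) (lam : nat -> R) (k : nat)
    (fp fm : 'rV[R]_n -> R) :
  (0 < n)%N ->
  open Omega -> bounded_set Omega -> smooth_boundary Omega ->
  continuous_cyl Omega f -> bounded_cyl Omega f ->
  locally_lipschitz_s Omega f ->
  C1_cyl Omega f ->
  (forall x, Omega x -> derive1 (f x) 0 = nu) ->
  (forall x, Omega x -> f x 0 = 0) ->
  3%:R / 4%:R < alpha -> alpha < 1 ->
  (2 * n)%:R <= p -> 2%:R <= p ->
  eigenvalue_enum Omega p lam -> lambda = lam k ->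
  {within Omega, continuous fp} -> {within Omega, continuous fm} ->
  (forall x, Omega x -> f x s @[s --> +oo] --> fp x) ->
  (forall x, Omega x -> f x s @[s --> -oo] --> fm x) ->
  ((forall u, kerA Omega p lambda u -> ~ ae_eq (leb R n) Omega u (cst 0) ->
      0 < landesman_lazer Omega fp fm u) ->
   forall c1 (r1 : R) c2 (r2 : R),
     Xalpha_pm Omega p alpha lam k c1 -> 0 < r1 ->
     kerA Omega p lambda c2 -> 0 < r2 ->
     exists2 rho : R, 0 < rho &
       forall y z x, ball_pm Omega p alpha lam k c1 r1 y ->
         ball_ker Omega p lambda c2 r2 z ->
         kerA Omega p lambda x -> rho <= Lp_norm Omega 2 x ->
         - L2_inner Omega (nemytskii f (x \+ y)) z
           < L2_inner Omega (nemytskii f (x \+ y)) x) /\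
  ((forall u, kerA Omega p lambda u -> ~ ae_eq (leb R n) Omega u (cst 0) ->
      landesman_lazer Omega fp fm u < 0) ->
   forall c1 (r1 : R) c2 (r2 : R),
     Xalpha_pm Omega p alpha lam k c1 -> 0 < r1 ->
     kerA Omega p lambda c2 -> 0 < r2 ->
     exists2 rho : R, 0 < rho &
       forall y z x, ball_pm Omega p alpha lam k c1 r1 y ->
         ball_ker Omega p lambda c2 r2 z ->
         kerA Omega p lambda x -> rho <= Lp_norm Omega 2 x ->
         L2_inner Omega (nemytskii f (x \+ y)) x
           < - L2_inner Omega (nemytskii f (x \+ y)) z).
Proof.
move=> n0 oO bO _ cf [M fM] _ _ _ _ alpha0 alpha1 _ p2 _ -> cfp cfm fpP fmP.
case: n => [//|n] in Omega f fp fm n0 oO bO cf fM cfp cfm fpP fmP *.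
have {}alpha0 : 0 < alpha by apply: lt_trans alpha0; rewrite divr_gt0.
have {}cf : {within Omega `*` [set: R], continuous (fun z : 'rV[R]_n.+1 * R => f z.1 z.2)}.
  apply: continuous_subspaceW cf => -[x s] [Ox _]; split=> //; exact: subset_closure.
have {}fM x s : Omega x -> `|f x s| <= M by move=> Ox; apply: fM; exact: subset_closure.
split=> LL c1 r1 c2 r2 Xc1 _ kc2 _.
  have [|c t c0 t0|//|rho rho0 h] := resonance_uniform oO bO p2 alpha0 alpha1 cf fM
    cfp cfm fpP fmP r1 r2 (C := [set t | 0 < t]) Xc1 kc2.
  - exact: open_gt.
  - exact: mulr_gt0.
  exists rho => // y z x yb zb kx xr.
  by have := h y z x yb zb kx xr; rewrite /= -ltrBlDr sub0r.
have [|c t c0 t0|//|rho rho0 h] := resonance_uniform oO bO p2 alpha0 alpha1 cf fM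
  cfp cfm fpP fmP r1 r2 (C := [set t | t < 0]) Xc1 kc2.
- exact: open_lt.
- by rewrite /= pmulr_rlt0.
exists rho => // y z x yb zb kx xr.
by have := h y z x yb zb kx xr; rewrite /= -ltrBrDr sub0r.
Qed.
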